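(* Let $0\le\beta<4$. (i) For every $\alpha>0$ and every $u\in W^{2,2}(\mathbb{R}^4)$, $$\int_{\mathbb{R}^4}\frac{e^{\alpha u^2}-1}{|x|^\beta}dx<\infty.$$ (ii) Let $\tau>0$ and $\sigma>0$ be constants. For every $\alpha<32\pi^2\left(1-\frac{\beta}{4}\right)$, $$\sup\left\{\int_{\mathbb{R}^4}\frac{e^{\alpha u^2}-1}{|x|^\beta}dx:\ u\in W^{2,2}(\mathbb{R}^4),\ \int_{\mathbb{R}^4}\left(|\Delta u|^2+\tau|\nabla u|^2+\sigma u^2\right)dx\le 1\right\}<\infty.$$ (iii) For every $\alpha>32\pi^2\left(1-\frac{\beta}{4}\right)$, the supremum in (ii) is infinite.
   Context: $W^{2,2}(\mathbb{R}^4)$ is the usual Sobolev space of functions on $\mathbb{R}^4$ with square-integrable derivatives up to order two. *)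

(* Defs.v *)
From HB Require Import structures.
From mathcomp Require Import all_boot all_order all_algebra.
From mathcomp Require Import all_classical all_reals all_analysis.
Set Implicit Arguments. Unset Strict Implicit. Unset Printing Implicit Defensive.
Import Order.TTheory GRing.Theory Num.Theory.
Import numFieldNormedType.Exports.
Local Open Scope classical_set_scope.
Local Open Scope ring_scope.

(* Points of R^4, represented as ((x1, x2), x3), x4 so that Lebesgue measure
   on R^4 is the iterated product of one-dimensional Lebesgue measures. *)
Definition pt4 (R : realType) := (((R * R) * R) * R)%type.

Section R4.
Variable R : realType.

Definition coord (i : 'I_4) (x : pt4 R) : R :=
  match val i with
  | 0 => x.1.1.1 | 1 => x.1.1.2 | 2 => x.1.2 | _ => x.2 end.

Definition upd (i : 'I_4) (t : R) (x : pt4 R) : pt4 R :=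
  match val i with
  | 0 => (((t, x.1.1.2), x.1.2), x.2)
  | 1 => (((x.1.1.1, t), x.1.2), x.2)
  | 2 => ((x.1.1, t), x.2)
  | _ => (x.1, t) end.

Definition norm4 (x : pt4 R) : R := Num.sqrt (\sum_(i < 4) coord i x ^+ 2).

Definition leb4 : set (pt4 R) -> \bar R :=
  (((@lebesgue_measure R \x @lebesgue_measure R) \x @lebesgue_measure R)
     \x @lebesgue_measure R)%E.

Definition partial (i : 'I_4) (f : pt4 R -> R) (x : pt4 R) : R :=
  derive1 (fun t => f (upd i t x)) (coord i x).

Fixpoint dpart (l : seq 'I_4) (f : pt4 R -> R) : pt4 R -> R :=
  if l is i :: l' then partial i (dpart l' f) else f.

Definition smooth4 (f : pt4 R -> R) : Prop :=
  (forall (l : seq 'I_4) (i : 'I_4) (x : pt4 R),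
      derivable (fun t => dpart l f (upd i t x)) (coord i x) 1) /\
  (forall l : seq 'I_4, continuous (dpart l f)).

Definition test_fun (f : pt4 R -> R) : Prop :=
  smooth4 f /\ exists M : R, forall x, M < norm4 x -> f x = 0.

Definition L2 (f : pt4 R -> R) : Prop :=
  measurable_fun setT f /\ leb4.-integrable setT (fun x => (f x ^+ 2)%:E).

Definition weak_deriv (l : seq 'I_4) (u g : pt4 R -> R) : Prop :=
  forall phi, test_fun phi ->
    (\int[leb4]_x (u x * dpart l phi x)%:E =
     ((-1) ^+ size l)%:E * \int[leb4]_x (g x * phi x)%:E)%E.

Definition W22 (u : pt4 R -> R) : Prop :=
  L2 u /\
  (forall i, exists g, L2 g /\ weak_deriv [:: i] u g) /\
  (forall i j, exists g, L2 g /\ weak_deriv [:: i; j] u g).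

(* \int (|Delta u|^2 + tau |grad u|^2 + sigma u^2) <= 1, expressed via the
   (a.e. unique) weak derivatives g_i = d_i u and h_i = d_i d_i u *)
Definition energy_le1 (tau sigma : R) (u : pt4 R -> R) : Prop :=
  exists (g h : 'I_4 -> pt4 R -> R),
    (forall i, L2 (g i) /\ weak_deriv [:: i] u (g i)) /\
    (forall i, L2 (h i) /\ weak_deriv [:: i; i] u (h i)) /\
    (\int[leb4]_x ((\sum_(i < 4) h i x) ^+ 2
                   + tau * \sum_(i < 4) g i x ^+ 2 + sigma * u x ^+ 2)%:E
       <= 1%:E)%E.

Definition AT_functional (alpha beta : R) (u : pt4 R -> R) : \bar R :=
  (\int[leb4]_x ((expR (alpha * u x ^+ 2) - 1) / (norm4 x `^ beta))%:E)%E.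

Definition AT_sup (alpha beta tau sigma : R) : \bar R :=
  ereal_sup [set AT_functional alpha beta u | u in [set u | W22 u /\ energy_le1 tau sigma u]].

End R4.

(* Main.v *)
(** With [s = |y-x|^2] and a cutoff [chi], the weak form of the Laplacian tested against
  [chi(s) / (s + c)] and the limit [c -> 0], taken after averaging [x] over boxes, bound [|u x|]
  for almost every [x] by [A + \int_(s < 1) |Delta u y| / (4 pi^2 s) dy], with [A] controlled by
  the L2 norm of [u].  Splitting [1/s = 1/(s+c) + c/(s(s+c))], Cauchy-Schwarz and
  [\int_(s < 1) (s+c)^-2 dy <= pi^2 (3 - ln c)] bound the first part by
  [|Delta u|_2 sqrt((3 - ln c) / (16 pi^2))], and Chebyshev bounds the measure of the set where
  the second part exceeds 1 by a multiple of [c^(2-2k)].  Choosing [c] at each level gives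
  Gaussian decay of the level sets of [u] at every rate below [32 pi^2 / |Delta u|_2^2]; the
  weight [|x|^-beta] is absorbed by weighted AM-GM.  Part (i) writes [Delta u] as a bounded
  function plus one of small L2 norm.  Part (iii) uses the functions
  [chi(|x|^2) ln(1/(|x|^2 + c))], of energy [16 pi^2 ln(1/c) + O(1)]. *)

Require Import Defs.
From HB Require Import structures.
From mathcomp Require Import all_boot all_order all_algebra.
From mathcomp Require Import all_classical all_reals all_analysis.
From mathcomp Require Import measurable_realfun lebesgue_integral_fubini.
From mathcomp Require Import ring lra.
Set Implicit Arguments. Unset Strict Implicit. Unset Printing Implicit Defensive.
Import Order.TTheory GRing.Theory Num.Theory.
Import numFieldNormedType.Exports.
Local Open Scope classical_set_scope.
Local Open Scope ring_scope.
Local Notation coord := Defs.coord.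

(** Origin of the constant: 1/(4 pi^2 (s + c)) has squared L2 norm - ln c / (16 pi^2) + O(1) on s <
    1, so a potential of height t with |Delta u|_2 = a corresponds to ln c = - 16 pi^2 t^2 / a^2;
    the remainder of the kernel has L1 mass of order c^(1-k), and Chebyshev applied to the square of
    its potential doubles that exponent, hence 32 pi^2. Sharpness survives the crude estimates
    because each of them shifts t or ln c by a bounded amount only, which adds linear terms to a
    quadratic exponent; the loss k is paid by the strict inequality on alpha. Two obstacles shape
    the rest. First, u is determined only almost everywhere, so the approximate identity cannot be
    evaluated against it at a point; averaged over a box, it falls on the indicator instead, which
    is locally constant off the faces. Second, radial integrals are computed without polar
    coordinates: powers of s + c are integrated one coordinate at a time through t = sqrt(b)
    tan(theta), and other radial integrals are compared with these. The variable is the squared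
    distance s because it is smooth at the origin. *)

Section Prodm.
Context d1 d2 (T1 : measurableType d1) (T2 : measurableType d2) (R : realType).
Variables (m1 : {sigma_finite_measure set T1 -> \bar R}) (m2 : {sigma_finite_measure set T2 -> \bar R}).
(* A copy of the product measure that carries a sigma-finite structure, so that products can be iterated. *)
Definition prodm : set (T1 * T2)%type -> \bar R := (m1 \x m2)%E.
HB.instance Definition _ := Measure.on prodm.
Let prodm_sigma_finite : sigma_finite setT prodm.
Proof.
have /sigma_finiteP[F [TF ndF Foo]] := sigma_finiteT m1.
have /sigma_finiteP[G [TG ndG Goo]] := sigma_finiteT m2.
exists (fun n => F n `*` G n).
  rewrite -setXTT TF TG predeqE => -[x y]; split.
    move=> [/= [n _ Fnx] [k _ Gky]]; exists (maxn n k) => //; split.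
    - by move: x Fnx; exact/subsetPset/ndF/leq_maxl.
    - by move: y Gky; exact/subsetPset/ndG/leq_maxr.
  by move=> [n _ []/= ? ?]; split; exists n.
move=> k; have [? ?] := Foo k; have [? ?] := Goo k.
split; first exact: measurableX.
by rewrite /prodm product_measure1E// lte_mul_pinfty// ge0_fin_numE.
Qed.
HB.instance Definition _ := Measure_isSigmaFinite.Build _ _ _ prodm prodm_sigma_finite.
Definition prodms : {sigma_finite_measure set (T1 * T2)%type -> \bar R} := prodm.

(** The push-forward under the product map agrees with the product measure on rectangles, and
    uniqueness of product measures does the rest. Iterated, this yields translation invariance on
    R^4. *)
Lemma prodms_pres (f1 : T1 -> T1) (f2 : T2 -> T2) :
  measurable_fun setT f1 -> measurable_fun setT f2 ->
  (forall A, measurable A -> m1 (f1 @^-1` A) = m1 A) ->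
  (forall A, measurable A -> m2 (f2 @^-1` A) = m2 A) ->
  forall A, measurable A -> prodms ((fun p => (f1 p.1, f2 p.2)) @^-1` A) = prodms A.
Proof.
move=> mf1 mf2 h1 h2 A mA; pose f := fun p : T1 * T2 => (f1 p.1, f2 p.2).
have mf : measurable_fun setT f.
  by apply: measurable_fun_pair; exact: measurableT_comp.
transitivity (pushforward prodms f A) => //; apply/esym.
have := @product_measure_unique _ _ _ _ _ m1 m2 (pushforward prodms f : {measure set (T1 * T2)%type -> \bar R}).
apply => // B C mB mC.
transitivity (prodms ((f1 @^-1` B) `*` (f2 @^-1` C))) => //.
have mB' : measurable (f1 @^-1` B) by rewrite -[X in measurable X]setTI; exact: mf1.
have mC' : measurable (f2 @^-1` C) by rewrite -[X in measurable X]setTI; exact: mf2.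
by rewrite [LHS]product_measure1E//; congr (_ * _)%E; [exact: h1|exact: h2].
Qed.
End Prodm.

(** * Lebesgue measure on R^4: iterated integrals and translations *)

Section Leb4.
Variable R : realType.

Local Notation lam := (@lebesgue_measure R).
Local Notation lam2 := (lam \x lam)%E.
Local Notation lam3 := (lam2 \x lam)%E.
Local Notation lam4 := (lam3 \x lam)%E.

(* [leb1], [mu4] and the [ll_] are the measures [lam_] on the default Borel display of [R]. *)
Definition leb1 : set R -> \bar R := lam.
HB.instance Definition _ := isMeasure.Build _ R R leb1
  (@measure0 _ _ _ lam) (@measure_ge0 _ _ _ lam) (@measure_semi_sigma_additive _ _ _ lam).
Let leb1_sigma_finite : sigma_finite setT leb1.
Proof. exact: (@sigma_finiteT _ _ _ lam). Qed.
HB.instance Definition _ := Measure_isSigmaFinite.Build _ R R leb1 leb1_sigma_finite.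

Definition mu4 : {sigma_finite_measure set (pt4 R) -> \bar R} := prodms (prodms (prodms leb1 leb1) leb1) leb1.
Lemma int4E (f : pt4 R -> \bar R) : measurable_fun setT f -> (forall x, 0 <= f x)%E ->
  (\int[mu4]_x f x = \int[leb1]_d \int[leb1]_c \int[leb1]_b \int[leb1]_a f (((a, b), c), d))%E.
Proof.
move=> mf f0; rewrite [LHS]fubini_tonelli2//; apply: eq_integral => d _.
rewrite /fubini_G [LHS]fubini_tonelli2//; last exact: (measurableT_comp mf).
apply: eq_integral => c _.
rewrite /fubini_G [LHS]fubini_tonelli2//.
apply: (measurableT_comp mf); apply: measurable_fun_pair => //; exact: measurable_fun_pair.
Qed.

Lemma leb1_shift (a : R) (A : set R) : measurable A -> leb1 ((fun x => x - a) @^-1` A) = leb1 A.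
Proof.
move=> mA.
have ms : measurable_fun setT ((fun x => x - a) : measurableTypeR R -> measurableTypeR R).
  exact: measurable_funB.
transitivity (pushforward lam ((fun x => x - a) : measurableTypeR R -> measurableTypeR R) A) => //.
apply/esym/lebesgue_measure_unique => // _ [[b c]] _ <-.
have e : (fun x => x - a) @^-1` (`]b, c]%classic) = `]b + a, c + a]%classic.
  by apply/seteqP; split => x/=; rewrite !in_itv/= ltrBrDr lerBlDr.
transitivity (lam `]b + a, c + a]); last by rewrite -e.
rewrite !lebesgue_measure_itv/= !lte_fin ltrD2r; case: ifPn => // _.
by rewrite -!EFinB; congr EFin; ring.
Qed.

Definition sub4 (y x : pt4 R) : pt4 R :=
  (((y.1.1.1 - x.1.1.1, y.1.1.2 - x.1.1.2), y.1.2 - x.1.2), y.2 - x.2).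

Lemma measurable_subR a : measurable_fun setT ((fun x => x - a) : R -> R).
Proof. exact: measurable_funB. Qed.

Lemma measurable_sub4 x : measurable_fun setT (sub4^~ x).
Proof.
by do !(apply: measurable_fun_pair => /=); apply: measurable_funB => //;
  do !apply: measurableT_comp => //.
Qed.

Lemma mu4_shift x (A : set (pt4 R)) : measurable A -> mu4 ((sub4^~ x) @^-1` A) = mu4 A.
Proof.
have h2 := prodms_pres (measurable_subR x.1.1.1) (measurable_subR x.1.1.2) (@leb1_shift _) (@leb1_shift _).
have h3 := prodms_pres _ (measurable_subR x.1.2) h2 (@leb1_shift _).
have h4 := prodms_pres _ (measurable_subR x.2) (h3 _) (@leb1_shift _).
apply: h4; do !(apply: measurable_fun_pair => /=); apply: measurable_funB => //;
  do !apply: measurableT_comp => //.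
Qed.

Lemma int4_shift (f : pt4 R -> \bar R) (x : pt4 R) : measurable_fun setT f -> (forall x, 0 <= f x)%E ->
  (\int[mu4]_y f (sub4 y x) = \int[mu4]_y f y)%E.
Proof.
move=> mf f0.
transitivity (\int[pushforward mu4 (sub4^~ x)]_y f y)%E.
  apply/esym; have := @ge0_integral_pushforward _ _ _ _ _ _ (measurable_sub4 x) mu4 setT f measurableT.
  by rewrite preimage_setT; apply => //.
apply: eq_measure_integral => [mT B mB|mT A mA _]; first exact: (measurable_sub4 x mT mB).
exact: (mu4_shift x mA).
Qed.

Let ll2 : set (R * R)%type -> \bar R := lam2.
HB.instance Definition _ := isMeasure.Build _ (R * R)%type R ll2
  (@measure0 _ _ _ lam2) (@measure_ge0 _ _ _ lam2) (@measure_semi_sigma_additive _ _ _ lam2).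

Let ll2E A : measurable A -> ll2 A = prodms leb1 leb1 A.
Proof.
move=> mA; apply/esym.
apply: (@product_measure_unique _ _ _ _ _ leb1 leb1 ll2) => // B C mB mC.
exact: (@product_measure1E _ _ _ _ _ lam lam).
Qed.

Let ll3 : set ((R * R) * R)%type -> \bar R := lam3.
HB.instance Definition _ := isMeasure.Build _ ((R * R) * R)%type R ll3
  (@measure0 _ _ _ lam3) (@measure_ge0 _ _ _ lam3) (@measure_semi_sigma_additive _ _ _ lam3).

Let ll3E A : measurable A -> ll3 A = prodms (prodms leb1 leb1) leb1 A.
Proof.
move=> mA; apply/esym.
apply: (@product_measure_unique _ _ _ _ _ (prodms leb1 leb1) leb1 ll3) => // B C mB mC.
have -> : prodms leb1 leb1 B = ll2 B by rewrite ll2E.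
exact: (@product_measure1E _ _ _ _ _ lam2 lam).
Qed.

Let ll4 : set (pt4 R) -> \bar R := lam4.
HB.instance Definition _ := isMeasure.Build _ (pt4 R) R ll4
  (@measure0 _ _ _ lam4) (@measure_ge0 _ _ _ lam4) (@measure_semi_sigma_additive _ _ _ lam4).

(** Bridge from the measure of the statement to the one carrying sigma-finite instances: at each of
    the three product levels the two agree on rectangles. *)
Lemma leb4_mu4 A : measurable A -> leb4 A = mu4 A.
Proof.
move=> mA; apply/esym.
apply: (@product_measure_unique _ _ _ _ _ (prodms (prodms leb1 leb1) leb1) leb1 ll4) => // B C mB mC.
have -> : prodms (prodms leb1 leb1) leb1 B = ll3 B by rewrite ll3E.
exact: (@product_measure1E _ _ _ _ _ lam3 lam).
Qed.

Lemma leb4_integral f : (\int[@leb4 R]_x f x = \int[mu4]_x f x)%E.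
Proof. by apply: (@eq_measure_integral _ _ _ _ mu4 ll4) => A mA _; exact: leb4_mu4. Qed.

Lemma leb4_integrable f : (@leb4 R).-integrable setT f <-> mu4.-integrable setT f.
Proof.
split => /integrableP[mf fi]; apply/integrableP; split => //.
  by rewrite -leb4_integral.
by rewrite leb4_integral.
Qed.
End Leb4.

(** * The flat function exp(-1/t) and its derivatives *)

Section FlatExp.
Variable R : realType.
Implicit Types (p : {poly R}) (t y : R).

(* Every derivative of [exp(-1/t)] (extended by 0) is again [flat p], with [p] transformed by [dflat]. *)
Definition flat p t : R := if 0 < t then p.[t^-1] * expR (- t^-1) else 0.
Definition dflat p : {poly R} := 'X^2 * (p - p^`()).

(** Termwise [y ^+ i <= i! * expR y], a single term of the exponential series. *)
Lemma poly_le_exp p : exists C : R, 0 <= C /\ forall y, 0 <= y -> `|p.[y]| <= C * expR y.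
Proof.
elim/poly_ind: p => [|p c [C [C0 hC]]].
  by exists 0; split => // y _; rewrite horner0 normr0 mul0r.
suff [C' [C'0 hC']] : exists C' : R, 0 <= C' /\ forall y, 0 <= y -> `|(p * 'X).[y]| <= C' * expR y.
  exists (C' + `|c|); split; first by rewrite addr_ge0.
  move=> y y0; rewrite hornerD hornerC (le_trans (ler_normD _ _))// mulrDl lerD ?hC'//.
  by rewrite ler_peMr// -(expR0) ler_expR.
clear C C0 hC.
pose C := \sum_(i < size (p * 'X)) `|(p * 'X)`_i| * i`!%:R.
exists C; split; first by apply: sumr_ge0 => i _; rewrite mulr_ge0.
move=> y y0; rewrite horner_coef (le_trans (ler_norm_sum _ _ _))// /C mulr_suml.
apply: ler_sum => i _; rewrite normrM -mulrA ler_wpM2l//.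
rewrite ger0_norm ?exprn_ge0//.
case: (i : nat) => [|n].
  by rewrite expr0 fact0 mul1r -expR0 ler_expR.
have := expR_ge1Dxn n y0.
rewrite -ler_pdivrMl; last by rewrite ltr0n fact_gt0.
by rewrite mulrC => h; rewrite (le_trans _ h)// lerDr.
Qed.

(** The exponential bound is applied to [p * 'X] at 1/t: the extra factor 1/t moves to the other
    side as the factor t that gives continuity at 0. *)
Lemma flat_le p : exists C : R, 0 <= C /\ forall t, `|flat p t| <= C * `|t|.
Proof.
have [C [C0 hC]] := poly_le_exp (p * 'X).
exists C; split => // t; rewrite /flat; case: ifPn => t0; last by rewrite normr0 mulr_ge0.
have ti : 0 < t^-1 by rewrite invr_gt0.
have := hC t^-1 (ltW ti); rewrite hornerM hornerX normrM [`|t^-1|]gtr0_norm// => h.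
rewrite normrM (gtr0_norm (expR_gt0 _)) (gtr0_norm t0).
rewrite expRN ler_pdivrMr ?expR_gt0// mulrAC -ler_pdivrMr// .
Qed.

Lemma flat_cts0 p : {for 0, continuous (flat p)}.
Proof.
have [C [C0 hC]] := flat_le p.
have e : flat p 0 = 0 by rewrite /flat ltxx.
rewrite /prop_for /continuous_at e; apply/norm_cvg0P.
apply: (@squeeze_cvgr _ _ _ _ (cst 0) (fun t => C * `|t|)).
- by near=> t; rewrite normr_ge0/= hC.
- exact: cvg_cst.
- rewrite -[X in _ --> X](mulr0 C); apply: cvgMr.
  by rewrite -[X in _ --> X](normr0 R); apply: cvg_norm; exact: cvg_id.
Unshelve. all: by end_near. Qed.

Lemma flat_derive p t : is_derive t 1 (flat p) (flat (dflat p) t).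
Proof.
have [t0|t0|->] := ltgtP t 0.
- rewrite [X in is_derive _ _ _ X]/flat (lt_gtF t0).
  apply: (@near_eq_is_derive _ _ _ (cst 0)).
  near=> z; rewrite /flat ifF//; apply/negbTE; rewrite -leNgt ltW//.
  by near: z; exact: lt_nbhsl.
- rewrite [X in is_derive _ _ _ X]/flat t0.
  apply: (@near_eq_is_derive _ _ _ (fun z : R => p.[z^-1] * expR (- z^-1) : R) (flat p)).
    near=> z; rewrite /flat ifT//.
    by near: z; exact: lt_nbhsr.
  have tn0 : t != 0 by rewrite gt_eqF.
  have dV : is_derive t 1 (fun z : R => z^-1) (- t ^- 2).
    by apply: is_derive_eq; [exact: is_deriveV|rewrite scaler1].
  have dp : is_derive t 1 (fun z : R => p.[z^-1]) (p^`().[t^-1] * - t ^- 2).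
    exact: (@is_derive1_comp _ (horner p) (fun z => z^-1)).
  have de : is_derive t 1 (fun z : R => expR (- z^-1)) (expR (- t^-1) * (t ^- 2)).
    apply: (@is_derive1_comp _ expR (fun z => - z^-1)).
    by apply: is_derive_eq; rewrite opprK.
  apply: is_derive_eq; rewrite /dflat !hornerE /GRing.scale/= exprVn; ring.
(* At 0 the difference quotient of [flat p] is [flat (p * 'X)], of the same family and hence
   continuous there with value 0. *)
- apply/is_derive1_caratheodory; exists (flat (p * 'X)); split.
  + move=> z; rewrite /flat ltxx !subr0; case: ifPn => z0; last by rewrite mul0r.
    rewrite hornerM hornerX -!mulrA; congr (_ * _).
    by rewrite mulrC -mulrA mulfV ?mulr1// gt_eqF.
  + exact: flat_cts0.
  + by rewrite /flat ltxx.
Unshelve. all: by end_near. Qed.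

Lemma flat_cts p : continuous (flat p).
Proof.
move=> t; apply: differentiable_continuous; apply/derivable1_diffP.
by have [] := flat_derive p t.
Qed.

Lemma flat_bnd p : exists C : R, 0 <= C /\ forall t, t <= 1 -> `|flat p t| <= C.
Proof.
have [C [C0 hC]] := flat_le p; exists C; split => // t t1.
have [t0|t0] := ltP 0 t; last by rewrite /flat ltNge t0/= normr0.
by apply: (le_trans (hC t)); rewrite ger0_norm ?(ltW t0)// ler_piMr.
Qed.

End FlatExp.

(** * A differentiation-closed syntax of smooth functions *)

Section SmoothExpr.
Variable R : realType.
Implicit Types (x y : pt4 R) (i j : 'I_4).

(** The squared Euclidean norm. Kernels are written in terms of it and not of [norm4], which is not
    differentiable at the origin. *)
Definition q4 (z : pt4 R) : R := z.1.1.1 ^+ 2 + z.1.1.2 ^+ 2 + z.1.2 ^+ 2 + z.2 ^+ 2.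

Lemma norm4E z : norm4 z = Num.sqrt (q4 z).
Proof. by rewrite /norm4 !big_ord_recr big_ord0/= add0r. Qed.

Lemma q4_ge0 z : 0 <= q4 z.
Proof. by rewrite /q4 !addr_ge0// sqr_ge0. Qed.

Lemma sqrt_lt_norm4 (r : R) z : Num.sqrt r < norm4 z -> r < q4 z.
Proof. by rewrite norm4E ltNge; apply: contraR; rewrite -leNgt; exact: ler_wsqrtr. Qed.

(* Syntax for the smooth functions of [y] used as test functions; [s] below is [|y - x|^2]:
   [Flt p] is [flat p (1 - s^2)], [Iv] is [1/(s + c)] and [Lg] is [ln (s + c)]. *)
Inductive sexpr := Cst of R | Crd of 'I_4 | Flt of {poly R} | Iv | Lg
  | Add of sexpr & sexpr | Mul of sexpr & sexpr.

Fixpoint ev x (c : R) (e : sexpr) (y : pt4 R) : R :=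
  match e with
  | Cst a => a
  | Crd i => coord i y - coord i x
  | Flt p => flat p (1 - q4 (sub4 y x) ^+ 2)
  | Iv => (q4 (sub4 y x) + c)^-1
  | Lg => ln (q4 (sub4 y x) + c)
  | Add e f => ev x c e y + ev x c f y
  | Mul e f => ev x c e y * ev x c f y
  end.

Let sq e := Mul e e.
Definition Qe := Add (Add (Add (sq (Crd 0)) (sq (Crd 1))) (sq (Crd (inord 2)))) (sq (Crd (inord 3))).

(** Since derivatives of expressions are expressions, [smooth4], which quantifies over all iterated
    partial derivatives, reduces to one differentiation step and to continuity. The numerical
    factors come from the derivative 2 (y_i - x_i) of s. *)
Fixpoint dx i (e : sexpr) : sexpr :=
  match e with
  | Cst a => Cst 0
  | Crd j => Cst (i == j)%:R
  | Flt p => Mul (Flt (dflat p)) (Mul (Mul (Cst (- 4)) (Crd i)) Qe)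
  | Iv => Mul (Mul (Cst (- 2)) (Crd i)) (Mul Iv Iv)
  | Lg => Mul (Mul (Cst 2) (Crd i)) Iv
  | Add e f => Add (dx i e) (dx i f)
  | Mul e f => Add (Mul (dx i e) f) (Mul e (dx i f))
  end.

Lemma evQe x c y : ev x c Qe y = q4 (sub4 y x).
Proof. by rewrite /= /q4 /sub4 /coord/= !inordK//= -!expr2. Qed.

Lemma coord_upd i j t y : coord j (upd i t y) = if i == j then t else coord j y.
Proof.
by case: i => [[|[|[|[|//]]]] hi]; case: j => [[|[|[|[|//]]]] hj]; rewrite /coord /upd.
Qed.

Lemma upd_coord i y : upd i (coord i y) y = y.
Proof. by case: i y => [[|[|[|[|//]]]] hi] [[[a b] d] e]. Qed.

Lemma crd_is_derive i j y a : is_derive (coord i y) 1 (fun t => coord j (upd i t y) - a) (i == j)%:R.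
Proof.
have -> : (fun t => coord j (upd i t y) - a) = (fun t => (if i == j then t else coord j y) - a).
  by apply/funext => t; rewrite coord_upd.
by case: eqP => ij; apply: is_derive_eq; rewrite ?subr0.
Qed.

Lemma q4_is_derive x i y : is_derive (coord i y) 1 (fun t => q4 (sub4 (upd i t y) x))
  (2 * (coord i y - coord i x)).
Proof.
have h j : is_derive (coord i y) 1 (fun t => (coord j (upd i t y) - coord j x) ^+ 2)
   ((i == j)%:R * (2 * (coord i y - coord i x))).
  have := crd_is_derive i j y (coord j x) => hd.
  apply: is_derive_eq; rewrite /GRing.scale/= coord_upd.
  by case: eqP => [<-|_] /=; ring.
have -> : (fun t => q4 (sub4 (upd i t y) x)) =
  (fun t => (coord 0 (upd i t y) - coord 0 x) ^+ 2 + (coord 1 (upd i t y) - coord 1 x) ^+ 2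
   + (coord (inord 2) (upd i t y) - coord (inord 2) x) ^+ 2 + (coord (inord 3) (upd i t y) - coord (inord 3) x) ^+ 2).
  by apply/funext => t; rewrite /q4 /sub4 /coord/= !inordK.
have h0 := h 0; have h1 := h 1; have h2 := h (inord 2); have h3 := h (inord 3).
apply: is_derive_eq; rewrite -!mulrDl.
(* Exactly one of the four indicators [i == j] equals 1. *)
rewrite (_ : _ + _ = 1) ?mul1r//.
rewrite -!natrD; apply/eqP; rewrite -subr_eq0 -[X in _ - X]/(1%:R) -natrB//; last first.
  by case: i {h h0 h1 h2 h3} => [[|[|[|[|//]]]] hi]; rewrite -!val_eqE/= !inordK.
by case: i {h h0 h1 h2 h3} => [[|[|[|[|//]]]] hi]; rewrite -!val_eqE/= !inordK.
Qed.

Lemma ev_is_derive x c i e y : 0 < c ->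
  is_derive (coord i y) 1 (fun t => ev x c e (upd i t y)) (ev x c (dx i e) y).
Proof.
move=> c0; have hq := q4_is_derive x i y.
have qc : 0 < q4 (sub4 y x) + c by rewrite ltr_wpDl ?q4_ge0.
elim: e => [a|j|p| | |e he f hf|e he f hf].
- exact: is_derive_cst.
- exact: crd_is_derive.
- rewrite [ev _ _ _ _]/=.
  apply: (@is_derive_eq _ _ _ _ _ _ _ (flat (dflat p) (1 - q4 (sub4 y x) ^+ 2) * (- (4 * (coord i y - coord i x) * q4 (sub4 y x))))).
    have := flat_derive p (1 - q4 (sub4 y x) ^+ 2); rewrite -{1}(upd_coord i y) => hf.
    apply: (@is_derive1_comp _ (flat p) (fun t => 1 - q4 (sub4 (upd i t y) x) ^+ 2)).
    apply: is_derive_eq; rewrite /GRing.scale/= upd_coord; ring.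
  rewrite -(evQe x c y) /=; ring.
- rewrite /=; apply: is_derive_eq; first by apply: is_deriveV; rewrite upd_coord gt_eqF.
  rewrite /GRing.scale/= upd_coord; move: qc; set w := q4 _ + c => qc.
  have w0 : w != 0 by rewrite gt_eqF.
  by field.
- have hl : is_derive (q4 (sub4 (upd i (coord i y) y) x) + c) 1 (@ln R) (q4 (sub4 y x) + c)^-1.
    by rewrite upd_coord; exact: is_derive1_ln.
  apply: (@is_derive_eq _ _ _ _ _ _ _ ((q4 (sub4 y x) + c)^-1 * (2 * (coord i y - coord i x)))).
    apply: (@is_derive1_comp _ (@ln R) (fun t => q4 (sub4 (upd i t y) x) + c)).
    by apply: is_derive_eq; rewrite addr0.
  by rewrite /= mulrC.
- exact: is_deriveD.
- apply: (is_derive_eq (is_deriveM he hf)); rewrite /GRing.scale/= !upd_coord; ring.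
Qed.

Lemma partial_ev x c i e : 0 < c -> partial i (ev x c e) = ev x c (dx i e).
Proof.
move=> c0; apply/funext => y; rewrite /partial derive1E.
by have [_ ->] := ev_is_derive x i e y c0.
Qed.

Lemma dpart_ev x c l e : 0 < c -> dpart l (ev x c e) = ev x c (foldr dx e l).
Proof. by move=> c0; elim: l => //= i l ->; exact: partial_ev. Qed.

Lemma continuous_coord i : continuous (@coord R i).
Proof.
move=> y; case: i => [[|[|[|[|//]]]] hi]; rewrite /coord/=.
- apply: (@continuous_comp _ _ _ (fun z : pt4 R => z.1) (fun z => z.1.1)); first exact: cvg_fst.
  apply: (@continuous_comp _ _ _ (fun z : R * R * R => z.1) (fun z => z.1)); exact: cvg_fst.
- apply: (@continuous_comp _ _ _ (fun z : pt4 R => z.1) (fun z => z.1.2)); first exact: cvg_fst.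
  apply: (@continuous_comp _ _ _ (fun z : R * R * R => z.1) (fun z => z.2)); [exact: cvg_fst|exact: cvg_snd].
- apply: (@continuous_comp _ _ _ (fun z : pt4 R => z.1) (fun z => z.2)); [exact: cvg_fst|exact: cvg_snd].
- exact: cvg_snd.
Qed.

Lemma continuous_q4 x : continuous (fun y => q4 (sub4 y x)).
Proof.
have h i : continuous (fun y => (coord i y - coord i x) ^+ 2).
  have hc : continuous (fun y => coord i y - coord i x).
    by move=> y; apply: cvgB; [exact: continuous_coord|exact: cvg_cst].
  by move=> y; exact: (cvgM (hc y) (hc y)).
have -> : (fun y => q4 (sub4 y x)) =
  (fun y => (coord 0 y - coord 0 x) ^+ 2 + (coord 1 y - coord 1 x) ^+ 2
   + (coord (inord 2) y - coord (inord 2) x) ^+ 2 + (coord (inord 3) y - coord (inord 3) x) ^+ 2).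
  by apply/funext => t; rewrite /q4 /sub4 /coord/= !inordK.
by move=> y; do !apply: cvgD; exact: h.
Qed.

Lemma continuous_ev x c e : 0 < c -> continuous (ev x c e).
Proof.
move=> c0; have qc y : 0 < q4 (sub4 y x) + c by rewrite ltr_wpDl ?q4_ge0.
have cqc : continuous (fun y => q4 (sub4 y x) + c).
  by move=> y; apply: cvgD; [exact: continuous_q4|exact: cvg_cst].
elim: e => [a|j|p| | |e he f hf|e he f hf] y.
- exact: cvg_cst.
- by apply: cvgB; [exact: continuous_coord|exact: cvg_cst].
- apply: (@continuous_comp _ _ _ (fun y => 1 - q4 (sub4 y x) ^+ 2) (flat p)); last exact: flat_cts.
  by apply: cvgB; [exact: cvg_cst|by apply: cvgM; exact: continuous_q4].
- by apply: cvgV; [rewrite gt_eqF|exact: cqc].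
- apply: (@continuous_comp _ _ _ (fun y => q4 (sub4 y x) + c) (@ln R)); first exact: cqc.
  exact: continuous_ln.
- by apply: cvgD; [exact: he|exact: hf].
- by apply: cvgM; [exact: he|exact: hf].
Qed.

Lemma smooth_ev x c e : 0 < c -> smooth4 (ev x c e).
Proof.
move=> c0; split => [l i y|l]; rewrite dpart_ev//; last exact: continuous_ev.
by have [] := ev_is_derive x i (foldr dx e l) y c0.
Qed.

Lemma q4_tri x y : q4 y <= 2 * q4 (sub4 y x) + 2 * q4 x.
Proof. have h (a b : R) : b ^+ 2 <= 2 * (b - a) ^+ 2 + 2 * a ^+ 2.
  by rewrite -subr_ge0 (_ : _ - _ = (b - 2 * a) ^+ 2) ?sqr_ge0//; ring.
rewrite /q4 /sub4/=.
have := h x.1.1.1 y.1.1.1; have := h x.1.1.2 y.1.1.2; have := h x.1.2 y.1.2; have := h x.2 y.2.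
lra. Qed.

(** The factor [Flt p] vanishes for s >= 1, and [q4_tri] turns this into a bound on |y| itself. *)
Lemma test_fun_ev x c p e : 0 < c -> test_fun (ev x c (Mul (Flt p) e)).
Proof.
move=> c0; split; first exact: smooth_ev.
exists (Num.sqrt (2 + 2 * q4 x)) => y /sqrt_lt_norm4 h.
rewrite /= /flat ltNge (_ : _ - _ <= 0) ?mul0r//.
have := lt_le_trans h (q4_tri x y); rewrite ltrD2r => h1.
by rewrite subr_le0; nra.
Qed.

Lemma measurable_q4 x : measurable_fun setT (fun y => q4 (sub4 y x)).
Proof.
by do !apply: measurable_funD => //; apply: measurable_funX; apply: measurable_funB => //;
  do !apply: measurableT_comp => //.
Qed.

End SmoothExpr.

(** * Continuous functions on R^4 are measurable *)

Section ContMeas.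
Variable R : realType.

Lemma measurable_coord i : measurable_fun setT (@coord R i).
Proof.
by case: i => [[|[|[|[|//]]]] hi]; rewrite /coord/=; do !apply: measurableT_comp => //.
Qed.

Lemma cvgn_pair (U V : topologicalType) (u : nat -> U) (v : nat -> V) (a : U) (b : V) :
  u n @[n --> \oo] --> a -> v n @[n --> \oo] --> b -> (u n, v n) @[n --> \oo] --> ((a, b) : U * V).
Proof.
move=> ua vb.
have h := @filter.cvg_pair nat U V \oo (nbhs a) (nbhs b) _ _ _ u v ua vb.
exact: h.
Qed.

Lemma measurable_fun_countable_fibers d (T : measurableType d) (K : countType) (g : T -> K) (h : K -> R) :
  (forall k, measurable [set x | g x = k]) -> measurable_fun setT (h \o g).
Proof.
move=> mg _ Y mY; rewrite setTI.
rewrite (_ : _ @^-1` Y = \bigcup_n (if @unpickle K n is Some k then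
   (if `[< Y (h k) >] then [set x | g x = k] else set0) else set0)).
  apply: bigcupT_measurable => n; case: unpickle => [k|]; last exact: measurable0.
  by case: ifP => // _; exact: measurable0.
apply/seteqP; split => [x /= Yx|x [n _]].
  by exists (pickle (g x)) => //; rewrite pickleK ifT//; exact/asboolP.
by case: unpickle => [k|//]; case: ifPn => // /asboolP Yk /= e; rewrite /preimage/= e.
Qed.

Let grid (n : nat) (x : pt4 R) : int * int * int * int :=
  (((Num.floor (x.1.1.1 * n.+1%:R), Num.floor (x.1.1.2 * n.+1%:R)), Num.floor (x.1.2 * n.+1%:R)), Num.floor (x.2 * n.+1%:R)).
Let ungrid (n : nat) (k : int * int * int * int) : pt4 R :=
  (((k.1.1.1%:~R / n.+1%:R, k.1.1.2%:~R / n.+1%:R), k.1.2%:~R / n.+1%:R), k.2%:~R / n.+1%:R).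

Let floor_cvg (t : R) : (Num.floor (t * n.+1%:R))%:~R / n.+1%:R @[n --> \oo] --> t.
Proof.
apply: (@squeeze_cvgr _ _ _ _ (fun n => t - n.+1%:R^-1) (cst t)).
- near=> n; apply/andP; split; last first.
    by rewrite ler_pdivrMr ?ltr0n// floor_le.
  rewrite ler_pdivlMr ?ltr0n// mulrBl mulVf ?pnatr_eq0//.
  by have := floorD1_gt (t * n.+1%:R); rewrite intrD; lra.
- rewrite -[X in _ --> X]subr0; apply: cvgB; first exact: cvg_cst.
  exact: cvg_harmonic.
- exact: cvg_cst.
Unshelve. all: by end_near. Qed.

Lemma measurable_floor_fiber (f : pt4 R -> R) k : measurable_fun setT f ->
  measurable [set x | Num.floor (f x) = k].
Proof.
move=> mf.
rewrite (_ : [set _ | _] = f @^-1` `[k%:~R, (k + 1)%:~R[%classic); last first.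
  apply/seteqP; split => x /=; rewrite in_itv/=.
    by move=> <-; rewrite floor_le floorD1_gt.
  by move=> h; apply/floor_def.
rewrite -[X in measurable X]setTI; apply: mf => //.
Qed.

(** The sigma-algebra of [pt4 R] is an iterated product, so open sets are not measurable by
    definition. Instead [f] is a pointwise limit of functions constant on the cells of a grid of
    mesh 1/(n+1), each of which factors through a countable type. *)
Lemma continuous_measurable4 (f : pt4 R -> R) : continuous f -> measurable_fun setT f.
Proof.
move=> cf; apply: (@measurable_fun_cvg _ _ _ setT (fun n => (f \o ungrid n) \o grid n)).
  move=> n; apply: measurable_fun_countable_fibers => -[[[a b] c] e].
  rewrite (_ : [set _ | _] = [set x | Num.floor (coord 0 x * n.+1%:R) = a] `&`
     [set x | Num.floor (coord 1 x * n.+1%:R) = b] `&`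
     [set x | Num.floor (coord (inord 2) x * n.+1%:R) = c] `&`
     [set x | Num.floor (coord (inord 3) x * n.+1%:R) = e]).
    by do !apply: measurableI; apply: measurable_floor_fiber; apply: measurable_funM => //;
     exact: measurable_coord.
  apply/seteqP; split => x /=; rewrite /grid /coord/= !inordK//.
    by case=> -> -> -> ->.
  by case=> -[[-> ->] ->] ->.
move=> x _; apply: (@cvg_comp _ _ _ (fun n => ungrid n (grid n x)) f _ (nbhs x)); last exact: cf.
case: x => [[[a b] c] e].
have h := cvgn_pair (cvgn_pair (cvgn_pair (@floor_cvg a) (@floor_cvg b)) (@floor_cvg c)) (@floor_cvg e).
exact: h.
Qed.

End ContMeas.

(** * The fundamental theorem of calculus on the whole line *)

Section Integrals1D.
Variable R : realType.
Local Notation L := (@lebesgue_measure R).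

Lemma is_derive_continuous (F f : R -> R) : (forall x : R, is_derive x 1 F (f x)) -> continuous F.
Proof.
move=> dF x; apply: differentiable_continuous; apply/derivable1_diffP.
by have [] := dF x.
Qed.

Lemma leb1_lebesgue (f : R -> \bar R) : measurable_fun setT f -> (forall x, 0 <= f x)%E ->
  (\int[@leb1 R]_x f x = \int[L]_x f x)%E.
Proof.
move=> mf f0.
pose phi : measurableTypeR R -> R := fun x => x.
have mphi : measurable_fun setT phi by move=> _ A mA; rewrite setTI.
have := @ge0_integral_pushforward _ _ _ _ R phi mphi L setT f measurableT mf.
rewrite preimage_setT => <-//.
Qed.

(** The line is cut at 0 and the negative half is reflected onto the positive one, where [F] becomes
    [- F (- x)]. *)
Lemma int1_FTC (f F : R -> R) (l1 l2 : R) :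
  (forall x, 0 <= f x) -> continuous f -> (forall x : R, is_derive x 1 F (f x)) ->
  F x @[x --> -oo] --> l1 -> F x @[x --> +oo] --> l2 ->
  (\int[@leb1 R]_x (f x)%:E = (l2 - l1)%:E)%E.
Proof.
move=> f0 cf dF F1 F2.
have mf : measurable_fun setT f by exact: continuous_measurable_fun.
have cF := is_derive_continuous dF.
rewrite leb1_lebesgue; last 2 first.
  exact/measurable_EFinP.
  by move=> x; rewrite lee_fin.
have -> : [set: measurableTypeR R] = `]-oo, 0%R]%classic `|` `]0%R, +oo[%classic.
  by apply/seteqP; split => x //= _; rewrite !in_itv/= andbT; case: leP => ?; [left|right].
rewrite ge0_integral_setU//=; last 3 first.
  by apply/measurable_EFinP; exact: measurable_funTS.
  by move=> x _; rewrite lee_fin.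
  by apply/disj_setPRL => x /=; rewrite !in_itv/= andbT => h; rewrite leNgt h.
have e2 : (\int[L]_(x in `]0%R, +oo[) (f x)%:E = l2%:E - (F 0)%:E)%E.
  rewrite integral_itv_obnd_cbnd; last by apply/measurable_EFinP; exact: measurable_funTS.
  apply: ge0_continuous_FTC2y => //; first exact: continuous_subspaceT.
  - by apply: cvg_at_right_filter; exact: cF.
  - by move=> x _; rewrite derive1E; have [_ ->] := dF x.
have e1 : (\int[L]_(x in `]-oo, 0%R]) (f x)%:E = (F 0)%:E - l1%:E)%E.
  have := @ge0_integration_by_substitution0 R (fun x => (f (- x))%:E).
  have mfN : measurable_fun setT (fun x : R => f (- x)).
    by apply: (measurableT_comp mf).
  move=> /(_ _ _)/esym; under eq_integral do rewrite opprK; move=> ->//; last 2 first.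
    exact/measurable_EFinP.
    by move=> x; rewrite lee_fin.
  rewrite (@ge0_continuous_FTC2y R (fun x => f (- x)) (fun x => - F (- x)) 0 (- l1))//.
  - by rewrite oppr0 -EFinB opprK addrC -EFinB.
  - apply: continuous_subspaceT => x; apply: continuous_comp; [exact: opp_continuous|exact: cf].
  - apply: cvgN; exact: (cvgNy_compNP _ _).1.
  - apply: cvg_at_right_filter; apply: cvgN.
    by apply: continuous_comp; [exact: opp_continuous|exact: cF].
  - move=> x _; rewrite derive1E; have := dF (- x) => h.
    have h2 : is_derive x 1 (fun x => - F (- x)) (f (- x)).
      have hc : is_derive x 1 (F \o -%R) (f (- x) * - 1) by apply: is_derive1_comp.
      have hN := is_deriveN hc.
      by apply: (is_derive_eq hN); rewrite mulrN1 opprK.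
    by have [_ ->] := h2.
by rewrite e1 e2 -!EFinB -EFinD; congr EFin; ring.
Qed.
End Integrals1D.

(** * Radial integrals over R^4 *)

Section RadialIntegrals.
Variable R : realType.
Local Notation mu := (@mu4 R).
Local Notation leb := (@leb1 R).

(** Written as x times the real power -1 of x^2, which is measurable; at 0 both sides take the value
    0. *)
Lemma measurable_invR : measurable_fun [set: R] (fun x : R => x^-1).
Proof.
rewrite (_ : (fun x : R => x^-1) = (fun x => x * (x ^+ 2) `^ (-1))).
  apply: measurable_funM => //.
  by apply: (measurableT_comp (measurable_powR (-1))); exact: measurable_funX.
apply/funext => x; rewrite powR_inv1 ?sqr_ge0//.
have [->|x0] := eqVneq x 0; first by rewrite invr0 mul0r.
by field.
Qed.

Lemma measurable_addV d (T : measurableType d) (f : T -> R) (c : R) :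
  measurable_fun setT f -> measurable_fun setT (fun x => (f x + c)^-1).
Proof. by move=> mf; apply: (measurableT_comp measurable_invR); exact: measurable_funD. Qed.

Lemma measurable_ltR d (T : measurableType d) (f : T -> R) a : measurable_fun setT f ->
    measurable_fun setT (fun y => (f y < a)%R%:R : R).
Proof.
move=> mf; apply: (@measurableT_comp _ _ _ _ _ _ (fun b : bool => (b : nat)%:R : R)) => //.
exact: measurable_fun_ltr.
Qed.

Lemma measurable_gtR d (T : measurableType d) (f : T -> R) a : measurable_fun setT f ->
    measurable_fun setT (fun y => (a < f y)%R%:R : R).
Proof.
move=> mf; rewrite (_ : (fun y => _) = (fun y => (- f y < - a)%R%:R)).
  by apply: measurable_ltR; exact: measurable_funN.
by apply/funext => y; rewrite ltrN2.
Qed.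

Lemma measurable_q4_0 : measurable_fun setT (@q4 R).
Proof.
have := measurable_q4 (((0, 0), 0), 0 : R); apply: eq_measurable_fun => y _.
by rewrite /q4 /sub4/= !subr0.
Qed.

(** [W] is the Wallis integral of cos^n over [-pi/2, pi/2]. The cases n = 0, ..., 4 are exactly what
    the coordinatewise integrations of (s + c)^-2 and (s + c)^-3 consume. *)
Definition cos_primitive (n : nat) (W : R) := exists G : R -> R,
  (forall t : R, is_derive t 1 G (cos t ^+ n)) /\ G (pi / 2) - G (- (pi / 2)) = W.

Lemma cos_primitive0 : cos_primitive 0 pi.
Proof.
exists id; split=> [t|]; first by rewrite expr0; exact: is_derive_id.
by field.
Qed.

Lemma cos_primitive1 : cos_primitive 1 2.
Proof.
exists (@sin R); split=> [t|]; first by rewrite expr1; exact: is_derive_sin.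
by rewrite sinN sin_pihalf; ring.
Qed.

Lemma cos_primitive2 : cos_primitive 2 (pi / 2).
Proof.
exists (fun t => 2^-1 * (t + sin t * cos t)); split=> [t|].
  apply: is_derive_eq; rewrite /GRing.scale/=.
  have := cos2Dsin2 t; set a := sin t; set b := cos t => h.
  have e2 : a ^+ 2 = 1 - b ^+ 2 by rewrite -h; ring.
  transitivity (2^-1 * (1 - a ^+ 2 + b ^+ 2)); first by ring.
  by rewrite e2; field.
by rewrite sinN cosN cos_pihalf; field.
Qed.

Lemma cos_primitive3 : cos_primitive 3 (4 / 3).
Proof.
exists (fun t => sin t - 3^-1 * sin t ^+ 3); split=> [t|].
  apply: is_derive_eq; rewrite /GRing.scale/=.
  have := cos2Dsin2 t; set a := sin t; set b := cos t => h.
  have e : b ^+ 3 = b * (1 - a ^+ 2) by rewrite -h; ring.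
  by rewrite e; field.
by rewrite sinN sin_pihalf; field.
Qed.

Lemma cos_primitive4 : cos_primitive 4 (3 * pi / 8).
Proof.
exists (fun t => 3 / 8 * (t + sin t * cos t) + 4^-1 * (sin t * cos t ^+ 3)); split=> [t|].
  apply: is_derive_eq; rewrite /GRing.scale/=.
  have := cos2Dsin2 t; set a := sin t; set b := cos t => h.
  have e2 : a ^+ 2 = 1 - b ^+ 2 by rewrite -h; ring.
  transitivity (3 / 8 * (1 - a ^+ 2 + b ^+ 2) - 3 / 4 * a ^+ 2 * b ^+ 2 + 4^-1 * b ^+ 4); first by field.
  by rewrite e2; field.
by rewrite sinN cosN cos_pihalf; field.
Qed.

Lemma cos_atan_div (r t : R) : 0 < r -> cos (atan (t / r)) / r = (Num.sqrt (t ^+ 2 + r ^+ 2))^-1.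
Proof.
move=> r0; rewrite cos_atan -invfM; congr (_^-1).
rewrite -{2}(gtr0_norm r0) -sqrtr_sqr -sqrtrM; last by rewrite addr_ge0// sqr_ge0.
by congr Num.sqrt; field; rewrite gt_eqF.
Qed.

(** Substitution t = r tan(theta) with r = sqrt(b): 1/sqrt(t^2 + b) becomes cos(theta)/r and dt
    becomes r/cos(theta)^2, which leaves cos^n and the power n + 1 of 1/r. *)
Lemma int1_sqrt (n : nat) (W K b : R) : cos_primitive n W -> 0 <= K -> 0 < b ->
  (\int[leb]_t (K * (Num.sqrt (t ^+ 2 + b))^-1 ^+ n.+2)%:E = (K * W * (Num.sqrt b)^-1 ^+ n.+1)%:E)%E.
Proof.
move=> [G [dG GW]] K0 b0; set r := Num.sqrt b.
have r0 : 0 < r by rewrite sqrtr_gt0.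
have br : b = r ^+ 2 by rewrite sqr_sqrtr// ltW.
have fE t : (Num.sqrt (t ^+ 2 + b))^-1 = cos (atan (t / r)) / r by rewrite cos_atan_div// br.
have cG := is_derive_continuous dG.
have dat (t : R) : is_derive t 1 (fun t => atan (t / r)) ((cos (atan (t / r))) ^+ 2 * r^-1).
  have h : is_derive t 1 (fun t : R => t / r) r^-1.
    by apply: is_derive_eq; rewrite /GRing.scale/= mulr0 add0r mulr1.
  rewrite cos_atan exprVn sqr_sqrtr; last by rewrite addr_ge0// sqr_ge0.
  exact: (@is_derive1_comp _ (@atan R) (fun t => t / r)).
have cat := is_derive_continuous dat.
have lim1 : (t / r) @[t --> +oo] --> +oo.
  by apply: gt0_cvgMly => //; rewrite invr_gt0.
have laty : atan (t / r) @[t --> +oo] --> pi / 2.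
  by apply: cvg_comp lim1 _; exact: cvgy_atan.
have latNy : atan (t / r) @[t --> -oo] --> - (pi / 2).
  apply/cvgNy_compNP; apply: cvg_trans (cvgN laty).
  by apply: near_eq_cvg; near=> t; rewrite /= mulNr atanN.
have -> : K * W * r^-1 ^+ n.+1 = K * r^-1 ^+ n.+1 * G (pi / 2) - K * r^-1 ^+ n.+1 * G (- (pi / 2)).
  by rewrite -GW; ring.
apply: (@int1_FTC R _ (fun t => K * r^-1 ^+ n.+1 * G (atan (t / r)))).
- by move=> t; rewrite mulr_ge0// exprn_ge0// invr_ge0 sqrtr_ge0.
- have -> : (fun t => K * (Num.sqrt (t ^+ 2 + b))^-1 ^+ n.+2) = (fun t => K * (cos (atan (t / r)) / r) ^+ n.+2).
    by apply/funext => t; rewrite fE.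
  move=> t; apply: cvgM; first exact: cvg_cst.
  have ch : continuous (fun t : R => cos (atan (t / r)) / r).
    move=> z; apply: cvgM; last exact: cvg_cst.
    by apply: continuous_comp; [exact: cat|exact: continuous_cos].
  exact: (cvg_comp _ _ (ch t) (@exprn_continuous R n.+2 _)).
- move=> t; rewrite fE.
  have h := @is_derive1_comp _ G (fun t => atan (t / r)) t _ _ (dG _) (dat t).
  apply: (is_derive_eq (is_deriveZ (K * r^-1 ^+ n.+1) h)); rewrite /GRing.scale/= exprMn !exprS; ring.
- apply: cvgM; first exact: cvg_cst.
  exact: (cvg_comp _ _ latNy (cG _)).
- apply: cvgM; first exact: cvg_cst.
  exact: (cvg_comp _ _ laty (cG _)).
Unshelve. all: by end_near. Qed.

(** Each coordinate lowers the power of 1/sqrt(s + c) by one, from 6 to 2, the remaining coordinates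
    serving as [b]. The constant is (3 pi/8)(4/3)(pi/2) 2 = pi^2/2. *)
Lemma int4_q4_inv3 (c : R) : 0 < c ->
  (\int[mu]_y ((q4 y + c)^-1 ^+ 3)%:E = (pi ^+ 2 / (2 * c))%:E)%E.
Proof.
move=> c0.
have mq := measurable_q4_0.
rewrite int4E; last 2 first.
  by apply/measurable_EFinP; apply: measurable_funX; exact: measurable_addV.
  by move=> y; rewrite lee_fin exprn_ge0// invr_ge0 addr_ge0 ?q4_ge0// ltW.
have sq (s : R) : 0 <= s -> s^-1 ^+ 3 = (Num.sqrt s)^-1 ^+ 6.
  move=> s0; have e : s^-1 = (Num.sqrt s)^-1 ^+ 2 by rewrite exprVn sqr_sqrtr.
  by rewrite e -exprM.
transitivity (\int[leb]_d \int[leb]_x \int[leb]_b (3 * pi / 8 * (Num.sqrt (b ^+ 2 + (x ^+ 2 + (d ^+ 2 + c))))^-1 ^+ 5)%:E)%E.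
  apply: eq_integral => d _; apply: eq_integral => x _; apply: eq_integral => b _.
  have := @int1_sqrt 4 _ 1 (b ^+ 2 + (x ^+ 2 + (d ^+ 2 + c))) cos_primitive4 ler01 _.
  rewrite mul1r => <-; last by rewrite !ltr_wpDl// sqr_ge0.
  apply: eq_integral => a _; rewrite mul1r sq; last by rewrite addr_ge0 ?q4_ge0// ltW.
  by rewrite /q4/=; congr ((Num.sqrt _)^-1 ^+ _)%:E; ring.
transitivity (\int[leb]_d \int[leb]_x (pi / 2 * (Num.sqrt (x ^+ 2 + (d ^+ 2 + c)))^-1 ^+ 4)%:E)%E.
  apply: eq_integral => d _; apply: eq_integral => x _.
  rewrite (int1_sqrt cos_primitive3)//; last 2 first.
    by rewrite divr_ge0// mulr_ge0// pi_ge0.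
    by rewrite !ltr_wpDl// sqr_ge0.
  by congr (_ * _)%:E; field.
transitivity (\int[leb]_d (pi ^+ 2 / 4 * (Num.sqrt (d ^+ 2 + c))^-1 ^+ 3)%:E)%E.
  apply: eq_integral => d _.
  rewrite (int1_sqrt cos_primitive2)//; last 2 first.
    by rewrite divr_ge0// pi_ge0.
    by rewrite !ltr_wpDl// sqr_ge0.
  by congr (_ * _)%:E; field.
rewrite (int1_sqrt cos_primitive1)//; last by rewrite divr_ge0// sqr_ge0.
by rewrite exprVn sqr_sqrtr ?(ltW c0)//; congr EFin; field; rewrite gt_eqF.
Qed.

(** The primitive is ln(d + sqrt(d^2 + c)). With s = sqrt(1 + c) and c = (s - 1)(s + 1), its
    increment over [-1, 1] is 2 ln(1 + s) - ln c, and ln(1 + s) <= s <= 3/2. *)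
Lemma int1_log (c : R) : 0 < c -> c <= 1 ->
  (\int[leb]_d ((d ^+ 2 < 1)%R%:R * (Num.sqrt (d ^+ 2 + c))^-1)%:E <= (3 - ln c)%:E)%E.
Proof.
move=> c0 c1.
pose F (d : R) := ln (d + Num.sqrt (d ^+ 2 + c)).
have sp (d : R) : 0 < d ^+ 2 + c by rewrite ltr_wpDl// sqr_ge0.
have Fp (d : R) : 0 < d + Num.sqrt (d ^+ 2 + c).
  rewrite -ltrBlDl sub0r (le_lt_trans (ler_norm _))// normrN -sqrtr_sqr ltr_sqrt//.
  by rewrite ltrDl.
have dF (d : R) : is_derive d 1 F (Num.sqrt (d ^+ 2 + c))^-1.
  have h0 : is_derive d 1 (fun d : R => d ^+ 2 + c) (2 * d).
    by apply: is_derive_eq; rewrite /GRing.scale/=; ring.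
  have h1 := @is_derive1_comp _ (@Num.sqrt R) (fun d => d ^+ 2 + c) d _ _ (is_derive1_sqrt (sp d)) h0.
  have h2 : is_derive d 1 (fun d : R => d + Num.sqrt (d ^+ 2 + c)) (1 + (2 * Num.sqrt (d ^+ 2 + c))^-1 * (2 * d)).
    exact: is_deriveD.
  have h3 := @is_derive1_comp _ (@ln R) (fun d => d + Num.sqrt (d ^+ 2 + c)) d _ _ (is_derive1_ln (Fp d)) h2.
  apply: (is_derive_eq h3).
  by field; rewrite !gt_eqF// sqrtr_gt0.
have cf : continuous (fun d : R => (Num.sqrt (d ^+ 2 + c))^-1).
  move=> d; apply: cvgV; first by rewrite gt_eqF// sqrtr_gt0.
  have ch : continuous (fun d : R => d ^+ 2 + c).
    by move=> z; apply: cvgD; [exact: exprn_continuous|exact: cvg_cst].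
  exact: (cvg_comp _ _ (ch d) (@sqrt_continuous R _)).
have mf : measurable_fun setT (fun d : R => (Num.sqrt (d ^+ 2 + c))^-1).
  exact: continuous_measurable_fun.
have mi : measurable_fun setT (fun d : R => (d ^+ 2 < 1)%R%:R * (Num.sqrt (d ^+ 2 + c))^-1).
  by apply: measurable_funM => //; apply: measurable_ltR; exact: measurable_funX.
rewrite leb1_lebesgue; last 2 first.
  exact/measurable_EFinP.
  by move=> x; rewrite lee_fin mulr_ge0// invr_ge0 sqrtr_ge0.
apply: (@le_trans _ _ (\int[@lebesgue_measure R]_(x in `[(-1)%R, 1%R]) ((Num.sqrt (x ^+ 2 + c))^-1)%:E)%E).
  rewrite [leRHS]integral_mkcond; apply: ge0_le_integral => //.
  - exact/measurable_EFinP.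
  - apply/(measurable_restrictT _ _).1 => //; apply/measurable_EFinP; exact: measurable_funTS.
  - move=> x _; rewrite patchE; case: ifPn => [_|].
      by rewrite lee_fin ler_piMl// ?invr_ge0 ?sqrtr_ge0//; case: (_ < _).
    rewrite notin_setE/= in_itv/= => hx; rewrite (_ : (x ^+ 2 < 1) = false) ?mul0r//.
    apply/negP => h; apply: hx; rewrite -ler_norml.
    by rewrite -(ler_pXn2r (isT : (0 < 2)%N)) ?nnegrE// expr1n real_normK ?num_real// ltW.
rewrite (@continuous_FTC2 R _ F)//; last 3 first.
  exact: continuous_subspaceT.
  split=> [x _||]; first by have [] := dF x.
    by apply: cvg_at_right_filter; exact: (is_derive_continuous dF).
  by apply: cvg_at_left_filter; exact: (is_derive_continuous dF).
  by move=> x _; rewrite derive1E; have [_ ->] := dF x.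
rewrite -EFinB lee_fin /F sqrrN expr1n.
set s := Num.sqrt (1 + c).
have s1 : 1 < s by rewrite -[X in X < _]sqrtr1 ltr_sqrt ?ltrDl// ltr_wpDl.
have s2 : s ^+ 2 = 1 + c by rewrite sqr_sqrtr// addr_ge0// ltW.
have s3 : s <= 3 / 2.
  by rewrite -(ler_pXn2r (isT : (0 < 2)%N)) ?nnegrE ?s2//; [lra|exact: ltW (lt_trans ltr01 s1)].
rewrite -ln_div ?posrE//; [|lra|lra].
have -> : (1 + s) / (-1 + s) = (1 + s) ^+ 2 / c.
  have -> : c = (s - 1) * (s + 1) by rewrite -subr_sqr_1 s2; ring.
  by field; rewrite !gt_eqF//; lra.
rewrite ln_div ?posrE// ?exprn_gt0//; last lra.
rewrite lerD2r lnXn; last lra.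
have h : ln (1 + s) <= 3 / 2.
  by apply: le_trans s3; apply: le_ln1Dx; lra.
by rewrite mulr2n; lra.
Qed.

(** The ball is enlarged to the slab where only the last coordinate is below 1 in absolute value, so
    that three coordinates run over the whole line. This costs only a bounded error: the coefficient
    pi^2 of - ln c stays optimal, on which the sharp exponent depends. *)
Lemma int4_q4_inv2 (c : R) : 0 < c -> c <= 1 ->
  (\int[mu]_y ((q4 y < 1)%R%:R * (q4 y + c)^-1 ^+ 2)%:E <= (pi ^+ 2 * (3 - ln c))%:E)%E.
Proof.
move=> c0 c1; have mq := measurable_q4_0.
have q0 (y : pt4 R) : 0 <= (q4 y + c)^-1 by rewrite invr_ge0 addr_ge0 ?q4_ge0// ltW.
have sq (s : R) : 0 <= s -> s^-1 ^+ 2 = (Num.sqrt s)^-1 ^+ 4.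
  move=> s0; have e : s^-1 = (Num.sqrt s)^-1 ^+ 2 by rewrite exprVn sqr_sqrtr.
  by rewrite {1}e -exprM.
have mi : measurable_fun setT (fun y : pt4 R => (q4 y + c)^-1 ^+ 2).
  apply: measurable_funX; exact: measurable_addV.
apply: (@le_trans _ _ (\int[mu]_y ((y.2 ^+ 2 < 1)%R%:R * (q4 y + c)^-1 ^+ 2)%:E)%E).
  apply: ge0_le_integral => //.
  - by move=> x _; rewrite lee_fin mulr_ge0// exprn_ge0.
  - by apply/measurable_EFinP; apply: measurable_funM => //; exact: measurable_ltR.
  - by apply/measurable_EFinP; apply: measurable_funM => //; apply: measurable_ltR; exact: measurable_funX.
  - move=> x _; rewrite lee_fin ler_wpM2r ?exprn_ge0// ler_nat.
    have [h|] := ltP (q4 x) 1; last by [].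
    rewrite (_ : _ < 1) // (le_lt_trans _ h)// /q4 lerDr.
    by rewrite !addr_ge0// sqr_ge0.
rewrite int4E; last 2 first.
  by apply/measurable_EFinP; apply: measurable_funM => //; apply: measurable_ltR; exact: measurable_funX.
  by move=> y; rewrite lee_fin mulr_ge0// exprn_ge0.
rewrite [leLHS](_ : _ = \int[leb]_d \int[leb]_x \int[leb]_b ((d ^+ 2 < 1)%R%:R * (pi / 2) * (Num.sqrt (b ^+ 2 + (x ^+ 2 + (d ^+ 2 + c))))^-1 ^+ 3)%:E)%E; last first.
  apply: eq_integral => d _; apply: eq_integral => x _; apply: eq_integral => b _.
  rewrite -(@int1_sqrt 2 _ ((d ^+ 2 < 1)%R%:R) (b ^+ 2 + (x ^+ 2 + (d ^+ 2 + c))) cos_primitive2)//; last first.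
    by rewrite !ltr_wpDl// sqr_ge0.
  apply: eq_integral => a _; rewrite sq; last by rewrite addr_ge0 ?q4_ge0// ltW.
  by rewrite /q4/=; congr (_ * (Num.sqrt _)^-1 ^+ _)%:E; ring.
rewrite [leLHS](_ : _ = \int[leb]_d \int[leb]_x ((d ^+ 2 < 1)%R%:R * pi * (Num.sqrt (x ^+ 2 + (d ^+ 2 + c)))^-1 ^+ 2)%:E)%E; last first.
  apply: eq_integral => d _; apply: eq_integral => x _.
  rewrite (int1_sqrt cos_primitive1)//; last 2 first.
    by rewrite mulr_ge0// divr_ge0// pi_ge0.
    by rewrite !ltr_wpDl// sqr_ge0.
  by congr (_ * _)%:E; field.
rewrite [leLHS](_ : _ = \int[leb]_d ((pi ^+ 2)%:E * ((d ^+ 2 < 1)%R%:R * (Num.sqrt (d ^+ 2 + c))^-1)%:E))%E; last first.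
  apply: eq_integral => d _.
  rewrite (int1_sqrt cos_primitive0)//; last 2 first.
    by rewrite mulr_ge0// pi_ge0.
    by rewrite ltr_wpDl// sqr_ge0.
  by rewrite -EFinM expr1; congr (_)%:E; ring.
rewrite ge0_integralZl_EFin//; last 2 first.
  apply/measurable_EFinP; apply: measurable_funM; first by apply: measurable_ltR; exact: measurable_funX.
  apply: (measurableT_comp measurable_invR); apply: (measurableT_comp (f := @Num.sqrt R)).
    by apply: continuous_measurable_fun; exact: sqrt_continuous.
  by apply: measurable_funD => //; exact: measurable_funX.
  by rewrite exprn_ge0// pi_ge0.
rewrite [leRHS]EFinM lee_pmul2l//; last by rewrite lte_fin exprn_gt0// pi_gt0.
exact: int1_log.
Qed.

Lemma dyadic_bracket (s : R) : 0 < s -> s <= 1 -> exists k : nat, 2^-1 ^+ k.+1 < s /\ s <= 2^-1 ^+ k.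
Proof.
move=> s0 s1.
have ex : exists n : nat, 2^-1 ^+ n < s.
  have := @cvg_geometric R 1 2^-1 _.
  rewrite ger0_norm// invf_lt1// ltr1n => /(_ isT)/cvgr_lt/(_ s s0)[n _ /(_ n (leqnn n))].
  by rewrite /geometric/= mul1r => h; exists n.
have [k hk kmin] := ex_minnP ex.
case: k hk kmin => [|k] hk kmin; first by move: hk; rewrite expr0 ltNge s1.
by exists k; split => //; rewrite leNgt; apply/negP => /kmin; rewrite ltnn.
Qed.

(** A single [g n] dominating [f] at each point is enough, since then [f] lies below their sum. Both
    the dyadic shells of a power and the level sets of u are summed in this way. *)
Lemma integral_le_geometric d (T : measurableType d) (m : {measure set T -> \bar R})
  (f : T -> \bar R) (g : nat -> T -> R) (a z : R) :
  0 <= a -> 0 < z -> z < 1 -> measurable_fun setT f -> (forall x, 0 <= f x)%E ->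
  (forall n, measurable_fun setT (g n)) -> (forall n x, 0 <= g n x) ->
  (forall x, exists n, f x <= (g n x)%:E)%E ->
  (forall n, \int[m]_x (g n x)%:E <= (a * z ^+ n)%:E)%E ->
  (\int[m]_x f x <= (a / (1 - z))%:E)%E.
Proof.
move=> a0 z0 z1 mf f0 mg g0 fg hg.
apply: (@le_trans _ _ (\int[m]_x \sum_(n <oo) (g n x)%:E)%E).
  apply: ge0_le_integral => //.
  - by apply: ge0_emeasurable_sum => [k x _ _|k _]; [rewrite lee_fin|exact/measurable_EFinP].
  - move=> x _; have [n hn] := fg x.
    apply: (le_trans hn).
    apply: (@le_trans _ _ (\sum_(0 <= k < n.+1) (g k x)%:E)%E).
      by rewrite big_nat_recr//= leeDr// sume_ge0// => i _; rewrite lee_fin.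
    by apply: nneseries_lim_ge => k _ _; rewrite lee_fin.
rewrite integral_nneseries//; last 2 first.
  by move=> n; exact/measurable_EFinP.
  by move=> n x _; rewrite lee_fin.
apply: lime_le.
  by apply: is_cvg_nneseries => n _ _; apply: integral_ge0 => x _; rewrite lee_fin.
near=> N.
apply: (@le_trans _ _ (\sum_(0 <= n < N) (a * z ^+ n)%:E)%E).
  by apply: lee_sum => n _; exact: hg.
rewrite sumEFin lee_fin.
have := @geometric_le_lim R N a z a0 z0; rewrite gtr0_norm// => /(_ z1).
by rewrite /series/= /geometric.
Unshelve. all: by end_near. Qed.

(** On the shell 2^-(n+1) < s <= 2^-n = c, s^(k-2) is at most 4 c^(k-2) = 32 c^(k+1) (2c)^-3 <= 32
    c^(k+1) (s + c)^-3. The exact integral of the latter, 16 pi^2 2^(-kn), replaces the volume of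
    the shell. *)
Lemma int4_q4_powR (k : R) : 0 < k -> k < 2 -> exists C : R, 0 <= C /\
  (\int[mu]_y ((q4 y < 1)%R%:R * (q4 y `^ (k - 2)))%:E <= C%:E)%E.
Proof.
move=> k0 k2; pose z : R := 2^-1 `^ k; pose c (n : nat) : R := 2^-1 ^+ n.
have z0 : 0 < z by rewrite powR_gt0// invr_gt0.
have z1 : z < 1.
  have := @gt0_ltr_powR R k k0 2^-1 1; rewrite powR1; apply; rewrite ?nnegrE// ?invr_ge0//.
  by rewrite invf_lt1// ltr1n.
have c0 n : 0 < c n by rewrite exprn_gt0// invr_gt0.
have cz n : c n `^ k = z ^+ n.
  have e : c n = 2^-1 `^ n%:R by rewrite powR_mulrn// invr_ge0.
  by rewrite e powRAC powR_mulrn// ltW.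
have mq := measurable_q4_0.
have g0 n y : 0 <= 32 * c n * z ^+ n * (q4 y + c n)^-1 ^+ 3.
  apply: mulr_ge0; last by rewrite exprn_ge0// invr_ge0 addr_ge0 ?q4_ge0// ltW.
  by apply: mulr_ge0; [rewrite mulr_ge0// ltW|rewrite exprn_ge0// ltW].
exists (16 * pi ^+ 2 / (1 - z)); split.
  by rewrite divr_ge0// ?subr_ge0 ?(ltW z1)// mulr_ge0// exprn_ge0// pi_ge0.
apply: (@integral_le_geometric _ _ mu _ (fun n y => 32 * c n * z ^+ n * (q4 y + c n)^-1 ^+ 3)) => //.
- by rewrite mulr_ge0// exprn_ge0// pi_ge0.
- apply/measurable_EFinP; apply: measurable_funM; first exact: measurable_ltR.
  exact: (measurableT_comp (measurable_powR _)).
- by move=> x; rewrite lee_fin mulr_ge0// powR_ge0.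
- move=> n; apply: measurable_funM => //; apply: measurable_funX.
  exact: measurable_addV.
- move=> x; have [q1|q1] := ltP (q4 x) 1; last first.
    by exists 0%N; rewrite mul0r lee_fin.
  have := q4_ge0 x; rewrite le_eqVlt => /predU1P[q0|q0].
    (* At the origin a real power with nonzero exponent has the default value 0. *)
    have e : q4 x `^ (k - 2) = 0 by rewrite -q0 powR0// subr_eq0 lt_eqF.
    by exists 0%N; rewrite e mulr0 lee_fin.
  have [n [h1 h2]] := dyadic_bracket q0 (ltW q1).
  exists n; rewrite lee_fin mul1r.
  move: h1 h2 q0 {q1}; rewrite exprS -/(c n); move: (q4 x) => s h1 h2 q0.
  rewrite powRB; last by rewrite (gt_eqF q0) implybT.
  rewrite -cz powR_mulrn ?(ltW q0)//.
  have hk : s `^ k <= c n `^ k by apply: ge0_ler_powR; rewrite ?nnegrE ?(ltW q0)// ?(ltW k0)// ltW.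
  have hk0 : 0 <= c n `^ k by exact: powR_ge0.
  have hs0 : 0 <= s `^ k by exact: powR_ge0.
  move: hk hk0 hs0 (c0 n) h1 h2 q0; move: (c n) (c n `^ k) (s `^ k) => C A B BA A0 B0 C0 h1 h2 s0.
  apply: (@le_trans _ _ (A * (4 / C ^+ 2))).
    apply: ler_pM => //; first by rewrite invr_ge0 exprn_ge0// ltW.
    rewrite -[4 / _]invrK invf_div lef_pV2 ?posrE ?exprn_gt0// ?divr_gt0 ?exprn_gt0//.
    by rewrite ler_pdivrMr//; nra.
  have -> : A * (4 / C ^+ 2) = 32 * C * A * (C + C)^-1 ^+ 3.
    have Cn0 : C != 0 by rewrite gt_eqF.
    by rewrite -mulr2n -mulr_natr invfM; field.
  apply: ler_wpM2l; first by rewrite !mulr_ge0// ltW.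
  rewrite ler_pXn2r// ?nnegrE ?invr_ge0 ?addr_ge0 ?(ltW C0) ?(ltW s0)//.
  by rewrite lef_pV2 ?posrE//; lra.
- move=> n; under eq_integral do rewrite EFinM.
  rewrite ge0_integralZl_EFin//; last 3 first.
    by move=> x _; rewrite lee_fin exprn_ge0// invr_ge0 addr_ge0 ?q4_ge0// ltW.
    by apply/measurable_EFinP; apply: measurable_funX; exact: measurable_addV.
    by rewrite !mulr_ge0// ?exprn_ge0// ?(ltW z0)// ltW.
  rewrite int4_q4_inv3// -EFinM lee_fin le_eqVlt; apply/orP; left; apply/eqP.
  by field; rewrite gt_eqF.
Qed.
End RadialIntegrals.

Lemma ge0_integral_lin2 d (T : measurableType d) (R : realType) (m : {measure set T -> \bar R})
  (a b : R) (f g : T -> \bar R) : 0 <= a -> 0 <= b -> measurable_fun setT f -> measurable_fun setT g ->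
  (forall x, 0 <= f x)%E -> (forall x, 0 <= g x)%E ->
  (\int[m]_x (a%:E * f x + b%:E * g x) = a%:E * \int[m]_x f x + b%:E * \int[m]_x g x)%E.
Proof.
move=> a0 b0 mf mg f0 g0; rewrite ge0_integralD//; last 4 first.
- by move=> x _; rewrite mule_ge0.
- exact: measurable_funeM.
- by move=> x _; rewrite mule_ge0.
- exact: measurable_funeM.
by rewrite !ge0_integralZl_EFin.
Qed.

(** * Potentials with radial kernels: pointwise and weak-type bounds *)

Section Potential.
Variable R : realType.
Local Notation mu := (@mu4 R).
Implicit Types (x y : pt4 R) (f U : pt4 R -> R) (phi : R -> R).

Lemma q4_sub4C x y : q4 (sub4 x y) = q4 (sub4 y x).
Proof. by rewrite /q4 /sub4/=; ring. Qed.

Lemma measurable_dq : measurable_fun setT (fun z : pt4 R * pt4 R => q4 (sub4 z.2 z.1)).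
Proof.
by do !apply: measurable_funD => //; apply: measurable_funX; apply: measurable_funB => //;
  do !apply: measurableT_comp => //.
Qed.

Lemma int4_dq (phi : R -> R) x : measurable_fun setT phi -> (forall s, 0 <= phi s) ->
  (\int[mu]_y (phi (q4 (sub4 y x)))%:E = \int[mu]_y (phi (q4 y))%:E)%E.
Proof.
move=> mphi phi0.
rewrite (@int4_shift R (fun y => (phi (q4 y))%:E) x)//; last first.
  by move=> y; rewrite lee_fin.
apply/measurable_EFinP; exact: (measurableT_comp mphi (@measurable_q4_0 R)).
Qed.

Definition pot (phi : R -> R) (f : pt4 R -> R) (x : pt4 R) : \bar R :=
  (\int[mu]_y (phi (q4 (sub4 y x)) * `|f y|)%:E)%E.

Lemma measurable_kernel (phi : R -> R) (g : pt4 R -> R) :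
  measurable_fun setT phi -> measurable_fun setT g ->
  measurable_fun setT (fun z : pt4 R * pt4 R => (phi (q4 (sub4 z.2 z.1)) * g z.2)%:E).
Proof.
move=> mphi mg; apply/measurable_EFinP; apply: measurable_funM.
  exact: (measurableT_comp mphi measurable_dq).
exact: (measurableT_comp mg).
Qed.

Lemma measurable_pot phi f : measurable_fun setT phi -> (forall s, 0 <= phi s) ->
  measurable_fun setT f -> measurable_fun setT (pot phi f).
Proof.
move=> mphi phi0 mf.
have mnf : measurable_fun setT (fun y => `|f y|) by exact: measurableT_comp.
apply: (@measurable_fun_fubini_tonelli_F _ _ _ _ _ mu (fun z : pt4 R * pt4 R => (phi (q4 (sub4 z.2 z.1)) * `|f z.2|)%:E)).
  exact: (@measurable_kernel phi (fun y => `|f y|) mphi mnf).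
by move=> z; rewrite lee_fin mulr_ge0.
Qed.

Lemma measurable_kernel1 phi (g : pt4 R -> R) x :
  measurable_fun setT phi -> measurable_fun setT g ->
  measurable_fun setT (fun y => (phi (q4 (sub4 y x)) * g y)%:E).
Proof.
move=> mphi mg; apply/measurable_EFinP; apply: measurable_funM => //.
exact: (measurableT_comp mphi (measurable_q4 x)).
Qed.

(** Cauchy-Schwarz in the form p g <= (t g^2 + p^2 / t) / 2 under the integral, with [t] left for
    the caller to optimise. *)
Lemma pot_young phi f x (t K a : R) : measurable_fun setT phi -> (forall s, 0 <= phi s) ->
  measurable_fun setT f -> 0 < t ->
  (\int[mu]_y (f y ^+ 2)%:E <= a%:E)%E ->
  (\int[mu]_y (phi (q4 y) ^+ 2)%:E <= K%:E)%E ->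
  (pot phi f x <= (2^-1 * (t * a + t^-1 * K))%:E)%E.
Proof.
move=> mphi phi0 mf t0 hf hphi.
have mnf : measurable_fun setT (fun y => `|f y|) by exact: measurableT_comp.
have mf2 : measurable_fun setT (fun y => (f y ^+ 2)%:E).
  by apply/measurable_EFinP; exact: measurable_funX.
have mp2 : measurable_fun setT (fun y => (phi (q4 (sub4 y x)) ^+ 2)%:E).
  apply/measurable_EFinP; apply: measurable_funX.
  exact: (measurableT_comp mphi (measurable_q4 x)).
apply: (@le_trans _ _ (\int[mu]_y ((2^-1 * t)%:E * (f y ^+ 2)%:E + (2^-1 * t^-1)%:E * (phi (q4 (sub4 y x)) ^+ 2)%:E))%E).
  apply: ge0_le_integral => //.
  - by move=> y _; rewrite lee_fin mulr_ge0.
  - exact: measurable_kernel1.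
  - by apply: emeasurable_funD; apply: measurable_funeM.
  - move=> y _; rewrite -!EFinM -EFinD lee_fin -[f y ^+ 2]real_normK ?num_real//.
    move: (phi _) (`|f y|) => p g.
    rewrite -subr_ge0 (_ : _ - _ = (2 * t)^-1 * (t * g - p) ^+ 2).
      by rewrite mulr_ge0 ?sqr_ge0// invr_ge0 mulr_ge0// ltW.
    by field; rewrite gt_eqF.
have t2 : 0 <= 2^-1 * t by rewrite mulr_ge0// ltW.
have t2' : 0 <= 2^-1 * t^-1 by rewrite mulr_ge0// invr_ge0 ltW.
rewrite ge0_integral_lin2//; last 2 first.
- by move=> y; rewrite lee_fin sqr_ge0.
- by move=> y; rewrite lee_fin sqr_ge0.
rewrite mulrDr !mulrA EFinD; apply: leeD; rewrite [leRHS]EFinM lee_wpmul2l//.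
rewrite (@int4_dq (fun s => phi s ^+ 2) x)//; first exact: measurable_funX.
by move=> s; rewrite sqr_ge0.
Qed.

(** Tonelli, together with the fact that the kernel has the same mass around every centre. *)
Lemma int4_pot phi (g : pt4 R -> R) (k1 a : R) : measurable_fun setT phi -> (forall s, 0 <= phi s) ->
  measurable_fun setT g -> 0 <= k1 ->
  (\int[mu]_y `|g y|%:E <= a%:E)%E ->
  (\int[mu]_y (phi (q4 y))%:E <= k1%:E)%E ->
  (\int[mu]_x pot phi g x <= (k1 * a)%:E)%E.
Proof.
move=> mphi phi0 mg k10 hg hphi.
have mng : measurable_fun setT (fun y => `|g y|) by exact: measurableT_comp.
have := @fubini_tonelli _ _ _ _ _ mu mu (fun z : pt4 R * pt4 R => (phi (q4 (sub4 z.2 z.1)) * `|g z.2|)%:E) (measurable_kernel mphi mng).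
move=> /(_ _)/= ->; last by move=> z; rewrite lee_fin mulr_ge0.
apply: (@le_trans _ _ (\int[mu]_y (k1%:E * `|g y|%:E))%E).
  apply: ge0_le_integral => //.
  - by move=> y _; apply: integral_ge0 => x _; rewrite lee_fin mulr_ge0.
  - apply: (@measurable_fun_fubini_tonelli_G _ _ _ _ _ mu (fun z : pt4 R * pt4 R => (phi (q4 (sub4 z.2 z.1)) * `|g z.2|)%:E)).
      exact: (@measurable_kernel phi (fun y => `|g y|) mphi mng).
    by move=> z; rewrite lee_fin mulr_ge0.
  - by apply: measurable_funeM; exact/measurable_EFinP.
  - move=> y _; under eq_integral do rewrite mulrC EFinM q4_sub4C.
    rewrite ge0_integralZl_EFin//; last 2 first.
      by move=> x _; rewrite lee_fin.
      by apply/measurable_EFinP; exact: (measurableT_comp mphi (measurable_q4 y)).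
    by rewrite muleC lee_wpmul2r ?lee_fin// int4_dq.
rewrite ge0_integralZl_EFin//; last exact/measurable_EFinP.
by rewrite EFinM lee_wpmul2l.
Qed.

(** From g <= (k1 g^2 + 1/k1) / 2 one gets pot(f) <= (k1/2) pot(f^2) + 1/2, because the kernel has
    mass at most [k1]. Hence pot(f) > 1 forces k1 pot(f^2) >= 1, and Chebyshev with the L1 bound of
    [int4_pot] gives the square of [k1]. *)
Lemma pot_weak phi f (k1 a : R) : measurable_fun setT phi -> (forall s, 0 <= phi s) ->
  measurable_fun setT f -> 0 < k1 ->
  (\int[mu]_y (f y ^+ 2)%:E <= a%:E)%E ->
  (\int[mu]_y (phi (q4 y))%:E <= k1%:E)%E ->
  (mu [set x | 1 < pot phi f x] <= (k1 ^+ 2 * a)%:E)%E.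
Proof.
move=> mphi phi0 mf k10 hf hphi.
have mf2 : measurable_fun setT (fun y => f y ^+ 2) by exact: measurable_funX.
have mnf : measurable_fun setT (fun y => `|f y|) by exact: measurableT_comp.
have hf2 : (\int[mu]_y `|f y ^+ 2|%:E <= a%:E)%E.
  by under eq_integral do rewrite ger0_norm ?sqr_ge0//.
have h1 := int4_pot mphi phi0 mf2 (ltW k10) hf2 hphi.
have msub x : (pot phi f x <= (2^-1 * k1)%:E * pot phi (fun y => f y ^+ 2)%R x + (2^-1)%:E)%E.
  have mp : measurable_fun setT (fun y => (phi (q4 (sub4 y x)))%:E).
    by apply/measurable_EFinP; exact: (measurableT_comp mphi (measurable_q4 x)).
  have mk : measurable_fun setT (fun y => (phi (q4 (sub4 y x)) * `|f y ^+ 2|)%:E).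
    by apply: measurable_kernel1 => //; exact: measurableT_comp.
  apply: (@le_trans _ _ (\int[mu]_y ((2^-1 * k1)%:E * (phi (q4 (sub4 y x)) * `|f y ^+ 2|)%:E + (2^-1 * k1^-1)%:E * (phi (q4 (sub4 y x)))%:E))%E).
    apply: ge0_le_integral => //.
    - by move=> y _; rewrite lee_fin mulr_ge0.
    - exact: measurable_kernel1.
    - by apply: emeasurable_funD; apply: measurable_funeM.
    - move=> y _; rewrite -!EFinM -EFinD lee_fin [`|f y ^+ 2|]ger0_norm ?sqr_ge0// -[f y ^+ 2]real_normK ?num_real//.
      have := phi0 (q4 (sub4 y x)); move: (phi _) (`|f y|) => p g p0.
      rewrite -subr_ge0 (_ : _ - _ = p * ((2 * k1)^-1 * (k1 * g - 1) ^+ 2)).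
        by rewrite mulr_ge0// mulr_ge0 ?sqr_ge0// invr_ge0 mulr_ge0// ltW.
      by field; rewrite gt_eqF.
  have k2 : 0 <= 2^-1 * k1 by rewrite mulr_ge0// ltW.
  have k2' : 0 <= 2^-1 * k1^-1 by rewrite mulr_ge0// invr_ge0 ltW.
  rewrite ge0_integral_lin2//; last 2 first.
  - by move=> y; rewrite lee_fin mulr_ge0.
  - by move=> y; rewrite lee_fin.
  apply: leeD => //; rewrite int4_dq//.
  apply: (@le_trans _ _ ((2^-1 * k1^-1)%:E * k1%:E)%E); first exact: lee_wpmul2l.
  by rewrite -EFinM lee_fin -mulrA mulVf ?mulr1// gt_eqF.
pose S x := (k1%:E * pot phi (fun y => f y ^+ 2)%R x)%E.
have mpot2 : measurable_fun setT (pot phi (fun y => f y ^+ 2)) by exact: measurable_pot.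
have mS : measurable_fun setT S by exact: measurable_funeM.
have pot0 g x : (0 <= pot phi g x)%E by apply: integral_ge0 => y _; rewrite lee_fin mulr_ge0.
have S0 x : (0 <= S x)%E by rewrite mule_ge0// lee_fin ltW.
apply: (@le_trans _ _ (mu (setT `&` [set x | (1%:E <= `|S x|)%E]))).
  apply: le_measure; rewrite ?inE.
  - rewrite -[X in measurable X]setTI; apply: emeasurable_fun_o_infty => //; exact: measurable_pot.
  - by apply: emeasurable_fun_c_infty => //; exact: measurableT_comp.
  - move=> x /= h; split => //; rewrite gee0_abs//.
    have := lt_le_trans h (msub x); rewrite /S EFinM -muleA.
    have := pot0 (fun y => f y ^+ 2) x.
    case: (pot phi (fun y => f y ^+ 2) x) => [r| |]//=.
    + by rewrite -!EFinM -EFinD lte_fin !lee_fin => _; lra.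
    + by rewrite gt0_muley ?lte_fin// => _ _; exact: leey.
have := @le_integral_comp_abse _ _ _ mu setT measurableT S 1 (fun z => z) _ _ _ mS ltr01.
rewrite mul1e => h; apply: (le_trans (h _ _ _)) => //.
under eq_integral do rewrite gee0_abs//.
rewrite /S ge0_integralZl_EFin//; last by rewrite ltW.
rewrite expr2 -mulrA [leRHS]EFinM lee_wpmul2l// lee_fin ltW//.
Qed.

End Potential.

(** * Level sets of the Newtonian potential of an L2 function *)

Section LevelSets.
Variable R : realType.
Local Notation mu := (@mu4 R).
Implicit Types (x y : pt4 R) (f U : pt4 R -> R) (phi : R -> R).

(* The absolute value makes this a nonnegative function on the whole line. *)
Definition newton (s : R) : R := (s < 1)%R%:R * (4 * pi ^+ 2 * `|s|)^-1.

Lemma newton_ge0 s : 0 <= newton s.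
Proof. by rewrite mulr_ge0// invr_ge0 mulr_ge0// mulr_ge0// sqr_ge0. Qed.

Lemma measurable_newton : measurable_fun setT newton.
Proof.
apply: measurable_funM; first exact: measurable_ltR.
by apply: (measurableT_comp (@measurable_invR R)); apply: measurable_funM.
Qed.

(** [far] is the Newton kernel with 1/s regularised to 1/(s + c); [near] is an integrable majorant
    of what this drops, c / (s (s + c)), with the smallness in [c] factored out. *)
Let far c (s : R) : R := (s < 1)%R%:R * (4 * pi ^+ 2)^-1 * `|(s + c)^-1|.
Let near c k (s : R) : R := (4 * pi ^+ 2)^-1 * c `^ (1 - k) * ((s < 1)%R%:R * s `^ (k - 2)).

Let far_ge0 c s : 0 <= far c s.
Proof. by rewrite /far !mulr_ge0// invr_ge0 mulr_ge0// exprn_ge0// pi_ge0. Qed.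

Let near_ge0 c k s : 0 <= near c k s.
Proof.
by rewrite /near !mulr_ge0// ?powR_ge0// invr_ge0 mulr_ge0// exprn_ge0// pi_ge0.
Qed.

Let measurable_far c : measurable_fun setT (far c).
Proof.
apply: measurable_funM; first by apply: measurable_funM => //; exact: measurable_ltR.
apply: measurableT_comp => //.
exact: measurable_addV.
Qed.

Let measurable_near c k : measurable_fun setT (near c k).
Proof.
apply: measurable_funM => //; apply: measurable_funM; first exact: measurable_ltR.
exact: measurable_powR.
Qed.

(** The remainder satisfies c / (s (s + c)) <= c^(1-k) s^(k-2), which amounts to s^(1-k) c^k <= s +
    c. *)
Let newton_split c k s : 0 <= s -> 0 < c -> 0 < k -> k < 1 -> newton s <= far c s + near c k s.
Proof.
move=> + c0 k0 k1; rewrite le_eqVlt => /predU1P[<-|s0].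
  by rewrite /newton normr0 mulr0 invr0 mulr0 addr_ge0.
rewrite /newton /far /near; case: ltP => s1; last by rewrite !mul0r mulr0 addr0.
have sc : 0 < s + c by rewrite addr_gt0.
rewrite !mul1r (gtr0_norm s0) gtr0_norm ?invr_gt0// invfM -mulrA -mulrDr ler_wpM2l//.
  by rewrite invr_ge0 mulr_ge0// exprn_ge0// pi_ge0.
have -> : s^-1 = (s + c)^-1 + c / (s + c) * s^-1 by field; rewrite !gt_eqF.
rewrite lerD2l.
have -> : c `^ (1 - k) * s `^ (k - 2) = c `^ (1 - k) * s `^ (k - 1) / s.
  rewrite -mulrA; congr (_ * _); rewrite -[X in _ / X]powRr1 ?(ltW s0)// -powRB ?(gt_eqF s0) ?implybT//.
  by congr (_ `^ _); ring.
rewrite ler_wpM2r ?invr_ge0 ?(ltW s0)//.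
rewrite ler_pdivrMr//.
have hc : c `^ (1 - k) * c `^ k = c.
  by rewrite -powRD ?subrK ?powRr1 ?(ltW c0)// (gt_eqF c0) implybT.
have hs : s `^ (k - 1) * s `^ (1 - k) = 1.
  by rewrite -powRD ?(gt_eqF s0) ?implybT// addrA subrK subrr powRr0.
have h1 : s `^ (1 - k) * c `^ k <= s + c.
  have <- : (s + c) `^ (1 - k) * (s + c) `^ k = s + c.
    by rewrite -powRD ?subrK ?powRr1 ?(ltW sc)// (gt_eqF sc) implybT.
  apply: ler_pM; rewrite ?powR_ge0//; apply: ge0_ler_powR; rewrite ?nnegrE ?subr_ge0 ?(ltW k0) ?(ltW k1) ?(ltW s0) ?(ltW c0) ?(ltW sc)//.
    by rewrite lerDl ltW.
  by rewrite lerDr ltW.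
have := ler_wpM2l (mulr_ge0 (powR_ge0 c (1 - k)) (powR_ge0 s (k - 1))) h1.
apply: le_trans; rewrite -[leLHS]hc.
by rewrite mulrA -[X in _ <= X * _]mulrA hs mulr1.
Qed.

(** The square root is the Cauchy-Schwarz bound of the far part, (4 pi^2)^-2 * pi^2 (3 - ln c)
    bounding the squared L2 norm of its kernel. The added 1 is the share of the near part, so the
    level set lies where the near part exceeds 1. *)
Lemma pot_newton_level k : 0 < k -> k < 1 -> exists C : R, 0 < C /\
  forall f (a c : R), measurable_fun setT f -> 0 < a -> 0 < c -> c <= 1 ->
  (\int[mu]_y (f y ^+ 2)%:E <= (a ^+ 2)%:E)%E ->
  (mu [set x | (a * Num.sqrt ((3 - ln c) / (16 * pi ^+ 2)) + 1)%:E < pot newton f x] <=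
    (C * a ^+ 2 * (c `^ (1 - k)) ^+ 2)%:E)%E.
Proof.
move=> k0 k1; have k2 : k < 2 by apply: lt_trans k1 _; rewrite ltr1n.
have [C2 [C20 hC2]] := @int4_q4_powR R k k0 k2.
have pi4 : 0 < (4 * pi ^+ 2 : R) by rewrite mulr_gt0// exprn_gt0// pi_gt0.
(* The [+ 1] makes the mass bound strictly positive, as [pot_weak] requires. *)
pose C1 := (4 * pi ^+ 2)^-1 * (C2 + 1).
have C10 : 0 < C1 by rewrite mulr_gt0 ?invr_gt0// ltr_wpDl.
exists (C1 ^+ 2); split; first by rewrite exprn_gt0.
move=> f a c mf a0 c0 c1 hf.
have ck0 : 0 < c `^ (1 - k) by rewrite powR_gt0.
have lnc : ln c <= 0 by exact: ln_le0.
set K := (3 - ln c) / (16 * pi ^+ 2).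
have K0 : 0 < K.
  rewrite divr_gt0//; first lra.
  by rewrite mulr_gt0// exprn_gt0// pi_gt0.
have hfar : (\int[mu]_y (far c (q4 y) ^+ 2)%:E <= K%:E)%E.
  have e : (K = (4 * pi ^+ 2)^-1 ^+ 2 * (pi ^+ 2 * (3 - ln c))).
    have pin : (pi ^+ 2 : R) != 0 by rewrite gt_eqF// exprn_gt0// pi_gt0.
    rewrite /K; move: (ln c) (pi ^+ 2) pin => l p pn.
    by field.
  rewrite e EFinM.
  apply: le_trans (lee_wpmul2l _ (int4_q4_inv2 c0 c1)); last by rewrite lee_fin sqr_ge0.
  have mm : measurable_fun setT (fun y : pt4 R => ((q4 y < 1)%R%:R * (q4 y + c)^-1 ^+ 2)%:E).
    apply/measurable_EFinP; apply: measurable_funM.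
      by apply: measurable_ltR; exact: measurable_q4_0.
    apply: measurable_funX; apply: measurable_addV; exact: measurable_q4_0.
  rewrite -ge0_integralZl_EFin//; last 2 first.
    by move=> y _; rewrite lee_fin mulr_ge0// sqr_ge0.
    by rewrite sqr_ge0.
  apply: ge0_le_integral => //.
  - by move=> y _; rewrite lee_fin sqr_ge0.
  - apply/measurable_EFinP; apply: measurable_funX.
    by apply: (measurableT_comp (measurable_far c)); exact: measurable_q4_0.
  - exact: measurable_funeM.
  - move=> y _; have q0c : 0 <= (q4 y + c)^-1 by rewrite invr_ge0 (le_trans (q4_ge0 y))// lerDl ltW.
    rewrite -EFinM lee_fin /far (ger0_norm q0c).
    by case: ltP => _; rewrite ?mul1r ?mul0r ?mulr0 ?expr0n// exprMn.
have hnear : (\int[mu]_y (near c k (q4 y))%:E <= (C1 * c `^ (1 - k))%:E)%E.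
  rewrite /near; under eq_integral do rewrite EFinM.
  rewrite ge0_integralZl_EFin//; last 3 first.
    by move=> y _; rewrite lee_fin mulr_ge0// powR_ge0.
    apply/measurable_EFinP; apply: measurable_funM.
      by apply: measurable_ltR; exact: measurable_q4_0.
    exact: (measurableT_comp (measurable_powR _) (@measurable_q4_0 R)).
    by rewrite mulr_ge0 ?invr_ge0 ?(ltW pi4) ?(ltW ck0).
  apply: (@le_trans _ _ (((4 * pi ^+ 2)^-1 * c `^ (1 - k))%:E * C2%:E)%E).
    by rewrite lee_wpmul2l// lee_fin mulr_ge0 ?invr_ge0 ?(ltW pi4) ?(ltW ck0).
  rewrite -EFinM lee_fin /C1 mulrAC ler_wpM2r ?(ltW ck0)// ler_wpM2l ?invr_ge0 ?(ltW pi4)//.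
  by rewrite lerDl.
have split x : (pot newton f x <= pot (far c) f x + pot (near c k) f x)%E.
  have mnf : measurable_fun setT (fun y => `|f y|) by exact: measurableT_comp.
  rewrite /pot -ge0_integralD//; last 4 first.
    by move=> y _; rewrite lee_fin mulr_ge0.
    exact: (@measurable_kernel1 R (far c) (fun y => `|f y|)).
    by move=> y _; rewrite lee_fin mulr_ge0.
    exact: (@measurable_kernel1 R (near c k) (fun y => `|f y|)).
  apply: ge0_le_integral => //.
  - by move=> y _; rewrite lee_fin mulr_ge0// newton_ge0.
  - by apply: (@measurable_kernel1 R newton (fun y => `|f y|)) => //; exact: measurable_newton.
  - apply: emeasurable_funD; first exact: (@measurable_kernel1 R (far c) (fun y => `|f y|)).
    exact: (@measurable_kernel1 R (near c k) (fun y => `|f y|)).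
  - move=> y _; rewrite -EFinD lee_fin -mulrDl ler_wpM2r//.
    by apply: newton_split => //; exact: q4_ge0.
(* With t = sqrt(K)/a the two terms of [pot_young] are equal, which recovers the Cauchy-Schwarz
   product. *)
have t0 : 0 < Num.sqrt K / a by rewrite divr_gt0// sqrtr_gt0.
have farb x : (pot (far c) f x <= (a * Num.sqrt K)%:E)%E.
  apply: le_trans (pot_young x (measurable_far c) (far_ge0 c) mf t0 hf hfar) _.
  rewrite lee_fin -{3}(sqr_sqrtr (ltW K0)).
  have := t0; rewrite pmulr_lgt0 ?invr_gt0// => sK.
  by rewrite le_eqVlt; apply/orP; left; apply/eqP; field; rewrite !gt_eqF.
have mpn : measurable_fun setT (pot newton f).
  by apply: measurable_pot => //; [exact: measurable_newton|exact: newton_ge0].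
apply: le_trans (_ : _ <= mu [set x | (1 < pot (near c k) f x)%E])%E _.
  apply: le_measure; rewrite ?inE.
  - by rewrite -[X in measurable X]setTI; exact: emeasurable_fun_o_infty.
  - rewrite -[X in measurable X]setTI; apply: emeasurable_fun_o_infty => //.
    exact: measurable_pot.
  - move=> x /= h; rewrite ltNge; apply/negP => h2.
    have := lt_le_trans h (le_trans (split x) (leeD (farb x) h2)).
    by rewrite -EFinD lte_fin ltxx.
have := pot_weak (measurable_near c k) (near_ge0 c k) mf (mulr_gt0 C10 ck0) hf hnear.
by move=> h; apply: (le_trans h); rewrite lee_fin exprMn mulrAC.
Qed.

End LevelSets.

(** * From level sets to exponential integrals, with and without weight *)

Section ExpIntegral.
Variable R : realType.
Local Notation mu := (@mu4 R).
Implicit Types (x y : pt4 R) (f U : pt4 R -> R) (phi : R -> R).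

Lemma measurable_absgt U (t : R) : measurable_fun setT U -> measurable [set x | t < `|U x|].
Proof.
move=> mU; rewrite (_ : [set x | _] = (fun x => `|U x|) @^-1` `]t, +oo[%classic).
  rewrite -[X in measurable X]setTI; have : measurable_fun setT (fun x => `|U x|) by exact: measurableT_comp.
  by apply.
by apply/seteqP; split => x /=; rewrite in_itv/= andbT.
Qed.

Lemma measure_le_ae d (T : measurableType d) (m : {measure set T -> \bar R}) (E F : set T) :
  measurable E -> measurable F -> {ae m, forall x : T, E x -> F x} -> (m E <= m F)%E.
Proof.
move=> mE mF [N [mN N0 hN]].
apply: (@le_trans _ _ (m (F `|` N))).
  apply: le_measure; rewrite ?inE//; first exact: measurableU.
  move=> x Ex; have [|nF] := pselect (F x); first by left.
  by right; apply: hN => /= h; exact/nF/h.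
apply: le_trans (measureU2 _ mF mN) _.
have h : (m N <= 0)%E by rewrite N0.
by rewrite -[leRHS]adde0; apply: leeD.
Qed.

(** This is 1 - t <= exp(-t) multiplied by exp(t). The factor t lets the L2 norm control the
    integral where u is small, a set of possibly infinite measure. *)
Lemma expR_sub1_le (t : R) : expR t - 1 <= t * expR t.
Proof.
have := @expR_ge1Dx R (- t); rewrite expRN => h.
have e0 := expR_gt0 t.
rewrite -(ler_pM2l e0) mulfV ?gt_eqF// in h; lra.
Qed.

(** Integer levels of |U|: the part below [n0] is paid by the L2 norm, each unit layer above it by
    [pot_newton_level]. The layers decay at a quadratic rate [la] larger than [al], and the gap
    absorbs all linear terms and leaves a geometric series of ratio 1/e. *)
Lemma exp_integral_bound (al a A B k : R) : 0 < al -> 0 < a -> 0 <= A -> 0 <= B ->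
  0 < k -> k < 1 -> al * a ^+ 2 < 32 * pi ^+ 2 * (1 - k) ->
  exists C : R, 0 <= C /\ forall U f, measurable_fun setT U -> measurable_fun setT f ->
   (\int[mu]_y (f y ^+ 2)%:E <= (a ^+ 2)%:E)%E ->
   (\int[mu]_y (U y ^+ 2)%:E <= B%:E)%E ->
   {ae mu, forall x, (`|U x|%:E <= A%:E + pot (@newton R) f x)%E} ->
   (\int[mu]_x (expR (al * U x ^+ 2) - 1)%:E <= C%:E)%E.
Proof.
move=> al0 a0 A0 B0 k0 k1 hal.
have [CL [CL0 hCL]] := @pot_newton_level R k k0 k1.
have pi0 : 0 < (pi : R) := pi_gt0 R.
(* Decay rate of the level sets: with the value of [c] chosen below, c^(2-2k) equals exp(6 (1 - k) -
   la sg^2). *)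
pose la := 32 * pi ^+ 2 * (1 - k) / a ^+ 2.
have la_al : 0 < la - al by rewrite subr_gt0 ltr_pdivlMr// exprn_gt0.
(* Levels from [n0] on exceed 1 + A by more than [a], which keeps the chosen [c] at most 1. *)
pose n0 := (Num.truncn (1 + A + a)).+1.
have n0P : 1 + A + a < n0%:R.
  by apply: truncnS_gt.
(* [D] bounds the exponent of the n-th term, maximised over n by completing the square. *)
pose b := 2 * al + 2 * la * (1 + A).
pose D := (1 - k) * 6 + al + (b + 1) ^+ 2 / (4 * (la - al)) + 1.
pose G := Num.max (CL * a ^+ 2 * expR D) (al * expR (al * n0%:R ^+ 2) * B).
have ee1 : expR (- 1) < 1 :> R by rewrite -[ltRHS]expR0 ltr_expR; lra.
have G0 : 0 <= G.
  by rewrite /G le_max mulr_ge0 ?expR_ge0// mulr_ge0 ?sqr_ge0// ltW.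
exists (G / (1 - expR (- 1))); split.
  by apply: divr_ge0 => //; rewrite subr_ge0 ltW.
move=> U f mU mf hf hU hae.
have mU2 : measurable_fun setT (fun x => U x ^+ 2) by exact: measurable_funX.
(* For n >= 1 the n-th layer is m n < |U| <= m n + 1, starting at m 1 = n0; index 0 is kept for |U|
   <= n0. *)
pose m n : R := (n0 + n.-1)%:R.
have mpn : measurable_fun setT (pot (@newton R) f).
  by apply: measurable_pot => //; [exact: measurable_newton|exact: newton_ge0].
have mlev t : measurable [set x | t < `|U x|].
  exact: measurable_absgt.
have hlev n : (mu [set x | (m n.+1 < `|U x|)%R] <= (CL * a ^+ 2 * expR (6 * (1 - k) - la * (m n.+1 - 1 - A) ^+ 2))%:E)%E.
  (* [A] is the bounded part of |U| and 1 the allowance of the near kernel: |U| > m n.+1 forces the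
     potential above sg + 1. *)
  set sg := m n.+1 - 1 - A.
  have sga : a < sg.
    rewrite /sg /m/= natrD; have : (0 : R) <= n%:R by [].
    lra.
  (* The solution of a sqrt((3 - ln c) / (16 pi^2)) = sg. *)
  pose c := expR (3 - 16 * pi ^+ 2 * sg ^+ 2 / a ^+ 2).
  have c0 : 0 < c := expR_gt0 _.
  have pi2 : 2 <= (pi : R) := pi_ge2 R.
  have an : a != 0 by rewrite gt_eqF.
  have ppn : (pi ^+ 2 : R) != 0 by rewrite gt_eqF// exprn_gt0.
  have c1 : c <= 1.
    rewrite -expR0 ler_expR subr_le0.
    apply: (@le_trans _ _ (16 * pi ^+ 2)); first nra.
    rewrite -mulrA; apply: ler_peMr; first by rewrite mulr_ge0// sqr_ge0.
    rewrite ler_pdivlMr ?exprn_gt0// mul1r ler_pXn2r// ?nnegrE ltW//.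
    exact: lt_trans a0 sga.
  have e1 : a * Num.sqrt ((3 - ln c) / (16 * pi ^+ 2)) = sg.
    have -> : (3 - ln c) / (16 * pi ^+ 2) = (sg / a) ^+ 2.
      rewrite /c expRK; move: (pi ^+ 2 : R) ppn => p pn.
      by field; rewrite an.
    rewrite sqrtr_sqr gtr0_norm ?divr_gt0// ?(lt_trans a0)//.
    by rewrite mulrC divfK// gt_eqF.
  have e2 : (c `^ (1 - k)) ^+ 2 = expR (6 * (1 - k) - la * sg ^+ 2).
    rewrite /powR gt_eqF// /c expRK -expRM_natl; congr expR.
    by rewrite /la; field.
  have := hCL f a c mf a0 c0 c1 hf; rewrite e1 e2 => h.
  apply: le_trans h.
  apply: measure_le_ae => //.
    by rewrite -[X in measurable X]setTI; exact: emeasurable_fun_o_infty.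
  apply: filterS hae => x h1 /= h2; rewrite -(@lteD2lE _ A%:E)//.
  apply: lt_le_trans h1; rewrite -EFinD lte_fin /sg.
  by rewrite (_ : A + _ = m n.+1)//; ring.
have key n : al * (m n.+1 + 1) ^+ 2 + (6 * (1 - k) - la * (m n.+1 - 1 - A) ^+ 2) <= D - n.+1%:R.
  have -> : al * (m n.+1 + 1) ^+ 2 + (6 * (1 - k) - la * (m n.+1 - 1 - A) ^+ 2) =
    - (la - al) * m n.+1 ^+ 2 + b * m n.+1 + al + 6 * (1 - k) - la * (1 + A) ^+ 2.
    by rewrite /b; ring.
  have la0 : 0 < la by apply: lt_trans al0 _; rewrite -subr_gt0.
  have h1 : 0 <= la * (1 + A) ^+ 2 by rewrite mulr_ge0 ?sqr_ge0// ltW.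
  have h2 : - (la - al) * m n.+1 ^+ 2 + (b + 1) * m n.+1 <= (b + 1) ^+ 2 / (4 * (la - al)).
    rewrite ler_pdivlMr ?mulr_gt0// -subr_ge0.
    have -> : (b + 1) ^+ 2 - (- (la - al) * m n.+1 ^+ 2 + (b + 1) * m n.+1) * (4 * (la - al)) =
      ((b + 1) - 2 * (la - al) * m n.+1) ^+ 2 by ring.
    exact: sqr_ge0.
  rewrite /D -natr1; lra.
pose g n x := if n is 0%N then al * expR (al * n0%:R ^+ 2) * U x ^+ 2
   else expR (al * (m n + 1) ^+ 2) * \1_[set x | m n < `|U x|] x.
apply: (@integral_le_geometric R _ _ mu (fun x => (expR (al * U x ^+ 2) - 1)%:E) g G (expR (- 1))).
- exact: G0.
- exact: expR_gt0.
- exact: ee1.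
- apply/measurable_EFinP; apply: measurable_funB => //.
  by apply: (measurableT_comp (@measurable_expR R)); exact: measurable_funM.
- by move=> x; rewrite lee_fin subr_ge0 -expR0 ler_expR mulr_ge0 ?sqr_ge0// ltW.
- case=> [|n]; first exact: measurable_funM.
  by apply: measurable_funM => //; exact: measurable_indic.
- by case=> [|n] x; rewrite mulr_ge0 ?sqr_ge0 ?expR_ge0// mulr_ge0 ?expR_ge0// ltW.
- move=> x; have ex : exists n, `|U x| <= (n0 + n)%:R.
    by exists (Num.truncn `|U x|).+1; rewrite natrD ler_wpDl// ltW// truncnS_gt.
  have [[|n] hn nmin] := ex_minnP ex.
    exists 0%N; rewrite lee_fin /g; move: hn; rewrite addn0 => hn.
    apply: le_trans (expR_sub1_le _) _; rewrite mulrAC ler_wpM2r ?sqr_ge0//.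
    rewrite ler_wpM2l ?(ltW al0)// ler_expR ler_wpM2l ?(ltW al0)// -real_normK ?num_real//.
    by rewrite ler_pXn2r// nnegrE.
  exists n.+1; rewrite lee_fin /g /= indicE mem_set/=; last first.
    by rewrite /m/= ltNge; apply/negP => /nmin; rewrite ltnn.
  rewrite mulr1 lerBlDr ler_wpDr// ler_expR ler_wpM2l ?(ltW al0)// -real_normK ?num_real//.
  rewrite ler_pXn2r// ?nnegrE ?addr_ge0//.
  by rewrite (le_trans hn)// /m/= natr1 ler_nat addnS.
- case=> [|n].
    rewrite expr0 mulr1 /g; under eq_integral do rewrite EFinM.
    rewrite ge0_integralZl_EFin//; last 3 first.
      by move=> x _; rewrite lee_fin sqr_ge0.
      exact/measurable_EFinP.
      by rewrite mulr_ge0 ?expR_ge0// ltW.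
    apply: (@le_trans _ _ ((al * expR (al * n0%:R ^+ 2))%:E * B%:E)%E).
      by rewrite lee_wpmul2l// lee_fin mulr_ge0 ?expR_ge0// ltW.
    by rewrite -EFinM lee_fin /G le_max lexx orbT.
  rewrite /g; under eq_integral do rewrite EFinM.
  rewrite ge0_integralZl_EFin//; last by apply/measurable_EFinP; exact: measurable_indic.
  rewrite integral_indic// setIT.
  apply: (@le_trans _ _ ((expR (al * (m n.+1 + 1) ^+ 2))%:E * (CL * a ^+ 2 * expR (6 * (1 - k) - la * (m n.+1 - 1 - A) ^+ 2))%:E)%E).
    by apply: lee_wpmul2l; [rewrite lee_fin expR_ge0|exact: hlev].
  rewrite -EFinM lee_fin mulrCA -expRD.
  apply: (@le_trans _ _ (CL * a ^+ 2 * expR (D - n.+1%:R))).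
    by apply: ler_wpM2l; [apply: mulr_ge0; [exact: ltW|exact: sqr_ge0]|rewrite ler_expR key].
  rewrite expRD mulrA -expRM_natl mulrN1 ler_wpM2r ?expR_ge0//.
  by rewrite /G le_max lexx.
Qed.

(** A weak weighted AM-GM inequality: replace both bases by the larger one. *)
Lemma powR_conv (X Y t : R) : 0 <= X -> 0 <= Y -> 0 < t -> t < 1 -> X `^ (1 - t) * Y `^ t <= X + Y.
Proof.
move=> X0 Y0 t0 t1.
have hZ (Z : R) : 0 <= Z -> Z `^ (1 - t) * Z `^ t = Z.
  move=> Z0; have [->|Zn] := eqVneq Z 0; first by rewrite [0 `^ t]powR0 ?mulr0// gt_eqF.
  by rewrite -powRD ?subrK ?powRr1// Zn implybT.
have [XY|XY] := leP X Y.
  apply: (@le_trans _ _ Y); last by rewrite lerDr.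
  rewrite -[leRHS](hZ Y Y0) ler_wpM2r ?powR_ge0//.
  by apply: ge0_ler_powR; rewrite ?nnegrE// subr_ge0 ltW.
apply: (@le_trans _ _ X); last by rewrite lerDl.
rewrite -[leRHS](hZ X X0) ler_wpM2l ?powR_ge0//.
by apply: ge0_ler_powR; rewrite ?nnegrE// ltW.
Qed.

Lemma measurable_norm4 : measurable_fun setT (@norm4 R).
Proof.
rewrite (_ : @norm4 R = (fun x => Num.sqrt (q4 x))); last by apply/funext => x; rewrite norm4E.
apply: (measurableT_comp (f := @Num.sqrt R)); last exact: measurable_q4_0.
by apply: continuous_measurable_fun; exact: sqrt_continuous.
Qed.

Lemma measurable_AT (al be : R) U : measurable_fun setT U ->
  measurable_fun setT (fun x => (expR (al * U x ^+ 2) - 1) / (norm4 x `^ be)).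
Proof.
move=> mU; apply: measurable_funM.
  apply: measurable_funB => //; apply: (measurableT_comp (@measurable_expR R)).
  by apply: measurable_funM => //; exact: measurable_funX.
apply: (measurableT_comp (@measurable_invR R)).
exact: (measurableT_comp (measurable_powR be) measurable_norm4).
Qed.

(** On the ball 1 <= 4 / (s + 1)^2, and [int4_q4_inv2] at c = 1 gives 4 * 3 pi^2. The true volume is
    pi^2/2; any finite bound serves. *)
Lemma int4_unit_ball : (\int[mu]_x ((q4 x < 1)%R%:R)%:E <= (12 * pi ^+ 2)%:E)%E.
Proof.
have mi : measurable_fun setT (fun x : pt4 R => (q4 x < 1)%R%:R : R).
  by apply: measurable_ltR; exact: measurable_q4_0.
have mj : measurable_fun setT (fun y : pt4 R => (q4 y < 1)%R%:R * (q4 y + 1)^-1 ^+ 2).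
  apply: measurable_funM => //; apply: measurable_funX; apply: measurable_addV; exact: measurable_q4_0.
apply: (@le_trans _ _ (4%:E * \int[mu]_y ((q4 y < 1)%R%:R * (q4 y + 1)^-1 ^+ 2)%:E)%E).
  rewrite -ge0_integralZl_EFin//; last 2 first.
    by move=> x _; rewrite lee_fin mulr_ge0// sqr_ge0.
    exact/measurable_EFinP.
  apply: ge0_le_integral => //.
  - exact/measurable_EFinP.
  - by apply: measurable_funeM; exact/measurable_EFinP.
  - move=> x _; rewrite -EFinM lee_fin; have := q4_ge0 x; case: ltP => q1 q0; last by rewrite mul0r mulr0.
    rewrite mul1r exprVn -[_ * _^-1]/(_ / _) ler_pdivlMr ?exprn_gt0 ?ltr_wpDl//.
    by rewrite mul1r; nra.
apply: (@le_trans _ _ (4%:E * (pi ^+ 2 * (3 - ln 1))%:E)%E).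
  by rewrite lee_wpmul2l//; apply: int4_q4_inv2.
by rewrite -EFinM lee_fin ln1; lra.
Qed.

(** Inside the unit ball [powR_conv] separates exp(al u^2) |x|^-be into exp(al' u^2) with al' = al /
    (1 - th) and a pure power of |x|; outside it the weight is at most 1. *)
Lemma AT_bound (al be a A B : R) : 0 < al -> 0 <= be -> be < 4 -> 0 < a -> 0 <= A -> 0 <= B ->
  al * a ^+ 2 < 32 * pi ^+ 2 * (1 - be / 4) ->
  exists C : R, 0 <= C /\ forall U f, measurable_fun setT U -> measurable_fun setT f ->
   (\int[mu]_y (f y ^+ 2)%:E <= (a ^+ 2)%:E)%E ->
   (\int[mu]_y (U y ^+ 2)%:E <= B%:E)%E ->
   {ae mu, forall x, (`|U x|%:E <= A%:E + pot (@newton R) f x)%E} ->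
   (\int[mu]_x ((expR (al * U x ^+ 2) - 1) / (norm4 x `^ be))%:E <= C%:E)%E.
Proof.
move=> al0 be0 be4 a0 A0 B0 hal.
have pi32 : 0 < 32 * pi ^+ 2 :> R by rewrite mulr_gt0// exprn_gt0// pi_gt0.
pose t0 := al * a ^+ 2 / (32 * pi ^+ 2).
have t00 : 0 < t0 by rewrite divr_gt0// mulr_gt0// exprn_gt0.
have t0b : t0 < 1 - be / 4 by rewrite ltr_pdivrMr// [ltRHS]mulrC.
(* Midpoint of be/4 and 1 - t0: above be/4 the separated power is integrable at 0, below 1 - t0 the
   exponent al' is still subcritical. *)
pose th := (be / 4 + 1 - t0) / 2.
have th1 : be / 4 < th by rewrite /th; lra.
have th2 : th < 1 - t0 by rewrite /th; lra.
have be40 : 0 <= be / 4 by rewrite divr_ge0.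
have th0 : 0 < th by exact: le_lt_trans th1.
have th11 : 0 < 1 - th by lra.
pose w := t0 / (1 - th).
have w0 : 0 < w by rewrite divr_gt0.
have w1 : w < 1 by rewrite ltr_pdivrMr// mul1r; lra.
pose al' := al / (1 - th).
have al'0 : 0 < al' by rewrite divr_gt0.
have alal' : al <= al' by rewrite ler_pdivlMr// ler_piMr// ?ltW//; lra.
have kk : 0 < (1 - w) / 2 by lra.
have kk1 : (1 - w) / 2 < 1 by lra.
have hal' : al' * a ^+ 2 < 32 * pi ^+ 2 * (1 - (1 - w) / 2).
  have -> : al' * a ^+ 2 = 32 * pi ^+ 2 * w.
    rewrite /al' /w /t0; have := gt_eqF th11; have := gt_eqF pi32; move: (32 * _) (1 - th) => u v un vn.
    by field; rewrite un vn.
  by rewrite ltr_pM2l//; lra.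
have [C1 [C10 hC1]] := exp_integral_bound al'0 a0 A0 B0 kk kk1 hal'.
(* Since (k - 2) th = - th - be/4 is at most - be/2, this power dominates the weight on the ball.
   The choice keeps k in (0, 1], also for be = 0. *)
pose k := 1 - be / 4 / th.
have k0 : 0 < k by rewrite subr_gt0 ltr_pdivrMr// mul1r.
have k2 : k < 2.
  have : 0 <= be / 4 / th by rewrite divr_ge0// ltW.
  by rewrite /k; lra.
have [C2 [C20 hC2]] := @int4_q4_powR R k k0 k2.
exists (C1 + (12 * pi ^+ 2 + C2)); split.
  by rewrite !addr_ge0// mulr_ge0// sqr_ge0.
move=> U f mU mf hf hU hae.
have mE : measurable_fun setT (fun x => (expR (al' * U x ^+ 2) - 1)%:E).
  apply/measurable_EFinP; apply: measurable_funB => //; apply: (measurableT_comp (@measurable_expR R)).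
  by apply: measurable_funM => //; exact: measurable_funX.
have mi : measurable_fun setT (fun x : pt4 R => ((q4 x < 1)%R%:R : R)%:E).
  by apply/measurable_EFinP; apply: measurable_ltR; exact: measurable_q4_0.
have mp : measurable_fun setT (fun x : pt4 R => ((q4 x < 1)%R%:R * q4 x `^ (k - 2))%:E).
  apply/measurable_EFinP; apply: measurable_funM; first by apply: measurable_ltR; exact: measurable_q4_0.
  exact: (measurableT_comp (measurable_powR _) (@measurable_q4_0 R)).
have e0 (c : R) x : 0 <= c -> 0 <= expR (c * U x ^+ 2) - 1.
  by move=> c0; rewrite subr_ge0 -[leLHS]expR0 ler_expR mulr_ge0 ?sqr_ge0.
(* The indicator of the ball makes up for the -1: [powR_conv] produces the full exponential. *)
apply: (@le_trans _ _ (\int[mu]_x ((expR (al' * U x ^+ 2) - 1)%:E + (((q4 x < 1)%R%:R : R)%:E + ((q4 x < 1)%R%:R * q4 x `^ (k - 2))%:E)))%E).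
  apply: ge0_le_integral => //.
  - by move=> x _; rewrite lee_fin divr_ge0 ?powR_ge0// e0// ltW.
  - by apply/measurable_EFinP; exact: measurable_AT.
  - by apply: emeasurable_funD => //; exact: emeasurable_funD.
  - move=> x _; rewrite -!EFinD lee_fin norm4E -powR12_sqrt ?q4_ge0// -powRrM.
    have ee : expR (al * U x ^+ 2) <= expR (al' * U x ^+ 2) by rewrite ler_expR ler_wpM2r ?sqr_ge0.
    have eal := e0 al x (ltW al0).
    have [q1|q1] := ltP (q4 x) 1; last first.
      rewrite mul0r !addr0; apply: (@le_trans _ _ (expR (al * U x ^+ 2) - 1)); last by rewrite lerD2r.
      rewrite ler_pdivrMr ?powR_gt0 ?(lt_le_trans ltr01)// ler_peMr//.
      by rewrite -[leLHS](powRr0 (q4 x)) ler_powR// mulr_ge0// invr_ge0.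
    rewrite mul1r.
    have := q4_ge0 x; rewrite le_eqVlt => /predU1P[q0|q0].
      (* At the origin the weight is 1 if be = 0; otherwise the norm to the power be is 0 and its
         inverse is 0 by default. *)
      rewrite -q0; have [->|ben] := eqVneq be 0.
        by rewrite mulr0 powRr0 divr1 ler_wpDr ?addr_ge0 ?powR_ge0// lerD2r.
      rewrite powR0 ?invr0 ?mulr0; last by rewrite mulf_neq0// invr_eq0.
      by rewrite addr_ge0 ?e0 ?(ltW al'0)// addr_ge0 ?powR_ge0.
    have := @powR_conv (expR (al' * U x ^+ 2)) (q4 x `^ (k - 2)) th (expR_ge0 _) (powR_ge0 _ _) th0.
    have th1' : th < 1 by rewrite -subr_gt0.
    move=> /(_ th1') h.
    rewrite [X in _ + (X + _)](_ : _ = 1)// addrA subrK; apply: le_trans h.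
    apply: ler_pM => //; first by rewrite invr_ge0 powR_ge0.
      rewrite -expRM (_ : al' * _ * _ = al * U x ^+ 2); first by rewrite lerBlDr lerDl.
      by rewrite /al'; field; rewrite gt_eqF.
    rewrite -powRrM -powRN; apply: ger_powR; first by rewrite q0 ltW.
    have -> : (k - 2) * th = - th - be / 4 by rewrite /k; field; rewrite gt_eqF.
    lra.
rewrite ge0_integralD//; last 3 first.
  by move=> x _; rewrite lee_fin e0// ltW.
  by move=> x _; rewrite -EFinD lee_fin addr_ge0// mulr_ge0// powR_ge0.
  exact: emeasurable_funD.
rewrite EFinD; apply: leeD; first exact: hC1 hf hU hae.
rewrite ge0_integralD//; last by move=> x _; rewrite lee_fin mulr_ge0// powR_ge0.
by rewrite EFinD; apply: leeD => //; exact: int4_unit_ball.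
Qed.
End ExpIntegral.

(** * The regularised fundamental solution and its Laplacian *)

Section LaplaceKernels.
Variable R : realType.
Local Notation mu := (@mu4 R).
Implicit Types (x y : pt4 R) (s c : R).

(* [chi] is the cutoff, normalised to [chi 0 = 1]; [Delta (Pc c s) = Rc c s - Kc c s] for [s = |y - x|^2],
   where [Kc c] is an approximation of [4 pi^2] times the Dirac mass. *)
Definition bump_poly : {poly R} := (expR 1)%:P.
Definition chi s : R := flat bump_poly (1 - s ^+ 2).
Let g1 s := flat (dflat bump_poly) (1 - s ^+ 2).
Let g2 s := flat (dflat (dflat bump_poly)) (1 - s ^+ 2).

Definition Kc c s : R := 8 * c * chi s * (s + c)^-1 ^+ 3.
Definition Pc c s : R := chi s * (s + c)^-1.
Definition Rc c s : R := (s + c)^-1 * s * (- 24 * g1 s + 16 * s ^+ 2 * g2 s)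
  + 16 * ((s + c)^-1 * s) ^+ 2 * g1 s.

Definition PHI : sexpr R := Mul (Flt bump_poly) (Iv R).

Lemma ev_dxQe x c i y : ev x c (dx i (Qe R)) y = 2 * (coord i y - coord i x).
Proof.
have h1 := @q4_is_derive R x i y.
have -> : ev x c (dx i (Qe R)) y = ev x 1 (dx i (Qe R)) y.
  by rewrite /Qe /=.
have h2 := @ev_is_derive R x 1 i (Qe R) y ltr01.
have e : (fun t => ev x 1 (Qe R) (upd i t y)) = (fun t => q4 (sub4 (upd i t y) x)).
  by apply/funext => t; rewrite evQe.
rewrite e in h2.
by have [_ <-] := h1; have [_ <-] := h2.
Qed.

Local Opaque Qe.
Lemma radial_dxdx x c i p (y : pt4 R) (s := q4 (sub4 y x)) (F := (s + c)^-1)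
   (f0 := flat p (1 - s ^+ 2)) (f1 := flat (dflat p) (1 - s ^+ 2)) (f2 := flat (dflat (dflat p)) (1 - s ^+ 2)) :
  ev x c (dx i (dx i (Mul (Flt p) (Iv R)))) y =
  2 * (- 2 * s * f1 * F - f0 * F ^+ 2) +
  4 * (coord i y - coord i x) ^+ 2 * ((- 2 * f1 + 4 * s ^+ 2 * f2) * F + 4 * s * f1 * F ^+ 2 + 2 * f0 * F ^+ 3).
Proof. rewrite /= ?eqxx evQe ev_dxQe -/s -/f0 -/f1 -/f2 -/F.
rewrite (_ : (true%:R : R) = 1)//; ring.
Qed.
Local Transparent Qe.

Lemma sum_affine (A B : R) x y :
  \sum_(i < 4) (A + 4 * (coord i y - coord i x) ^+ 2 * B) = 4 * A + 4 * q4 (sub4 y x) * B.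
Proof. by rewrite !big_ord_recr big_ord0/= add0r /q4 /sub4 /coord/=; ring. Qed.

(** In dimension four a function f(s) of s = |y - x|^2 has Laplacian 8 f' + 4 s f''. For f = 1/(s +
    c) this is - 8 c / (s + c)^3; the terms in which the cutoff is differentiated form [Rc]. *)
Lemma lapPHI x c y : 0 < c ->
  \sum_(i < 4) dpart [:: i; i] (ev x c PHI) y = Rc c (q4 (sub4 y x)) - Kc c (q4 (sub4 y x)).
Proof.
move=> c0.
have h i : dpart [:: i; i] (ev x c PHI) y = ev x c (dx i (dx i (Mul (Flt bump_poly) (Iv R)))) y.
  by rewrite dpart_ev.
under eq_bigr do rewrite h radial_dxdx.
rewrite sum_affine.
rewrite /Rc /Kc /chi /g1 /g2; have := q4_ge0 (sub4 y x); move: (q4 _) => s s0.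
move: (flat bump_poly _) (flat (dflat bump_poly) _) (flat (dflat (dflat _)) _) => f0 f1 f2.
have sc : s + c != 0 by rewrite gt_eqF// ltr_wpDl.
by field.
Qed.

Lemma chi_ge0 s : 0 <= chi s.
Proof.
rewrite /chi /flat; case: ifP => // _; rewrite hornerC mulr_ge0// expR_ge0.
Qed.

Lemma flat_ge1 p s : 1 <= s -> flat p (1 - s ^+ 2) = 0.
Proof.
by move=> s1; rewrite /flat ifF//; apply/negbTE; rewrite -leNgt subr_le0; nra.
Qed.

Lemma chi_le1 s : chi s <= 1.
Proof.
rewrite /chi /flat; case: ifPn => // h; rewrite hornerC -expRD -[leRHS]expR0 ler_expR subr_le0.
by rewrite -[leLHS]invr1 lef_pV2 ?posrE//; have := sqr_ge0 s; lra.
Qed.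

(** For s <= 1/2, 1 - exp(1 - 1/(1 - s^2)) <= s^2 / (1 - s^2) <= 2 s; beyond that the right side
    exceeds 1. Linear vanishing at s = 0 cancels one factor 1/(s + c) in later kernel estimates. *)
Lemma chi_lip s : 0 <= s -> s < 1 -> 1 - chi s <= 2 * s.
Proof.
move=> s0 s1; have [h|h] := ltP (2^-1) s.
  by have := chi_ge0 s; lra.
have p : 0 < 1 - s ^+ 2 by nra.
rewrite /chi /flat p hornerC -expRD.
have := @expR_ge1Dx R (1 - (1 - s ^+ 2)^-1).
have -> : 1 - (1 - s ^+ 2)^-1 = - (s ^+ 2 / (1 - s ^+ 2)) by field; rewrite gt_eqF.
suff : s ^+ 2 / (1 - s ^+ 2) <= 2 * s by lra.
by rewrite ler_pdivrMr//; nra.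
Qed.

Let iv_le c s : 0 <= s -> 0 <= c -> 0 <= (s + c)^-1 * s <= 1.
Proof.
move=> s0 c0; rewrite mulr_ge0 ?invr_ge0 ?addr_ge0//=.
have [->|sn] := eqVneq s 0; first by rewrite mulr0.
by rewrite mulrC ler_pdivrMr ?mul1r ?lerDl// ltr_wpDr// lt_neqAle eq_sym sn.
Qed.

(** Differentiating a function of s^2 produces a factor s for each 1/(s + c) in [Rc], and s / (s +
    c) <= 1. The bound is thus uniform in c, including c = 0. *)
Lemma Rc_bound : exists C, 0 <= C /\ forall c s, 0 <= c -> 0 <= s -> `|Rc c s| <= C * (s < 1)%R%:R.
Proof.
have [C1 [C10 h1]] := flat_bnd (dflat bump_poly).
have [C2 [C20 h2]] := flat_bnd (dflat (dflat bump_poly)).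
exists (24 * C1 + 16 * C2 + 16 * C1); split; first by lra.
move=> c s c0 s0; have [s1|s1] := ltP s 1; last first.
  rewrite [X in _ <= _ * X](_ : _ = 0)// mulr0.
  have e1 : g1 s = 0 by rewrite /g1 flat_ge1.
  have e2 : g2 s = 0 by rewrite /g2 flat_ge1.
  by rewrite /Rc e1 e2 !(mulr0, addr0) normr0.
have {}h1 : `|g1 s| <= C1 by apply: h1; rewrite gerBl sqr_ge0.
have {}h2 : `|g2 s| <= C2 by apply: h2; rewrite gerBl sqr_ge0.
rewrite mulr1 /Rc; have /andP[t0 t1] := iv_le s0 c0; move: ((s + c)^-1 * s) t0 t1 => t t0 t1.
have n1 : `|- 24 * g1 s + 16 * s ^+ 2 * g2 s| <= 24 * C1 + 16 * C2.
  rewrite (le_trans (ler_normD _ _))// lerD//.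
    by rewrite normrM normrN normr_nat ler_wpM2l.
  rewrite -mulrA normrM normr_nat ler_wpM2l// normrM ger0_norm ?sqr_ge0//.
  by apply: le_trans h2; rewrite ler_piMl//; nra.
rewrite (le_trans (ler_normD _ _))// lerD//.
  by rewrite normrM (ger0_norm t0); apply: le_trans n1; rewrite ler_piMl.
rewrite -mulrA normrM normr_nat ler_wpM2l// normrM ger0_norm ?sqr_ge0//.
by apply: le_trans h1; rewrite ler_piMl//; nra.
Qed.

Lemma Pc_ge0 c s : 0 <= c -> 0 <= s -> 0 <= Pc c s.
Proof. by move=> c0 s0; rewrite mulr_ge0 ?chi_ge0// invr_ge0 addr_ge0. Qed.

Lemma Pc_le c s : 0 <= c -> 0 < s -> Pc c s <= (s < 1)%R%:R * s^-1.
Proof.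
move=> c0 s0; rewrite /Pc; have [s1|s1] := ltP s 1; last by rewrite /chi flat_ge1// !mul0r.
apply: ler_pM; rewrite ?chi_ge0 ?chi_le1// ?invr_ge0 ?addr_ge0// ?(ltW s0)//.
by rewrite lef_pV2 ?posrE ?lerDl// ltr_pwDl.
Qed.

Lemma Kc_ge0 c s : 0 <= c -> 0 <= s -> 0 <= Kc c s.
Proof.
move=> c0 s0; rewrite /Kc mulr_ge0//; first by rewrite mulr_ge0 ?chi_ge0// mulr_ge0.
by rewrite exprn_ge0// invr_ge0 addr_ge0.
Qed.

Lemma Kc_le c s : 0 < c -> 0 <= s -> Kc c s <= 8 * c^-1 ^+ 2 * (s < 1)%R%:R.
Proof.
move=> c0 s0; have [s1|s1] := ltP s 1; last by rewrite /Kc /chi flat_ge1// !mulr0 !mul0r.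
rewrite mulr1 /Kc.
have : (s + c)^-1 ^+ 3 <= c^-1 ^+ 3.
  by rewrite ler_pXn2r ?nnegrE ?invr_ge0 ?addr_ge0 ?(ltW c0)// lef_pV2 ?posrE ?lerDr// ltr_wpDl.
have := chi_le1 s; have := chi_ge0 s.
have : 0 <= (s + c)^-1 ^+ 3 by rewrite exprn_ge0// invr_ge0 addr_ge0// ltW.
have -> : 8 * c^-1 ^+ 2 = 8 * c * c^-1 ^+ 3 by field; rewrite gt_eqF.
move: (chi s) ((s + c)^-1 ^+ 3) (c^-1 ^+ 3) => a b d b0 a0 a1 bd.
rewrite -!mulrA ler_wpM2l// ler_wpM2l ?(ltW c0)//; nra.
Qed.

Lemma measurable_flat p : measurable_fun setT (@flat R p).
Proof. by apply: continuous_measurable_fun; exact: flat_cts. Qed.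

Let measurable_flatc p : measurable_fun setT (fun s => flat p (1 - s ^+ 2)).
Proof. by apply: (measurableT_comp (measurable_flat p)); exact: measurable_funB. Qed.

Let measurable_iv c : measurable_fun setT (fun s => (s + c)^-1).
Proof. exact: measurable_addV. Qed.

Lemma measurable_Kc c : measurable_fun setT (Kc c).
Proof.
apply: measurable_funM; last by apply: measurable_funX; exact: measurable_iv.
by apply: measurable_funM => //; exact: measurable_flatc.
Qed.

Lemma measurable_Pc c : measurable_fun setT (Pc c).
Proof. by apply: measurable_funM; [exact: measurable_flatc|exact: measurable_iv]. Qed.

Lemma measurable_Rc c : measurable_fun setT (Rc c).
Proof.
have mi : measurable_fun setT (fun s => (s + c)^-1 * s) by apply: measurable_funM => //; exact: measurable_iv.
apply: measurable_funD.
  apply: measurable_funM => //; apply: measurable_funD; first by apply: measurable_funM => //; exact: measurable_flatc.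
  apply: measurable_funM; last exact: measurable_flatc.
  by apply: measurable_funM => //; exact: measurable_funX.
apply: measurable_funM; last exact: measurable_flatc.
by apply: measurable_funM => //; exact: measurable_funX.
Qed.

Lemma Rc_cvg s : 0 <= s -> Rc n.+1%:R^-1 s @[n --> \oo] --> Rc 0 s.
Proof.
move=> s0; have hi : (s + n.+1%:R^-1)^-1 * s @[n --> \oo] --> (s + 0)^-1 * s.
  have [->|sn] := eqVneq s 0.
    rewrite (_ : (fun n => _) = cst 0); last by apply/funext => n; rewrite mulr0.
    by rewrite mulr0; exact: cvg_cst.
  apply: cvgM; last exact: cvg_cst.
  by apply: cvgV; [rewrite addr0|apply: cvgD; [exact: cvg_cst|exact: cvg_harmonic]].
apply: cvgD; first by apply: cvgM hi _; exact: cvg_cst.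
apply: cvgM; last exact: cvg_cst.
by apply: cvgM; [exact: cvg_cst|rewrite expr2; exact: (cvgM hi hi)].
Qed.

Lemma Pc_cvg s : 0 < s -> Pc n.+1%:R^-1 s @[n --> \oo] --> Pc 0 s.
Proof.
move=> s0; apply: cvgM; first exact: cvg_cst.
by apply: cvgV; [rewrite addr0 gt_eqF|apply: cvgD; [exact: cvg_cst|exact: cvg_harmonic]].
Qed.

Lemma mu4_ball_fin (r : R) : 0 <= r ->
  (\int[mu]_y ((q4 y < r)%R%:R)%:E <= ((r + 1) ^+ 3 * (pi ^+ 2 / 2))%:E)%E.
Proof.
move=> r0.
have mj : measurable_fun setT (fun y : pt4 R => (q4 y + 1)^-1 ^+ 3).
  apply: measurable_funX; apply: measurable_addV; exact: measurable_q4_0.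
have p0 (y : pt4 R) : 0 <= (q4 y + 1)^-1 ^+ 3.
  by rewrite exprn_ge0// invr_ge0 (le_trans (q4_ge0 y))// lerDl.
have r1 : 0 <= (r + 1) ^+ 3 by rewrite exprn_ge0// addr_ge0.
apply: (@le_trans _ _ (((r + 1) ^+ 3)%:E * \int[mu]_y ((q4 y + 1)^-1 ^+ 3)%:E)%E).
  rewrite -ge0_integralZl_EFin//; last 2 first.
    by move=> y _; rewrite lee_fin.
    exact/measurable_EFinP.
  apply: ge0_le_integral => //.
  - by apply/measurable_EFinP; apply: measurable_ltR; exact: measurable_q4_0.
  - by apply: measurable_funeM; exact/measurable_EFinP.
  - move=> y _; rewrite -EFinM lee_fin; case: ltP => h; last by rewrite mulr_ge0.
    have q1 : 0 < q4 y + 1 by rewrite ltr_wpDl ?q4_ge0.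
    rewrite exprVn -[_ * _^-1]/(_ / _) ler_pdivlMr ?exprn_gt0// mul1r.
    by rewrite ler_pXn2r ?nnegrE ?(ltW q1) ?addr_ge0// lerD2r ltW.
by rewrite int4_q4_inv3// -EFinM mulr1.
Qed.

(** The majorant 8 r^3 / (s + r)^3 equals 8 at the point, while its integral 4 pi^2 r^2 tends to 0
    with r. *)
Lemma mu4_point x : mu [set y | q4 (sub4 y x) = 0] = 0%E.
Proof.
have mE : measurable [set y | q4 (sub4 y x) = 0].
  rewrite (_ : [set y | _] = (fun y => q4 (sub4 y x)) @^-1` [set 0]); last by [].
  rewrite -[X in measurable X]setTI; have := measurable_q4 x; apply => //; exact: measurable_set1.
apply/eqP; rewrite eq_le measure_ge0 andbT; apply/lee_addgt0Pr => e e0; rewrite add0e.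
pose r : R := e / (4 * pi ^+ 2 + e).
have p0 : 0 < 4 * pi ^+ 2 :> R by rewrite mulr_gt0// exprn_gt0// pi_gt0.
have r0 : 0 < r by rewrite divr_gt0// addr_gt0.
have r1 : r <= 1 by rewrite ler_pdivrMr ?addr_gt0// mul1r lerDr ltW.
have re : 4 * pi ^+ 2 * r <= e.
  by rewrite /r mulrCA ler_piMr ?(ltW e0)// ler_pdivrMr ?addr_gt0// mul1r lerDl ltW.
have mj : measurable_fun setT (fun y : pt4 R => (q4 y + r)^-1 ^+ 3).
  apply: measurable_funX; apply: measurable_addV; exact: measurable_q4_0.
have p1 (y : pt4 R) : 0 <= (q4 y + r)^-1 ^+ 3.
  by rewrite exprn_ge0// invr_ge0 (le_trans (q4_ge0 y))// lerDl ltW.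
have mjx := measurableT_comp mj (measurable_sub4 x).
rewrite -[X in mu X]setIT -integral_indic//.
apply: (@le_trans _ _ ((8 * r ^+ 3)%:E * \int[mu]_y ((q4 (sub4 y x) + r)^-1 ^+ 3)%:E)%E).
  rewrite -ge0_integralZl_EFin//; last 3 first.
    by move=> y _; rewrite lee_fin.
    exact/measurable_EFinP.
    by rewrite mulr_ge0// exprn_ge0// ltW.
  apply: ge0_le_integral => //.
  - by apply/measurable_EFinP; exact: measurable_indic.
  - by apply: measurable_funeM; exact/measurable_EFinP.
  - move=> y _; rewrite -EFinM lee_fin indicE; case: (boolP (_ \in _)) => h.
      move: h; rewrite inE/= => ->; rewrite add0r.
      rewrite -mulrA -exprMn mulfV ?gt_eqF// expr1n mulr1.
      by rewrite ler1n.
    by rewrite mulr_ge0// mulr_ge0// exprn_ge0// ltW.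
rewrite (@int4_shift R (fun y => ((q4 y + r)^-1 ^+ 3)%:E) x); last 2 first.
  exact/measurable_EFinP.
  by move=> y; rewrite lee_fin.
rewrite int4_q4_inv3// -EFinM lee_fin; apply: le_trans re.
have -> : 8 * r ^+ 3 * (pi ^+ 2 / (2 * r)) = 4 * pi ^+ 2 * r * r.
  by field; rewrite gt_eqF.
by rewrite ler_piMr// mulr_ge0 ?(ltW p0)// ltW.
Qed.
End LaplaceKernels.

(** * Integrability against test functions and the tested Laplacian *)

Section TestFunctions.
Variable R : realType.
Local Notation mu := (@mu4 R).
Implicit Types (x y : pt4 R) (f g u : pt4 R -> R).

Lemma coord_le_norm4 i x : `|coord i x| <= norm4 x.
Proof.
rewrite norm4E -sqrtr_sqr ler_wsqrtr// /q4 /coord.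
have h0 := sqr_ge0 x.1.1.1; have h1 := sqr_ge0 x.1.1.2; have h2 := sqr_ge0 x.1.2; have h3 := sqr_ge0 x.2.
by case: i => [[|[|[|[|//]]]] hi] /=; lra.
Qed.

Lemma compact_box (M : R) : compact [set x : pt4 R | forall i, - M <= coord i x <= M].
Proof.
have cI := @segment_compact R (- M) M.
have := compact_setX (compact_setX (compact_setX cI cI) cI) cI.
set A := (X in compact X -> _); set B := (X in _ -> compact X).
suff -> : A = B by [].
apply/seteqP; split => x /=; rewrite /A /B /= !in_itv/=.
  by move=> [[[h0 h1] h2] h3] i; rewrite /coord; case: i => [[|[|[|[|//]]]] hi].
move=> h; have := h 0; have := h 1; have := h (inord 2); have := h (inord 3).
by rewrite /coord/= !inordK.
Qed.

Lemma continuous_support_bounded f : continuous f -> (exists M : R, forall x, M < norm4 x -> f x = 0) ->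
  exists B, 0 <= B /\ forall x, `|f x| <= B.
Proof.
move=> cf [M hM].
have cb := @compact_box M.
have cnf : {within [set x : pt4 R | forall i, - M <= coord i x <= M], continuous f}.
  exact: continuous_subspaceT.
have /compact_bounded[B [_ hB]] := continuous_compact cnf cb.
exists (Num.max 0 (B + 1)); split; first by rewrite le_max lexx.
move=> x; rewrite le_max; have [h|h] := leP (norm4 x) M; last by rewrite hM// normr0 lexx.
apply/orP; right; apply: (hB (B + 1)); first by rewrite ltrDl.
by exists x => //= i; rewrite -ler_norml (le_trans (coord_le_norm4 i x)).
Qed.

Lemma integrable_ball_bounded f (r B : R) : 0 <= r -> measurable_fun setT f ->
  (forall x, `|f x| <= B * (q4 x < r)%R%:R) -> mu.-integrable setT (EFin \o f).
Proof.
move=> r0 mf hf; apply/integrableP; split; first exact/measurable_EFinP.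
have mi : measurable_fun setT (fun x : pt4 R => (q4 x < r)%R%:R : R).
  by apply: measurable_ltR; exact: measurable_q4_0.
apply: (@le_lt_trans _ _ (\int[mu]_x (`|B|%:E * ((q4 x < r)%R%:R)%:E))%E).
  apply: ge0_le_integral => //.
  - by apply: measurableT_comp => //; exact/measurable_EFinP.
  - by apply: measurable_funeM; exact/measurable_EFinP.
  - move=> x _; rewrite /= -EFinM lee_fin (le_trans (hf x))// ler_wpM2r//.
    exact: ler_norm.
rewrite ge0_integralZl_EFin//; last exact/measurable_EFinP.
apply: (@le_lt_trans _ _ (`|B|%:E * ((r + 1) ^+ 3 * (pi ^+ 2 / 2))%:E)%E).
  by rewrite lee_wpmul2l//; exact: mu4_ball_fin.
by rewrite -EFinM ltry.
Qed.

Lemma L2_integrable u : L2 u -> measurable_fun setT u /\ mu.-integrable setT (fun x => (u x ^+ 2)%:E).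
Proof. by move=> [mu' /leb4_integrable]. Qed.

Lemma integrable_L2_bounded u g (r B : R) : L2 u -> 0 <= r -> measurable_fun setT g ->
  (forall x, `|g x| <= B * (q4 x < r)%R%:R) -> mu.-integrable setT (fun x => (u x * g x)%:E).
Proof.
move=> /L2_integrable[mu0 iu] r0 mg hg.
have ig2 : mu.-integrable setT (EFin \o (fun x => g x ^+ 2)).
  apply: (@integrable_ball_bounded _ r (B ^+ 2)) => //; first exact: measurable_funX.
  move=> x; rewrite normrX; have := hg x; case: ltP => _; rewrite ?mulr1 ?mulr0 => h.
    by rewrite ler_pXn2r ?nnegrE// (le_trans _ h).
  by move: h; rewrite normr_le0 => /eqP ->; rewrite normr0 expr0n.
apply: (le_integrable _ _ _ (integrableD _ iu ig2)) => //.
  by apply/measurable_EFinP; exact: measurable_funM.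
move=> x _; rewrite -[X in (_ <= X)%E]/(`|u x ^+ 2 + g x ^+ 2|%:E) lee_fin.
rewrite [leRHS]ger0_norm ?addr_ge0 ?sqr_ge0// normrM.
rewrite -[u x ^+ 2]real_normK ?num_real// -[g x ^+ 2]real_normK ?num_real//.
have := normr_ge0 (u x); have := normr_ge0 (g x); nra.
Qed.

Lemma norm4_q4 x (M : R) : `|M| < norm4 x <-> M ^+ 2 < q4 x.
Proof.
rewrite norm4E -[M ^+ 2]real_normK ?num_real//; split => h.
  by rewrite -[ltRHS]sqr_sqrtr ?q4_ge0// ltr_pXn2r// nnegrE sqrtr_ge0.
rewrite -[ltLHS]ger0_norm// -sqrtr_sqr ltr_sqrt//.
by apply: le_lt_trans h; exact: sqr_ge0.
Qed.

Lemma test_fun_ball f : continuous f -> (exists M : R, forall x, M < norm4 x -> f x = 0) ->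
  exists r B : R, 0 <= r /\ forall x, `|f x| <= B * (q4 x < r)%R%:R.
Proof.
move=> cf hM; have [B [B0 hB]] := continuous_support_bounded cf hM.
have [M {}hM] := hM; exists (M ^+ 2 + 1), B; split; first by rewrite addr_ge0// sqr_ge0.
move=> x; case: ltP => h; first by rewrite mulr1.
rewrite mulr0 normr_le0 hM//; apply: le_lt_trans (ler_norm M) _.
by apply/norm4_q4; apply: lt_le_trans h; rewrite ltrDl.
Qed.

Lemma integrable_L2_test u f : L2 u -> continuous f -> (exists M : R, forall x, M < norm4 x -> f x = 0) ->
  mu.-integrable setT (fun x => (u x * f x)%:E).
Proof.
move=> Lu cf hM; have [r [B [r0 h]]] := test_fun_ball cf hM.
by apply: integrable_L2_bounded h => //; exact: continuous_measurable4.
Qed.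

(** The weak derivatives are tested on the cutoff kernel [PHI] and summed over i, using [lapPHI].
    Most of the proof shows each term integrable, without which the sums could not be rearranged in
    the extended reals. *)
Lemma laplacian_identity u (h : 'I_4 -> pt4 R -> R) x (c : R) : 0 < c -> L2 u ->
  (forall i, L2 (h i)) -> (forall i, weak_deriv [:: i; i] u (h i)) ->
  (\int[mu]_y (u y * Kc c (q4 (sub4 y x)))%:E =
   \int[mu]_y (u y * Rc c (q4 (sub4 y x)) - (\sum_(i < 4) h i y) * Pc c (q4 (sub4 y x)))%:E)%E.
Proof.
move=> c0 Lu Lh wh.
pose phi := ev x c (@PHI R).
have tphi : test_fun phi by exact: test_fun_ev.
pose r := 2 + 2 * q4 x.
have r0 : 0 <= r by rewrite addr_ge0// mulr_ge0// q4_ge0.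
have near_r y : (q4 (sub4 y x) < 1)%R%:R <= (q4 y < r)%R%:R :> R.
  rewrite ler_nat; case: (ltP (q4 (sub4 y x)) 1) => // hlt.
  by rewrite (_ : q4 y < r)// (le_lt_trans (q4_tri x y))// /r; lra.
have ball (g : R -> R) (w : pt4 R -> R) (B : R) : L2 w -> 0 <= B -> measurable_fun setT g -> (forall s : R, 0 <= s -> `|g s| <= B * (s < 1)%R%:R) ->
    mu.-integrable setT (fun y => (w y * g (q4 (sub4 y x)))%:E).
  move=> Lw B0 mg hg; apply: (@integrable_L2_bounded w (fun y => g (q4 (sub4 y x))) r B) => //.
    exact: (measurableT_comp mg (measurable_q4 x)).
  by move=> y; rewrite (le_trans (hg _ (q4_ge0 _)))// ler_wpM2l.
have iK : mu.-integrable setT (fun y => (u y * Kc c (q4 (sub4 y x)))%:E).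
  apply: (ball _ _ (8 * c^-1 ^+ 2)) => //.
  - by rewrite mulr_ge0// sqr_ge0.
  - exact: measurable_Kc.
  - by move=> s s0; rewrite ger0_norm ?Kc_le// Kc_ge0// ltW.
have [CR [CR0 hCR]] := Rc_bound R.
have iR : mu.-integrable setT (fun y => (u y * Rc c (q4 (sub4 y x)))%:E).
  apply: (ball _ _ CR) => //; first exact: measurable_Rc.
  by move=> s s0; rewrite hCR// ltW.
have iP i : mu.-integrable setT (fun y => (h i y * Pc c (q4 (sub4 y x)))%:E).
  apply: (ball _ _ c^-1) => //; [by rewrite invr_ge0 ltW|exact: measurable_Pc|].
  move=> s s0; rewrite ger0_norm ?Pc_ge0 ?(ltW c0)// /Pc; case: ltP => s1; last first.
    by rewrite /chi flat_ge1// mul0r mulr0.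
  rewrite mulr1 -[leRHS]mul1r; apply: ler_pM; rewrite ?chi_ge0 ?chi_le1 ?invr_ge0 ?addr_ge0 ?(ltW c0)//.
  by rewrite lef_pV2 ?posrE ?lerDr// ltr_wpDl.
have iD i : mu.-integrable setT (fun y => (u y * dpart [:: i; i] phi y)%:E).
  apply: integrable_L2_test => //; first exact: (tphi.1.2 [:: i; i]).
  exists (Num.sqrt r) => y; rewrite norm4E => hy.
  have hq : 1 <= q4 (sub4 y x).
    rewrite leNgt; apply/negP => h1; have := near_r y; rewrite h1 /=.
    case: ltP => h2; last by rewrite ler_nat.
    by move: hy; rewrite ltNge ler_wsqrtr// ltW.
  rewrite dpart_ev// [foldr _ _ _]/(dx i (dx i (@PHI R))) radial_dxdx !flat_ge1//.
  by rewrite !(mulr0, mul0r, addr0, subr0).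
have wi i : (\int[mu]_y (u y * dpart [:: i; i] phi y)%:E = \int[mu]_y (h i y * Pc c (q4 (sub4 y x)))%:E)%E.
  have := wh i phi tphi; rewrite !leb4_integral => ->.
  by rewrite /= sqrrN expr1n mul1e.
have hPE y : ((\sum_(i < 4) h i y) * Pc c (q4 (sub4 y x)))%:E = (\sum_(i < 4) (h i y * Pc c (q4 (sub4 y x)))%:E)%E.
  by rewrite sumEFin big_distrl.
have iS : mu.-integrable setT (fun y => ((\sum_(i < 4) h i y) * Pc c (q4 (sub4 y x)))%:E).
  rewrite (_ : (fun y => _) = (fun y => \sum_(i < 4) (h i y * Pc c (q4 (sub4 y x)))%:E)%E); last first.
    by apply/funext => y; rewrite hPE.
  by apply: integrable_sum => // i _; exact: iP.
have e1 : (\int[mu]_y (u y * (Rc c (q4 (sub4 y x)) - Kc c (q4 (sub4 y x))))%:E =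
   \int[mu]_y ((\sum_(i < 4) h i y) * Pc c (q4 (sub4 y x)))%:E)%E.
  transitivity (\int[mu]_y (\sum_(i < 4) (u y * dpart [:: i; i] phi y)%:E))%E.
    by apply: eq_integral => y _; rewrite -lapPHI// sumEFin big_distrr.
  rewrite integral_sum//.
  under eq_bigr do rewrite wi.
  rewrite -integral_sum//.
  by apply: eq_integral => y _; rewrite hPE.
under [RHS]eq_integral do rewrite EFinB.
rewrite integralB// -e1.
under [X in (_ - X)%E]eq_integral do rewrite mulrBr EFinB.
rewrite [X in (_ - X)%E]integralB//.
have fR := integrable_fin_num measurableT iR; have fK := integrable_fin_num measurableT iK.
by rewrite fin_num_oppeB// addeA subee// add0e.
Qed.
End TestFunctions.

(** * Open boxes as a generating pi-system *)

Section Boxes.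
Variable R : realType.
Local Notation mu := (@mu4 R).
Implicit Types (x y lo hi : pt4 R).

Definition box lo hi : set (pt4 R) := [set x | forall i, coord i lo < coord i x < coord i hi].

Definition cst4 (a : R) : pt4 R := (((a, a), a), a).

Lemma coord_cst4 i a : coord i (cst4 a) = a.
Proof. by rewrite /coord; case: i => [[|[|[|[|//]]]] hi]. Qed.

Lemma coord_ext x y : (forall i, coord i x = coord i y) -> x = y.
Proof.
move: x y => [[[x0 x1] x2] x3] [[[y0 y1] y2] y3] h.
have := h 0; have := h 1; have := h (inord 2); have := h (inord 3).
by rewrite /coord/= !inordK//= => -> -> -> ->.
Qed.

Definition mk4 (f : 'I_4 -> R) : pt4 R := (((f 0, f 1), f (inord 2)), f (inord 3)).

Lemma coord_mk4 i f : coord i (mk4 f) = f i.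
Proof.
rewrite /coord; case: i => [[|[|[|[|//]]]] hi] /=; congr f; apply/val_inj => //=; by rewrite inordK.
Qed.

Lemma indic01 (B : set (pt4 R)) x : 0 <= (\1_B x : R) <= 1.
Proof. by rewrite indicE; case: (_ \in _); rewrite /= ?lexx ?ler01. Qed.

Lemma measurable_box lo hi : measurable (box lo hi).
Proof.
rewrite (_ : box lo hi = \bigcap_(i in [set: 'I_4]) ((coord i) @^-1` `]coord i lo, coord i hi[%classic)).
  apply: fin_bigcap_measurable => // i _; rewrite -[X in measurable X]setTI.
  exact: (measurable_coord i).
apply/seteqP; split => x /= h i; last by have := h i I; rewrite /= in_itv.
by move=> _; rewrite /= in_itv/=; exact: h.
Qed.

Definition boxes : set (set (pt4 R)) := [set B | exists lo hi, B = box lo hi].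

Lemma boxes_setI : setI_closed boxes.
Proof.
move=> _ _ [lo [hi ->]] [lo' [hi' ->]].
exists (mk4 (fun i => Num.max (coord i lo) (coord i lo'))), (mk4 (fun i => Num.min (coord i hi) (coord i hi'))).
apply/seteqP; split => x /=.
  by move=> [h h'] i; rewrite !coord_mk4 gt_max lt_min; have /andP[-> ->] := h i; have /andP[-> ->] := h' i.
by move=> h; split=> i; have := h i; rewrite !coord_mk4 gt_max lt_min => /andP[/andP[? ?] /andP[? ?]]; apply/andP.
Qed.

Lemma box_exhaust x : exists n : nat, box (cst4 (- n%:R)) (cst4 n%:R) x.
Proof.
pose r := norm4 x + 1; have r0 : 0 <= r by rewrite addr_ge0// norm4E sqrtr_ge0.
exists (Num.truncn r).+1 => i; rewrite !coord_cst4.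
rewrite -ltr_norml (le_lt_trans (coord_le_norm4 i x))// (lt_trans _ (truncnS_gt _))//.
by rewrite /r ltrDl.
Qed.

(** A half-space a < x_i is an increasing union of boxes, so the coordinates, and with them the
    identity map, are measurable for the sigma-algebra generated by boxes. *)
Lemma measurable_boxes : @measurable _ (pt4 R) = <<s boxes >>.
Proof.
apply/seteqP; split; last first.
  apply: smallest_sub; first exact: sigma_algebra_measurable.
  by move=> _ [lo [hi ->]]; exact: measurable_box.
pose T : measurableType _ := g_sigma_algebraType boxes.
have mc i : @measurable_fun _ _ T R setT (coord i).
  have mR : @measurable default_measure_display R = <<s (@RGenOInfty.G R) >> by exact: RGenOInfty.measurableE.
  apply: (@measurability _ default_measure_display T R setT (coord i) (@RGenOInfty.G R) mR).
  move=> _ [_ [a ->] <-]; rewrite setTI.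
  rewrite (_ : _ @^-1` _ = \bigcup_n (box (mk4 (fun j => if j == i then a else - n%:R)) (cst4 n%:R))); last first.
    apply/seteqP; split => x /=; rewrite ?in_itv/= ?andbT.
      move=> ax; have [n hn] := box_exhaust x; exists n => // j.
      have := hn j; rewrite coord_mk4 !coord_cst4 => /andP[h ->]; rewrite andbT.
      by case: eqP => [->|_].
    by move=> [n _ h]; have := h i; rewrite coord_mk4 eqxx => /andP[].
  apply: bigcupT_measurable => n; apply: sub_sigma_algebra.
  by do 2 eexists.
have mid : @measurable_fun _ _ T (pt4 R) setT id.
  have -> : (id : T -> pt4 R) = (fun x : T => (((coord 0 x, coord 1 x), coord (inord 2) x), coord (inord 3) x)).
    by apply/funext => x; apply: coord_ext => i; rewrite -/(mk4 (fun i => coord i x)) coord_mk4.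
  by apply: measurable_fun_pair => //; apply: measurable_fun_pair => //; exact: measurable_fun_pair.
by move=> A mA; have := mid measurableT A mA; rewrite setTI.
Qed.

(** The measurable sets over which a localised [F] integrates to 0 form a Dynkin class containing
    all boxes. *)
Lemma box_ae0 (F : pt4 R -> \bar R) :
  (forall lo hi, mu.-integrable setT (fun x => (\1_(box lo hi) x)%:E * F x)%E /\
     \int[mu]_x ((\1_(box lo hi) x)%:E * F x) = 0)%E ->
  {ae mu, forall x, F x = 0%E}.
Proof.
move=> hF.
(* [F] is integrable over boxes only, so it is first cut off to the cubes [K n]; intersections with
   [K n] are again boxes. *)
pose K (n : nat) := box (cst4 (- n%:R)) (cst4 n%:R).
pose H n x := ((\1_(K n) x)%:E * F x)%E.
have iH n : mu.-integrable setT (H n) by exact: (hF _ _).1.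
have H0 n A : measurable A -> (\int[mu]_(x in A) H n x = 0)%E.
  rewrite measurable_boxes; move: A.
  have fH A : measurable A -> (\int[mu]_(x in A) H n x)%E \is a fin_num.
    by move=> mA; apply: integrable_fin_num => //; exact: integrableS (iH n).
  apply: (dynkin_induction measurable_boxes boxes_setI).
  - exact: (hF _ _).2.
  - move=> _ [lo [hi ->]].
    have [lo' [hi' e]] : boxes (box lo hi `&` K n).
      by apply: boxes_setI; [exists lo, hi|exists (cst4 (- n%:R)), (cst4 n%:R)].
    rewrite integral_mkcond -[RHS](hF lo' hi').2; apply: eq_integral => x _.
    rewrite /patch /H -e !indicE in_setI; case: (x \in box lo hi) => //=.
    by rewrite mul0e.
  - move=> A mA hA.
    have := chargeD (induced_charge (iH n)) measurableT mA.
    change (\int[mu]_(x in setT `\` A) H n x = \int[mu]_(x in setT) H n x - \int[mu]_(x in setT `&` A) H n x ->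
      \int[mu]_(x in ~` A) H n x = 0)%E.
    by rewrite setTD setTI hA (hF _ _).2 sube0.
  - move=> A mA tA hA.
    have := @charge_semi_sigma_additive _ _ _ (induced_charge (iH n)) A mA tA (bigcupT_measurable A mA).
    rewrite (_ : (fun k => _) = cst 0%E).
      by move=> h; apply/esym; apply: (cvg_unique _ _ h) => //; exact: cvg_cst.
    by apply/funext => k; rewrite big1// => i _; exact: hA.
have aeH n : {ae mu, forall x, H n x = 0%E}.
  have := @integral_ae_eq _ _ _ mu setT measurableT (cst 0%E) (H n) (iH n) (measurable_cst _).
  move=> h; have {}h : ae_eq mu setT (H n) (cst 0%E).
    by apply: h => E _ mE; rewrite H0// integral0.
  by apply: filterS h => x /(_ I).
have := ae_foralln aeH; apply: filterS => x hx.
have [n hn] := box_exhaust x; have := hx n.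
by rewrite /H indicE mem_set// mul1e.
Qed.
End Boxes.

(** * Regularity of box indicators off their faces *)

Section BoxAverages.
Variable R : realType.
Local Notation mu := (@mu4 R).
Implicit Types (x y lo hi : pt4 R) (c s : R).

Lemma prodms_null d1 d2 (T1 : measurableType d1) (T2 : measurableType d2)
  (m1 : {sigma_finite_measure set T1 -> \bar R}) (m2 : {sigma_finite_measure set T2 -> \bar R})
  (A : set T1) (B : set T2) : measurable A -> measurable B -> m1 A = 0%E \/ m2 B = 0%E ->
  prodms m1 m2 (A `*` B) = 0%E.
Proof.
move=> mA mB h; rewrite [LHS](@product_measure1E _ _ _ _ _ m1 m2)//.
by case: h => h; [rewrite -(mul0e (m2 B))|rewrite -(mule0 (m1 A))]; congr (_ * _)%E.
Qed.

Lemma mu4_hyperplane i (a : R) : mu [set x | coord i x = a] = 0%E.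
Proof.
have z : @leb1 R [set a] = 0%E by exact: lebesgue_measure_set1.
case: i => [[|[|[|[|//]]]] hi].
- rewrite (_ : [set x | _] = [set a] `*` setT `*` setT `*` setT); last first.
    by apply/seteqP; split => [[[[? ?] ?] ?]|[[[? ?] ?] ?] [[[]]]] //=.
  do 3![apply: prodms_null => //; try (by do ?apply: measurableX); left] => //.
- rewrite (_ : [set x | _] = setT `*` [set a] `*` setT `*` setT); last first.
    by apply/seteqP; split => [[[[? ?] ?] ?]|[[[? ?] ?] ?] [[[]]]] //=.
  do 2![apply: prodms_null => //; try (by do ?apply: measurableX); left] => //.
  by apply: prodms_null => //; right.
- rewrite (_ : [set x | _] = setT `*` [set a] `*` setT); last first.
    by apply/seteqP; split => [[[[? ?] ?] ?]|[[[? ?] ?] ?] [[]]] //=.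
  apply: prodms_null => //; try (by do ?apply: measurableX); left => //.
  by apply: prodms_null => //; right.
- rewrite (_ : [set x | _] = setT `*` [set a]); last first.
    by apply/seteqP; split => [[[[? ?] ?] ?]|[[[? ?] ?] ?] []] //=.
  by apply: prodms_null => //; right.
Qed.

Lemma coord_sq_le i x y : (coord i y - coord i x) ^+ 2 <= q4 (sub4 y x).
Proof.
rewrite /q4 /sub4 /coord /=.
have h0 := sqr_ge0 (y.1.1.1 - x.1.1.1); have h1 := sqr_ge0 (y.1.1.2 - x.1.1.2).
have h2 := sqr_ge0 (y.1.2 - x.1.2); have h3 := sqr_ge0 (y.2 - x.2).
by case: i => [[|[|[|[|//]]]] hi] /=; lra.
Qed.

(** Avoids the whole hyperplanes through the faces; at such points the indicator of the box is
    locally constant. *)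
Definition off_faces lo hi y := forall i, coord i y != coord i lo /\ coord i y != coord i hi.

Lemma ae_off_faces lo hi : {ae mu, forall y, off_faces lo hi y}.
Proof.
have h i (a : R) : {ae mu, forall y, coord i y != a}.
  exists [set x | coord i x = a]; split.
  - rewrite (_ : [set x | _] = coord i @^-1` [set a])// -[X in measurable X]setTI.
    exact: (measurable_coord i).
  - exact: mu4_hyperplane.
  - by move=> x /= /negP; rewrite negbK => /eqP.
have hh i : {ae mu, forall y, coord i y != coord i lo /\ coord i y != coord i hi}.
  by apply: filterS2 (h i (coord i lo)) (h i (coord i hi)) => y.
(* The four conditions are indexed by natural numbers, vacuously from 4 on, so that a countable
   intersection of almost-everywhere sets applies. *)
have hn (n : nat) : {ae mu, forall y, forall hn : (n < 4)%N,
    coord (Ordinal hn) y != coord (Ordinal hn) lo /\ coord (Ordinal hn) y != coord (Ordinal hn) hi}.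
  case: (pselect (n < 4)%N) => n4; last by apply: aeW => y hn; case: (n4 hn).
  by apply: filterS (hh (Ordinal n4)) => y h0 hn; rewrite (bool_irrelevance hn n4).
by have := ae_foralln hn; apply: filterS => y h0 [n n4]; exact: h0.
Qed.

(** If the indicator differs at x and y, then in some coordinate a face separates them, and s is at
    least the squared distance from y to it. [D] sums the inverse squared distances to all faces.
    Linearity in s is what the kernel estimate needs. *)
Lemma box_lip lo hi y : off_faces lo hi y -> exists D : R, 0 <= D /\
  forall x, `|\1_(box lo hi) x - \1_(box lo hi) y| <= D * q4 (sub4 y x) :> R.
Proof.
move=> hy; pose d i := ((coord i y - coord i lo) ^+ 2)^-1 + ((coord i y - coord i hi) ^+ 2)^-1.
have d0 i : 0 <= d i by rewrite addr_ge0// invr_ge0 sqr_ge0.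
exists (\sum_(i < 4) d i); split; first exact: sumr_ge0.
move=> x.
have key i (p t : R) : p = coord i lo \/ p = coord i hi ->
    (coord i y - p) ^+ 2 <= t -> 1 <= (\sum_(i < 4) d i) * t.
  move=> hp ht.
  have yp : 0 < (coord i y - p) ^+ 2.
    by rewrite exprn_even_gt0//= subr_eq0; have [] := hy i; case: hp => ->.
  have t0 : 0 <= t by apply: le_trans ht; exact: ltW.
  have : ((coord i y - p) ^+ 2)^-1 <= \sum_(i < 4) d i.
    rewrite (bigD1 i)//= (@le_trans _ _ (d i))//; last by rewrite lerDl sumr_ge0.
    by case: hp => ->; rewrite /d ?lerDl ?lerDr invr_ge0 sqr_ge0.
  move=> h; apply: le_trans (ler_wpM2r t0 h).
  by rewrite mulrC ler_pdivlMr// mul1r.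
have q := q4_ge0 (sub4 y x).
have D0 : 0 <= \sum_(i < 4) d i by exact: sumr_ge0.
rewrite !indicE; have [hx|hx] := boolP (x \in _); have [h|h] := boolP (y \in _);
  rewrite ?subrr ?normr0 ?subr0 ?sub0r ?normrN ?normr1 ?mulr_ge0//.
- have [i hi'] : exists i, ~ (coord i lo < coord i y < coord i hi).
    by apply/existsNP => hh; move/negP: h; apply; rewrite inE.
  move: hx; rewrite inE => /(_ i) /andP[xl xh].
  have [n1 n2] := hy i.
  have ci := coord_sq_le i x y.
  have [h1|h1] := ltP (coord i lo) (coord i y).
    have h2 : coord i hi < coord i y.
      rewrite lt_neqAle eq_sym n2/= leNgt; apply/negP => h2; apply: hi'; by rewrite h1.
    by apply: (key i (coord i hi)); [right|nra].
  have {}h1 : coord i y < coord i lo by rewrite lt_neqAle n1.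
  by apply: (key i (coord i lo)); [left|nra].
- have [i hi'] : exists i, ~ (coord i lo < coord i x < coord i hi).
    by apply/existsNP => hh; move/negP: hx; apply; rewrite inE.
  move: h; rewrite inE => /(_ i) /andP[xl xh].
  have ci := coord_sq_le i x y.
  have [h1|h1] := ltP (coord i lo) (coord i x).
    have h2 : coord i hi <= coord i x.
      rewrite leNgt; apply/negP => h2; apply: hi'; by rewrite h1.
    by apply: (key i (coord i hi)); [right|nra].
  by apply: (key i (coord i lo)); [left|nra].
Qed.

Lemma box_ball lo hi : exists r : R, 0 <= r /\ forall x, box lo hi x -> q4 x < r.
Proof.
pose t i := `|coord i lo| + `|coord i hi| + 1.
have t0 i : 0 <= t i by rewrite !addr_ge0.
exists (t 0 ^+ 2 + t 1 ^+ 2 + t (inord 2) ^+ 2 + t (inord 3) ^+ 2); split.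
  by rewrite !addr_ge0// exprn_ge0.
move=> x hx; have h i : coord i x ^+ 2 < t i ^+ 2.
  rewrite -[ltLHS]real_normK ?num_real// ltr_pXn2r// ?nnegrE// /t.
  have /andP[h1 h2] := hx i.
  have h3 := ler_norm (coord i hi); have h4 := ler_norm (- coord i lo); rewrite normrN in h4.
  have h5 := normr_ge0 (coord i hi); have h6 := normr_ge0 (coord i lo).
  by rewrite ltr_norml; apply/andP; split; lra.
have h0 := h 0; have h1 := h 1; have h2 := h (inord 2); have h3 := h (inord 3).
by move: h0 h1 h2 h3; rewrite /coord /= !inordK// /q4; lra.
Qed.

Lemma mul_oppln_le1 (t : R) : 0 < t -> t * - ln t <= 1.
Proof.
move=> t0; have := @le_ln1Dx R (t^-1 - 1).
rewrite (_ : 1 + (t^-1 - 1) = t^-1); last by ring.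
rewrite lnV ?posrE// ltrBrDl subrr invr_gt0 t0 => /(_ isT) h.
by have := ler_wpM2l (ltW t0) h; rewrite mulrBr mulfV ?gt_eqF// mulr1; lra.
Qed.

(** With t = sqrt(c) this follows from - t ln t <= 1. It makes the error of the approximate
    identity, of size c (3 - ln c), tend to 0. *)
Lemma cln_le c : 0 < c -> c <= 1 -> c * (3 - ln c) <= 5 * Num.sqrt c.
Proof.
move=> c0 c1; set t := Num.sqrt c.
have t0 : 0 < t by rewrite sqrtr_gt0.
have e : c = t ^+ 2 by rewrite sqr_sqrtr// ltW.
have h := mul_oppln_le1 t0.
rewrite e lnXn// -mulr_natl.
nra.
Qed.

Lemma sqrt_harmonic_cvg : Num.sqrt (n.+1%:R^-1 : R) @[n --> \oo] --> (0 : R).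
Proof.
rewrite -[X in _ --> X]sqrtr0; apply: cvg_comp; first exact: (@cvg_harmonic R).
exact: sqrt_continuous.
Qed.
End BoxAverages.

(** * The approximate identity tested on boxes *)

Section KernelLimit.
Variable R : realType.
Local Notation mu := (@mu4 R).
Implicit Types (x y lo hi : pt4 R) (c s : R).

(** [Kc] without the cutoff: its mass is exactly 4 pi^2 for every c > 0, so it serves as the
    reference for [Kc]. *)
Let full c s : R := 8 * c * (s + c)^-1 ^+ 3.

Let full_ge0 c s : 0 < c -> 0 <= s -> 0 <= full c s.
Proof. by move=> c0 s0; rewrite mulr_ge0 ?(mulr_ge0 _ (ltW c0))// exprn_ge0// invr_ge0 addr_ge0// ltW. Qed.

Let mfull c : measurable_fun setT (full c).
Proof.
apply: measurable_funM => //; apply: measurable_funX.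
exact: measurable_addV.
Qed.

Let Kc_full c s : 0 < c -> 0 <= s -> Kc c s <= full c s.
Proof.
move=> c0 s0; rewrite /Kc mulrAC -[leRHS]mulr1; apply: ler_wpM2l (chi_le1 s).
exact: (full_ge0 c0 s0).
Qed.

Let measurable_dq2 (phi : R -> R) y : measurable_fun setT phi ->
  measurable_fun setT (fun x => phi (q4 (sub4 y x))).
Proof.
move=> mphi; apply: (measurableT_comp mphi).
rewrite (_ : (fun x => _) = (fun x => q4 (sub4 x y))); last by apply/funext => x; rewrite q4_sub4C.
exact: measurable_q4.
Qed.

Let int4_dq2 (phi : R -> R) y : measurable_fun setT phi -> (forall s, 0 <= s -> 0 <= phi s) ->
  (\int[mu]_x (phi (q4 (sub4 y x)))%:E = \int[mu]_y (phi (q4 y))%:E)%E.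
Proof.
move=> mphi phi0; under eq_integral do rewrite q4_sub4C.
rewrite (@int4_shift R (fun x => (phi (q4 x))%:E) y)//; last first.
  by move=> x; rewrite lee_fin phi0// q4_ge0.
by apply/measurable_EFinP; exact: (measurableT_comp mphi (@measurable_q4_0 R)).
Qed.

Lemma int4_full y c : 0 < c -> (\int[mu]_x (full c (q4 (sub4 y x)))%:E = (4 * pi ^+ 2)%:E)%E.
Proof.
move=> c0; rewrite int4_dq2//; last by move=> s; exact: full_ge0.
under eq_integral do rewrite EFinM.
rewrite ge0_integralZl_EFin//; last 3 first.
- by move=> x _; rewrite lee_fin exprn_ge0// invr_ge0 addr_ge0 ?q4_ge0// ltW.
- apply/measurable_EFinP; apply: measurable_funX; apply: measurable_addV; exact: measurable_q4_0.
- by rewrite mulr_ge0// ltW.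
by rewrite int4_q4_inv3// -EFinM; congr EFin; field; rewrite gt_eqF.
Qed.

Lemma measurable_indic_box lo hi : measurable_fun setT (\1_(box lo hi) : pt4 R -> R).
Proof. by apply: measurable_indic; exact: measurable_box. Qed.

Let integrable_full y c : 0 < c -> mu.-integrable setT (fun x => (full c (q4 (sub4 y x)))%:E).
Proof.
move=> c0; apply/integrableP; split; first by apply/measurable_EFinP; exact: measurable_dq2.
under eq_integral do rewrite /= ger0_norm ?full_ge0 ?q4_ge0//.
by rewrite int4_full// ltry.
Qed.

Lemma integrable_boxK lo hi y c : 0 < c ->
  mu.-integrable setT (fun x => (\1_(box lo hi) x * Kc c (q4 (sub4 y x)))%:E).
Proof.
move=> c0; apply: (le_integrable _ _ _ (integrable_full y c0)) => //.
  apply/measurable_EFinP; apply: measurable_funM; first exact: measurable_indic_box.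
  by apply: measurable_dq2; exact: measurable_Kc.
move=> x _; rewrite /= lee_fin normrM.
have /andP[i0 i1] := indic01 (box lo hi) x.
have K0 : 0 <= Kc c (q4 (sub4 y x)) by rewrite Kc_ge0 ?q4_ge0 ?ltW.
have KF := Kc_full c0 (q4_ge0 (sub4 y x)).
rewrite (ger0_norm i0) (ger0_norm K0) ger0_norm ?(le_trans K0 KF)//; apply: le_trans KF; exact: ler_piMl.
Qed.

(** After Fubini the kernel is integrated in its centre x with y fixed, so that it acts on the box
    indicator and not on u. *)
Definition box_mass lo hi c y : R := \int[mu]_x (\1_(box lo hi) x * Kc c (q4 (sub4 y x))).

Lemma box_massE lo hi c y : 0 < c ->
  (\int[mu]_x (\1_(box lo hi) x * Kc c (q4 (sub4 y x)))%:E = (box_mass lo hi c y)%:E)%E.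
Proof. by move=> c0; rewrite fineK//; apply: integrable_fin_num => //; exact: integrable_boxK. Qed.

Lemma box_mass_ge0 lo hi c y : 0 < c -> 0 <= box_mass lo hi c y.
Proof.
move=> c0; rewrite -lee_fin -box_massE//; apply: integral_ge0 => x _.
by rewrite lee_fin mulr_ge0 ?Kc_ge0 ?q4_ge0 ?(ltW c0)//; have /andP[] := indic01 (box lo hi) x.
Qed.

Lemma box_mass_le lo hi c y : 0 < c -> box_mass lo hi c y <= 4 * pi ^+ 2.
Proof.
move=> c0; rewrite -lee_fin -box_massE// -(int4_full y c0).
apply: ge0_le_integral => //.
- by move=> x _; rewrite lee_fin mulr_ge0 ?Kc_ge0 ?q4_ge0 ?(ltW c0).
- exact: (measurable_int mu (integrable_boxK lo hi y c0)).
- exact: (measurable_int mu (integrable_full y c0)).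
move=> x _; rewrite lee_fin; have /andP[i0 i1] := indic01 (box lo hi) x.
apply: le_trans (Kc_full c0 (q4_ge0 (sub4 y x))); apply: ler_piMl => //.
by rewrite Kc_ge0 ?q4_ge0 ?ltW.
Qed.

Lemma box_mass_far lo hi c y r : 0 < c -> (forall x, box lo hi x -> q4 x < r) -> 2 + 2 * r <= q4 y ->
  box_mass lo hi c y = 0.
Proof.
move=> c0 hr hy; apply: EFin_inj; rewrite -box_massE//.
rewrite integral0_eq// => x _; rewrite indicE; case: (boolP (x \in _)) => h; last by rewrite mul0r.
move: h; rewrite inE => /hr qx.
rewrite /Kc /chi flat_ge1 ?mulr0 ?mul0r ?mulr0//.
by rewrite leNgt; apply/negP => h; have := q4_tri x y; lra.
Qed.

(** For s < 1 the Lipschitz bounds on the indicator and on the cutoff give a factor (D + 2) s, and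
    s/(s + c) <= 1 lowers the kernel to c (s + c)^-2. For s >= 1 the cutoff vanishes and s + 1 <= 2
    (s + c) bounds what is left. *)
Let pointwise lo hi y c x (D : R) : 0 < c -> c <= 1 -> 0 <= D ->
  `|\1_(box lo hi) x - \1_(box lo hi) y| <= D * q4 (sub4 y x) ->
  `|\1_(box lo hi) x * Kc c (q4 (sub4 y x)) - \1_(box lo hi) y * full c (q4 (sub4 y x))| <=
   8 * (D + 2) * c * ((q4 (sub4 y x) < 1)%R%:R * (q4 (sub4 y x) + c)^-1 ^+ 2)
   + 64 * c * (q4 (sub4 y x) + 1)^-1 ^+ 3.
Proof.
move=> c0 c1 D0; have := q4_ge0 (sub4 y x); move: (q4 _) => s s0.
have /andP[] := indic01 (box lo hi) x; have /andP[] := indic01 (box lo hi) y.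
move: (\1_ _ x) (\1_ _ y) => a b b0 b1 a0 a1 hab.
have sc : 0 < s + c by rewrite ltr_wpDl.
have S0 : 0 < s + 1 by rewrite ltr_wpDl.
have F0 := full_ge0 c0 s0.
have -> : a * Kc c s - b * full c s = (a * chi s - b) * full c s by rewrite /Kc /full; ring.
rewrite normrM (ger0_norm F0).
have ch0 := chi_ge0 s; have ch1 := chi_le1 s.
have [s1|s1] := ltP s 1.
- have hd : `|a * chi s - b| <= (D + 2) * s.
    rewrite (_ : a * chi s - b = (a - b) * chi s - b * (1 - chi s)); last by ring.
    rewrite (le_trans (ler_normB _ _))// [leRHS]mulrDl lerD//.
      by rewrite normrM (ger0_norm ch0); apply: le_trans hab; rewrite ler_piMr.
    rewrite normrM ger0_norm// ger0_norm ?subr_ge0//.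
    by apply: le_trans (chi_lip s0 s1); rewrite ler_piMl// subr_ge0.
  rewrite mul1r -[leLHS]addr0 lerD//; last by rewrite !mulr_ge0 ?exprn_ge0 ?invr_ge0 ?(ltW S0) ?(ltW c0).
  apply: le_trans (ler_wpM2r F0 hd) _.
  have -> : (D + 2) * s * full c s = 8 * (D + 2) * c * (s + c)^-1 ^+ 2 * (s * (s + c)^-1).
    by rewrite /full; ring.
  apply: ler_piMr; last by rewrite ler_pdivrMr// mul1r lerDl ltW.
  by rewrite !mulr_ge0 ?exprn_ge0 ?invr_ge0 ?(ltW sc) ?(ltW c0)// addr_ge0.
- have e : (s < 1) = false by rewrite ltNge s1.
  rewrite mul0r mulr0 add0r /chi flat_ge1// mulr0 sub0r normrN ger0_norm//.
  apply: le_trans (ler_piMl F0 b1) _.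
  have -> : 64 * c * (s + 1)^-1 ^+ 3 = 8 * c * (2 * (s + 1)^-1) ^+ 3 by ring.
  rewrite /full ler_wpM2l ?mulr_ge0 ?(ltW c0)//.
  rewrite ler_pXn2r// ?nnegrE ?invr_ge0 ?(ltW sc)//; last by rewrite mulr_ge0// invr_ge0 ltW.
  by rewrite -[leLHS]mul1r ler_pdivrMr// mulrAC ler_pdivlMr//; lra.
Qed.

Lemma box_mass_near lo hi y c (D : R) : 0 < c -> c <= 1 -> 0 <= D ->
  (forall x, `|\1_(box lo hi) x - \1_(box lo hi) y| <= D * q4 (sub4 y x) :> R) ->
  `|box_mass lo hi c y - 4 * pi ^+ 2 * \1_(box lo hi) y| <=
   8 * (D + 2) * c * (pi ^+ 2 * (3 - ln c)) + 32 * c * pi ^+ 2.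
Proof.
move=> c0 c1 D0 hD.
have iF : mu.-integrable setT (fun x => (\1_(box lo hi) y * full c (q4 (sub4 y x)))%:E).
  under eq_fun do rewrite EFinM.
  by apply: integrableZl => //; exact: integrable_full.
have eF : (\int[mu]_x (\1_(box lo hi) y * full c (q4 (sub4 y x)))%:E = (4 * pi ^+ 2 * \1_(box lo hi) y)%:E)%E.
  under eq_integral do rewrite EFinM.
  by rewrite integralZl//; [rewrite int4_full// -EFinM mulrC|exact: integrable_full].
have iK := integrable_boxK lo hi y c0.
rewrite -lee_fin -abse_EFin EFinB -box_massE// -eF -integralB//.
apply: le_trans (le_abse_integral _ _ _) _ => //.
  exact: (measurable_int mu (integrableB measurableT iK iF)).
have mA : measurable_fun setT (fun s : R => (s < 1)%R%:R * (s + c)^-1 ^+ 2 : R).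
  apply: measurable_funM; first exact: measurable_ltR.
  apply: measurable_funX; exact: measurable_addV.
have mB : measurable_fun setT (fun s : R => (s + 1)^-1 ^+ 3 : R).
  apply: measurable_funX; exact: measurable_addV.
have A0 (s : R) : 0 <= s -> 0 <= (s < 1)%R%:R * (s + c)^-1 ^+ 2 :> R by move=> s0; rewrite mulr_ge0// sqr_ge0.
have B0 (s : R) : 0 <= s -> 0 <= (s + 1)^-1 ^+ 3 :> R by move=> s0; rewrite exprn_ge0// invr_ge0 addr_ge0.
have k1 : 0 <= 8 * (D + 2) * c by rewrite mulr_ge0 ?(ltW c0)// mulr_ge0// addr_ge0.
have k2 : 0 <= 64 * c by rewrite mulr_ge0// ltW.
apply: (@le_trans _ _ (\int[mu]_x ((8 * (D + 2) * c)%:E * ((q4 (sub4 y x) < 1)%R%:R * (q4 (sub4 y x) + c)^-1 ^+ 2)%:E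
   + (64 * c)%:E * ((q4 (sub4 y x) + 1)^-1 ^+ 3)%:E))%E).
  apply: ge0_le_integral => //.
  - apply: measurableT_comp => //; exact: (measurable_int mu (integrableB measurableT iK iF)).
  - apply: emeasurable_funD; apply: measurable_funeM; apply/measurable_EFinP.
      exact: (measurable_dq2 y mA).
    exact: (measurable_dq2 y mB).
  - move=> x _; rewrite -EFinB abse_EFin -!EFinM -EFinD lee_fin.
    exact: pointwise.
rewrite ge0_integral_lin2//; last 4 first.
- by apply/measurable_EFinP; exact: (measurable_dq2 y mA).
- by apply/measurable_EFinP; exact: (measurable_dq2 y mB).
- by move=> x; rewrite lee_fin A0// q4_ge0.
- by move=> x; rewrite lee_fin B0// q4_ge0.
rewrite (int4_dq2 y mA A0) (int4_dq2 y mB B0) int4_q4_inv3// EFinD leeD//.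
  by rewrite [X in (_ <= X)%E]EFinM lee_wpmul2l// int4_q4_inv2.
by rewrite -EFinM lee_fin mulr1 le_eqVlt; apply/orP; left; apply/eqP; field.
Qed.

Lemma box_mass_cvg lo hi y : off_faces lo hi y ->
  box_mass lo hi n.+1%:R^-1 y @[n --> \oo] --> 4 * pi ^+ 2 * \1_(box lo hi) y.
Proof.
move=> /box_lip[D [D0 hD]].
set L := 4 * _ * _.
pose M := 8 * (D + 2) * pi ^+ 2 * 5 + 32 * pi ^+ 2.
have cv : M * Num.sqrt (n.+1%:R^-1 : R) @[n --> \oo] --> (0 : R).
  rewrite -(mulr0 M); apply: cvgM; [exact: cvg_cst|exact: sqrt_harmonic_cvg].
apply/subr_cvg0; apply/norm_cvg0P.
apply: (@squeeze_cvgr _ _ _ _ (fun=> 0) (fun n => M * Num.sqrt (n.+1%:R^-1 : R))) => //; last exact: cvg_cst.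
apply: nearW => n; rewrite normr_ge0/=.
have c0 : 0 < n.+1%:R^-1 :> R by rewrite invr_gt0.
have c1 : n.+1%:R^-1 <= 1 :> R by rewrite invf_le1// ler1n.
apply: le_trans (box_mass_near c0 c1 D0 hD) _.
have h1 := cln_le c0 c1.
have h2 : n.+1%:R^-1 <= Num.sqrt (n.+1%:R^-1 : R).
  rewrite -[leLHS]sqr_sqrtr ?(ltW c0)//; set t := Num.sqrt _.
  have t0 : 0 <= t by rewrite sqrtr_ge0.
  have t1 : t <= 1 by rewrite -sqrtr1 ler_wsqrtr.
  nra.
rewrite /M [leRHS]mulrDl lerD//.
  rewrite (_ : 8 * (D + 2) * n.+1%:R^-1 * _ = 8 * (D + 2) * pi ^+ 2 * (n.+1%:R^-1 * (3 - ln n.+1%:R^-1))); last by ring.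
  by rewrite -[leRHS]mulrA ler_wpM2l// mulr_ge0 ?sqr_ge0// mulr_ge0// addr_ge0.
by rewrite mulrAC ler_wpM2l// mulr_ge0// sqr_ge0.
Qed.
End KernelLimit.

(** * Almost everywhere representation of u through its Laplacian *)

Section Representation.
Variable R : realType.
Local Notation mu := (@mu4 R).
Local Notation MM := (mu \x mu)%E.
Implicit Types (x y lo hi : pt4 R) (c s : R) (u w H : pt4 R -> R).

Lemma integrable_indic_box lo hi : mu.-integrable setT (fun x => (\1_(box lo hi) x : R)%:E).
Proof.
have [r [r0 hr]] := box_ball lo hi.
apply: (@integrable_ball_bounded _ _ r 1) => //; first exact: measurable_indic_box.
move=> x; rewrite mul1r indicE; case: (boolP (x \in _)) => h; last by rewrite normr0.
by move: h; rewrite inE => /hr ->; rewrite normr1.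
Qed.

(** Since the indicator b is in [0, 1], b |w| <= b + w^2. The first term is integrable because a box
    has finite measure, the second because k is in L1 and w in L2. *)
Lemma box_pot_integrable w (k : R -> R) (K : R) lo hi : measurable_fun setT w ->
  mu.-integrable setT (fun y => (w y ^+ 2)%:E) ->
  measurable_fun setT k -> (forall s, 0 <= k s) -> (\int[mu]_y (k (q4 y))%:E <= K%:E)%E ->
  MM.-integrable setT (fun z => (\1_(box lo hi) z.1 * (k (q4 (sub4 z.2 z.1)) * `|w z.2|))%:E).
Proof.
move=> mw iw mk k0 hK.
have mI := @measurable_indic_box R lo hi; pose w2 y := w y ^+ 2.
have mnw : measurable_fun setT (fun y => `|w y|) by exact: measurableT_comp.
have mw2 : measurable_fun setT w2 by exact: measurable_funX.
have K0 : 0 <= K.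
  by rewrite -lee_fin; apply: le_trans hK; apply: integral_ge0 => y _; rewrite lee_fin.
have mf : measurable_fun setT (fun z : pt4 R * pt4 R =>
    (\1_(box lo hi) z.1 * (k (q4 (sub4 z.2 z.1)) * `|w z.2|))%:E).
  apply/measurable_EFinP; apply: measurable_funM; first exact: (measurableT_comp mI).
  apply/measurable_EFinP; exact: (@measurable_kernel R k (fun y => `|w y|)).
apply/integrable12ltyP => //.
have mp : measurable_fun setT (pot k w2) by exact: measurable_pot.
apply: (@le_lt_trans _ _ (\int[mu]_x (K%:E * (\1_(box lo hi) x)%:E + pot k w2 x))%E).
  apply: ge0_le_integral => //.
  - by move=> x _; apply: integral_ge0.
  - apply: (@measurable_fun_fubini_tonelli_F _ _ _ _ _ mu (fun z => `|(\1_(box lo hi) z.1 * (k (q4 (sub4 z.2 z.1)) * `|w z.2|))%:E|%E)) => //.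
    by apply: measurableT_comp.
  - by apply: emeasurable_funD => //; apply: measurable_funeM; exact/measurable_EFinP.
  move=> x _.
  have mk1 : measurable_fun setT (fun y => (k (q4 (sub4 y x)))%:E).
    by apply/measurable_EFinP; exact: (measurableT_comp mk (measurable_q4 x)).
  have mk2 : measurable_fun setT (fun y => (k (q4 (sub4 y x)) * `|w2 y|)%:E).
    by apply: (@measurable_kernel1 R k (fun y => `|w2 y|)) => //; exact: measurableT_comp.
  have /andP[b0 b1] := indic01 (box lo hi) x.
  apply: (@le_trans _ _ (\int[mu]_y ((\1_(box lo hi) x)%:E * (k (q4 (sub4 y x)))%:E +
      (k (q4 (sub4 y x)) * `|w2 y|)%:E))%E).
    apply: ge0_le_integral => //.
    - apply: measurableT_comp => //; exact: (measurableT_comp mf (measurable_pair1 x)).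
    - by apply: emeasurable_funD => //; exact: measurable_funeM.
    move=> y _; rewrite abse_EFin -EFinM -EFinD lee_fin ger0_norm; last by rewrite !mulr_ge0.
    rewrite /w2 normrX; have := k0 (q4 (sub4 y x)); move: (k _) => a a0.
    move: (\1_ _ _) b0 b1 => b b0 b1; have := normr_ge0 (w y); move: `|w y| => t t0.
    rewrite mulrCA [b * a]mulrC -mulrDr ler_wpM2l//.
    have : b * t <= t by exact: ler_piMl.
    have [h|h] := leP t b; [have := sqr_ge0 t|]; nra.
  rewrite ge0_integralD//; last 3 first.
  - by move=> y _; rewrite mule_ge0 ?lee_fin.
  - exact: measurable_funeM.
  - by move=> y _; rewrite lee_fin mulr_ge0.
  rewrite leeD2r// ge0_integralZl_EFin//; last by move=> y _; rewrite lee_fin.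
  by rewrite (int4_dq x mk k0) muleC lee_wpmul2r ?lee_fin.
rewrite ge0_integralD//; last 3 first.
- by move=> x _; rewrite mule_ge0 ?lee_fin//; have /andP[] := indic01 (box lo hi) x.
- by apply: measurable_funeM; exact/measurable_EFinP.
- by move=> x _; apply: integral_ge0 => y _; rewrite lee_fin mulr_ge0.
rewrite lte_add_pinfty//.
  rewrite ge0_integralZl_EFin//; last first.
    exact/measurable_EFinP.
  rewrite lte_mul_pinfty ?lee_fin//.
  exact: (integral_fune_lt_pinfty measurableT (integrable_indic_box lo hi)).
have fw := integrable_fin_num measurableT iw.
apply: (@le_lt_trans _ _ (K * fine (\int[mu]_y (w y ^+ 2)%:E))%:E); last by rewrite ltry.
apply: (int4_pot mk k0 mw2 K0) => //.
rewrite fineK// le_eqVlt; apply/orP; left; apply/eqP; apply: eq_integral => y _.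
by rewrite /w2 ger0_norm// sqr_ge0.
Qed.

Definition knewton s : R := (s < 1)%R%:R * `|s|^-1.

Lemma measurable_knewton : measurable_fun setT knewton.
Proof.
apply: measurable_funM; first exact: measurable_ltR.
exact: (measurableT_comp (@measurable_invR R) (@normr_measurable R setT)).
Qed.

Lemma knewton_ge0 s : 0 <= knewton s.
Proof. by rewrite mulr_ge0// invr_ge0. Qed.

Lemma int4_knewton : exists C : R, 0 <= C /\ (\int[mu]_y (knewton (q4 y))%:E <= C%:E)%E.
Proof.
have [C [C0 hC]] := @int4_q4_powR R 1 ltr01 (ltr_nat R 1 2).
exists C; split => //; apply: le_trans hC; rewrite le_eqVlt; apply/orP; left; apply/eqP.
apply: eq_integral => y _; rewrite /knewton ger0_norm ?q4_ge0//.
rewrite (_ : 1 - 2 = -1 :> R); last by ring.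
by rewrite powRN powRr1// q4_ge0.
Qed.

(* [Pc c] with its value at [s = 0] removed, so that [knewton] dominates it uniformly in [c]. *)
Definition Pp c s : R := (0 < s)%R%:R * Pc c s.

Lemma measurable_Pp c : measurable_fun setT (Pp c).
Proof.
apply: measurable_funM; last exact: measurable_Pc.
exact: measurable_gtR.
Qed.

Lemma Pp_le c s : 0 <= c -> 0 <= s -> 0 <= Pp c s <= knewton s.
Proof.
move=> c0; rewrite le_eqVlt /Pp => /orP[/eqP <-|s0].
  by rewrite ltxx mul0r lexx /= knewton_ge0.
by rewrite s0 mul1r Pc_ge0 ?(ltW s0)//= /knewton gtr0_norm// Pc_le.
Qed.

Lemma Pp_cvg s : 0 <= s -> Pp n.+1%:R^-1 s @[n --> \oo] --> Pp 0 s.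
Proof.
rewrite le_eqVlt /Pp => /orP[/eqP <-|s0].
  rewrite ltxx mul0r (_ : (fun n => _) = cst 0); first exact: cvg_cst.
  by apply/funext => n; rewrite mul0r.
by apply: cvgM; [exact: cvg_cst|exact: Pc_cvg].
Qed.

(** Formal value at c = 0 of the right side of the kernel identity, hence the candidate for 4 pi^2
    u. *)
Definition repr u H x : \bar R :=
  (\int[mu]_y (u y * Rc 0 (q4 (sub4 y x)) - H y * Pp 0 (q4 (sub4 y x)))%:E)%E.

Lemma integral_indicZ (B : set (pt4 R)) (x : pt4 R) (g : pt4 R -> R) :
  (\int[mu]_y (\1_B x * g y)%:E = (\1_B x)%:E * \int[mu]_y (g y)%:E)%E.
Proof.
rewrite indicE; case: (x \in B) => /=.
  by rewrite mul1e; apply: eq_integral => y _; rewrite mul1r.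
by rewrite mul0e integral0_eq// => y _; rewrite mul0r.
Qed.

Definition kernel_identity u H := forall x c, 0 < c ->
  (\int[mu]_y (u y * Kc c (q4 (sub4 y x)))%:E =
   \int[mu]_y (u y * Rc c (q4 (sub4 y x)) - H y * Pc c (q4 (sub4 y x)))%:E)%E.

(** The kernel identity is integrated in x over the box. On the right, dominated convergence on the
    product space has the majorant [D], independent of c; on the left, Fubini turns the integral
    into that of u times [box_mass], which converges off the faces. Both are limits of one
    sequence. *)
Lemma box_identity u H lo hi : L2 u -> L2 H ->
  kernel_identity u H ->
  (mu.-integrable setT (fun x => (\1_(box lo hi) x)%:E * ((4 * pi ^+ 2 * u x)%:E - repr u H x))%E /\
   \int[mu]_x ((\1_(box lo hi) x)%:E * ((4 * pi ^+ 2 * u x)%:E - repr u H x)) = 0)%E.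
Proof.
move=> Lu LH hid.
have [mu0 iu2] := L2_integrable Lu; have [mH iH2] := L2_integrable LH.
have mI := @measurable_indic_box R lo hi.
pose q (z : pt4 R * pt4 R) := q4 (sub4 z.2 z.1).
have q0 z : 0 <= q z by exact: q4_ge0.
have mq : measurable_fun setT q by exact: measurable_dq.
pose G c (z : pt4 R * pt4 R) := \1_(box lo hi) z.1 * (u z.2 * Rc c (q z) - H z.2 * Pp c (q z)).
have mG c : measurable_fun setT (G c).
  apply: measurable_funM; first exact: (measurableT_comp mI).
  apply: measurable_funB; apply: measurable_funM.
  - exact: (measurableT_comp mu0).
  - exact: (measurableT_comp (measurable_Rc c) mq).
  - exact: (measurableT_comp mH).
  - exact: (measurableT_comp (measurable_Pp c) mq).
have [CR [CR0 hCR]] := Rc_bound R.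
have [CK [CK0 hCK]] := int4_knewton.
pose D1 (z : pt4 R * pt4 R) := \1_(box lo hi) z.1 * ((q z < 1)%R%:R * `|u z.2|).
pose D2 (z : pt4 R * pt4 R) := \1_(box lo hi) z.1 * (knewton (q z) * `|H z.2|).
have mlt : measurable_fun setT (fun s : R => (s < 1)%R%:R : R) by exact: measurable_ltR.
have iD1 : MM.-integrable setT (fun z => (D1 z)%:E).
  exact: (@box_pot_integrable u (fun s => (s < 1)%R%:R) (12 * pi ^+ 2) lo hi mu0 iu2 mlt (fun=> ler0n _ _) (@int4_unit_ball R)).
have iD2 : MM.-integrable setT (fun z => (D2 z)%:E).
  exact: (@box_pot_integrable H knewton CK lo hi mH iH2 measurable_knewton knewton_ge0 hCK).
pose D (z : pt4 R * pt4 R) := CR * D1 z + D2 z.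
have iD : MM.-integrable setT (fun z => (D z)%:E).
  rewrite (_ : (fun z => _) = (fun z => CR%:E * (D1 z)%:E + (D2 z)%:E)%E)//.
  by apply: integrableD => //; exact: integrableZl.
have GD c z : 0 <= c -> `|G c z| <= D z.
  move=> c0; rewrite normrM /D /D1 /D2.
  have /andP[b0 b1] := indic01 (box lo hi) z.1; rewrite (ger0_norm b0); move: (\1_ _ _) b0 b1 => b b0 b1.
  rewrite [CR * _]mulrCA -mulrDr ler_wpM2l// (le_trans (ler_normB _ _))// lerD// normrM.
    by rewrite mulrC [leRHS]mulrA ler_wpM2r// hCR.
  have /andP[p0 p1] := Pp_le c0 (q0 z).
  by rewrite mulrC ler_wpM2r// ger0_norm.
pose cn n : R := n.+1%:R^-1.
have cn0 n : 0 < cn n by rewrite invr_gt0.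
have cvGz z : (G (cn n) z)%:E @[n --> \oo] --> (G 0 z)%:E.
  apply: cvg_EFin; first exact: nearW.
  apply: (@cvgM _ _ _ _ (fun=> \1_(box lo hi) z.1)); first exact: cvg_cst.
  apply: cvgB.
    by apply: (@cvgM _ _ _ _ (fun=> u z.2)); [exact: cvg_cst|exact: Rc_cvg].
  by apply: (@cvgM _ _ _ _ (fun=> H z.2)); [exact: cvg_cst|exact: Pp_cvg].
have [iG0 _ cvG] := @dominated_convergence _ _ _ MM setT measurableT (fun n z => (G (cn n) z)%:E)
  (fun z => (G 0 z)%:E) (fun z => (D z)%:E)
  (fun n => (measurable_EFinP _ _).2 (mG (cn n))) ((measurable_EFinP _ _).2 (mG 0))
  (aeW _ (fun z _ => cvGz z)) iD (aeW _ (fun z n _ => GD (cn n) z (ltW (cn0 n)))).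
pose f c (z : pt4 R * pt4 R) := \1_(box lo hi) z.1 * (u z.2 * Kc c (q z)).
have mf c : measurable_fun setT (f c).
  apply: measurable_funM; first exact: (measurableT_comp mI).
  apply: measurable_funM; first exact: (measurableT_comp mu0).
  exact: (measurableT_comp (measurable_Kc c) mq).
have if_ c : 0 < c -> MM.-integrable setT (fun z => (f c z)%:E).
  move=> c0.
  have iZ : MM.-integrable setT (fun z => (8 * c^-1 ^+ 2)%:E * (D1 z)%:E)%E by exact: integrableZl.
  apply: (le_integrable _ _ _ iZ) => //; first exact/measurable_EFinP.
  move=> z _; rewrite -EFinM !abse_EFin lee_fin /D1.
  have /andP[b0 b1] := indic01 (box lo hi) z.1; rewrite [leLHS]normrM (ger0_norm b0).
  have k0 := Kc_ge0 (ltW c0) (q0 z); have k1 := Kc_le c0 (q0 z).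
  have c2 : 0 <= 8 * c^-1 ^+ 2 by rewrite mulr_ge0// sqr_ge0.
  rewrite [leRHS]ger0_norm; last by apply: mulr_ge0 => //; rewrite !mulr_ge0.
  rewrite [leRHS]mulrCA ler_wpM2l// normrM mulrC [leRHS]mulrA ler_wpM2r//.
  by rewrite ger0_norm.
have fE c y : 0 < c -> (\int[mu]_x (f c (x, y))%:E = (u y * box_mass lo hi c y)%:E)%E.
  move=> c0; rewrite EFinM -box_massE// -integralZl//; last exact: integrable_boxK.
  by apply: eq_integral => x _; rewrite -EFinM /f /=; congr EFin; rewrite mulrCA.
have E1 n : (\int[MM]_z (G (cn n) z)%:E = \int[mu]_y (u y * box_mass lo hi (cn n) y)%:E)%E.
  have iG : MM.-integrable setT (fun z => (G (cn n) z)%:E).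
    apply: (le_integrable _ _ _ iD) => //; first exact/measurable_EFinP.
    move=> z _; rewrite !abse_EFin lee_fin; apply: le_trans (GD _ _ (ltW (cn0 n))) _; exact: ler_norm.
  rewrite -(integral12_prod_meas1 iG).
  under [RHS]eq_integral do rewrite -fE//.
  rewrite -(Fubini (if_ _ (cn0 n))).
  apply: eq_integral => x _; rewrite /fubini_F !integral_indicZ; congr (_ * _)%E.
  rewrite hid//; apply: ae_eq_integral => //.
  - apply/measurable_EFinP; apply: measurable_funB; apply: measurable_funM => //.
      exact: (measurableT_comp (measurable_Rc _) (measurable_q4 x)).
    exact: (measurableT_comp (measurable_Pp _) (measurable_q4 x)).
  - apply/measurable_EFinP; apply: measurable_funB; apply: measurable_funM => //.
      exact: (measurableT_comp (measurable_Rc _) (measurable_q4 x)).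
    exact: (measurableT_comp (measurable_Pc _) (measurable_q4 x)).
  (* [Pp] and [Pc] differ only at y = x, a null set. *)
  - exists [set y | q4 (sub4 y x) = 0]; split.
    + rewrite (_ : [set y | _] = (fun y => q4 (sub4 y x)) @^-1` [set 0])// -[X in measurable X]setTI.
      by apply: measurable_q4.
    + exact: mu4_point.
    + move=> y /=; apply: contra_notP => /eqP qn _.
      rewrite /q /= /Pp (_ : (0 < q4 (sub4 y x)) = true) ?mul1r//.
      by rewrite lt_neqAle eq_sym qn q4_ge0.
have [r [r0 hr]] := box_ball lo hi.
(* A majorant of all box masses: they are at most 4 pi^2 and vanish once |y|^2 reaches 2 + 2r. *)
pose g y : R := 4 * pi ^+ 2 * (q4 y < 2 + 2 * r)%R%:R.
have pi0 : 0 <= 4 * pi ^+ 2 :> R by rewrite mulr_ge0// sqr_ge0.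
have ig : mu.-integrable setT (fun y => (u y * g y)%:E).
  apply: (@integrable_L2_bounded _ _ _ (2 + 2 * r) (4 * pi ^+ 2)) => //.
  - by rewrite addr_ge0// mulr_ge0.
  - by apply: measurable_funM => //; apply: measurable_ltR; exact: measurable_q4_0.
  - by move=> y; rewrite ger0_norm// mulr_ge0.
pose bm n y := (u y * box_mass lo hi (cn n) y)%:E.
pose bL y := (u y * (4 * pi ^+ 2 * \1_(box lo hi) y))%:E.
have mbm n : measurable_fun setT (bm n).
  rewrite (_ : bm n = fubini_G mu (fun z => (f (cn n) z)%:E)); first exact: measurable_fubini_G (if_ _ _).
  by apply/funext => y; rewrite /fubini_G fE.
have mbL : measurable_fun setT bL.
  by apply/measurable_EFinP; apply: measurable_funM => //; exact: measurable_funM.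
have cvb : {ae mu, forall y, [set: pt4 R] y -> bm n y @[n --> \oo] --> bL y}.
  apply: filterS (ae_off_faces lo hi) => y hy _.
  apply: cvg_EFin; first exact: nearW.
  by apply: (@cvgM _ _ _ _ (fun=> u y)); [exact: cvg_cst|exact: box_mass_cvg].
have bmg : {ae mu, forall y n, [set: pt4 R] y -> (`|bm n y| <= `|(u y * g y)%:E|)%E}.
  apply: aeW => y n _; rewrite /bm !abse_EFin lee_fin [leLHS]normrM [leRHS]normrM ler_wpM2l//.
  rewrite ger0_norm ?box_mass_ge0//; apply: le_trans (ler_norm _); rewrite /g; case: ltP => hq.
    by rewrite mulr1 box_mass_le.
  by rewrite mulr0 (box_mass_far _ hr).
have [iB _ cvB] := @dominated_convergence _ _ _ mu setT measurableT bm bL _ mbm mbL cvb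
  (integrable_abse ig) bmg.
have eL : (\int[MM]_z (G 0 z)%:E = \int[mu]_y bL y)%E.
  apply: (cvg_unique _ cvG) => //.
  rewrite (_ : (fun n => _) = (fun n => \int[mu]_x bm n x)%E); first exact: cvB.
  by apply/funext => n; rewrite E1.
have iF := integrable_fubini_F iG0.
have FE : fubini_F mu (fun z => (G 0 z)%:E) = (fun x => (\1_(box lo hi) x)%:E * repr u H x)%E.
  by apply/funext => x; rewrite /fubini_F integral_indicZ.
have eF x : ((\1_(box lo hi) x)%:E * ((4 * pi ^+ 2 * u x)%:E - repr u H x) = bL x - (\1_(box lo hi) x)%:E * repr u H x)%E.
  rewrite muleBr ?fin_num_adde_defr// -EFinM /bL; congr (_ - _)%E; congr EFin; ring.
rewrite FE in iF; under [X in integrable _ _ X]eq_fun do rewrite eF.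
split; first exact: integrableB.
under eq_integral do rewrite eF.
rewrite integralB// -eL -(integral12_prod_meas1 iG0) FE subee//.
by apply: integrable_fin_num.
Qed.
Lemma repr_ae u H : L2 u -> L2 H ->
  kernel_identity u H ->
  {ae mu, forall x, repr u H x = (4 * pi ^+ 2 * u x)%:E}.
Proof.
move=> Lu LH hid.
have := @box_ae0 R _ (fun lo hi => box_identity lo hi Lu LH hid).
apply: filterS => x; case: (repr u H x) => [r||]//= h; congr EFin.
by have := EFin_inj h; lra.
Qed.

(** The kernel of the [Rc] term is bounded and supported in s <= 1, so [pot_young] with t = 1 bounds
    that term by the L2 norm of u and the volume bound 12 pi^2; the remaining term is dominated by
    the Newton potential of [H]. *)
Lemma newton_bound : exists C : R, 0 <= C /\ forall u H (a : R), L2 u -> L2 H ->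
  kernel_identity u H ->
  (\int[mu]_y (u y ^+ 2)%:E <= a%:E)%E ->
  {ae mu, forall x, (`|u x|%:E <= (C * (a + 12 * pi ^+ 2))%:E + pot (@newton R) H x)%E}.
Proof.
have [CR [CR0 hCR]] := Rc_bound R.
have pi0 : 0 < 4 * pi ^+ 2 :> R by rewrite mulr_gt0// exprn_gt0// pi_gt0.
set k := 4 * pi ^+ 2 in pi0.
exists (CR / k * 2^-1); split; first by rewrite !mulr_ge0// invr_ge0 ltW.
move=> u H a Lu LH hid ha.
have [mu0 iu2] := L2_integrable Lu; have [mH iH2] := L2_integrable LH.
apply: filterS (repr_ae Lu LH hid) => x hx.
have mlt : measurable_fun setT (fun s : R => (s < 1)%R%:R : R) by exact: measurable_ltR.
have mnu : measurable_fun setT (fun y => `|u y|) by exact: measurableT_comp.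
have mnH : measurable_fun setT (fun y => `|H y|) by exact: measurableT_comp.
have mR : measurable_fun setT (fun y => Rc 0 (q4 (sub4 y x))).
  exact: (measurableT_comp (measurable_Rc _) (measurable_q4 x)).
have mP : measurable_fun setT (fun y => Pp 0 (q4 (sub4 y x))).
  exact: (measurableT_comp (measurable_Pp _) (measurable_q4 x)).
have mW : measurable_fun setT (fun y => (u y * Rc 0 (q4 (sub4 y x)) - H y * Pp 0 (q4 (sub4 y x)))%:E).
  by apply/measurable_EFinP; apply: measurable_funB; exact: measurable_funM.
have -> : (`|u x|%:E = k^-1%:E * `|repr u H x|)%E.
  by rewrite hx abse_EFin -EFinM normrM (gtr0_norm pi0) mulKf// gt_eqF.
have m1 := @measurable_kernel1 R (fun s => (s < 1)%R%:R) (fun y => `|u y|) x mlt mnu.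
have m2 := @measurable_kernel1 R (@newton R) (fun y => `|H y|) x (@measurable_newton R) mnH.
have CRk : 0 <= CR / k by rewrite mulr_ge0// invr_ge0 ltW.
apply: (@le_trans _ _ (\int[mu]_y ((CR / k)%:E * ((q4 (sub4 y x) < 1)%R%:R * `|u y|)%:E +
   (newton (q4 (sub4 y x)) * `|H y|)%:E))%E).
  apply: (@le_trans _ _ (k^-1%:E * \int[mu]_y `|(u y * Rc 0 (q4 (sub4 y x)) - H y * Pp 0 (q4 (sub4 y x)))%:E|)%E).
    rewrite lee_wpmul2l ?lee_fin ?invr_ge0 ?(ltW pi0)//; exact: le_abse_integral.
  rewrite -ge0_integralZl_EFin ?invr_ge0 ?(ltW pi0)//; last exact: measurableT_comp.
  apply: ge0_le_integral => //.
  - by move=> y _; rewrite mule_ge0 ?lee_fin ?invr_ge0 ?(ltW pi0).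
  - by apply: measurable_funeM; exact: measurableT_comp.
  - by apply: emeasurable_funD => //; exact: measurable_funeM.
  move=> y _; rewrite abse_EFin -!EFinM -EFinD lee_fin.
  have s0 := q4_ge0 (sub4 y x); move: (q4 _) s0 => s s0.
  have /andP[p0 p1] := @Pp_le 0 s (lexx _) s0.
  have r1 := hCR 0 s (lexx _) s0.
  have e : newton s = k^-1 * knewton s by rewrite /newton /knewton -/k invfM mulrCA.
  rewrite e.
  rewrite (_ : CR / k * _ + _ = k^-1 * (CR * (s < 1)%R%:R * `|u y| + knewton s * `|H y|)); last by ring.
  rewrite ler_wpM2l ?invr_ge0 ?(ltW pi0)// (le_trans (ler_normB _ _))// lerD// normrM mulrC ler_wpM2r//.
  by rewrite ger0_norm.
rewrite ge0_integralD//; last 3 first.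
- by move=> y _; rewrite mule_ge0 ?lee_fin// mulr_ge0.
- exact: measurable_funeM.
- by move=> y _; rewrite lee_fin mulr_ge0// newton_ge0.
rewrite leeD2r// ge0_integralZl_EFin//.
rewrite -[X in (_ <= X%:E)%E]mulrA [X in (_ <= X)%E]EFinM lee_wpmul2l ?lee_fin//.
have := @pot_young R (fun s => (s < 1)%R%:R) u x 1 (12 * pi ^+ 2) a mlt (fun=> ler0n _ _) mu0 ltr01 ha.
rewrite invr1 !mul1r; apply.
rewrite (eq_integral (fun y : pt4 R => ((q4 y < 1)%R%:R)%:E)); first exact: int4_unit_ball.
by move=> y _; case: (_ < _); rewrite ?expr1n ?expr0n.
Qed.
End Representation.

(** * Parts (i) and (ii) *)

Section Finiteness.
Variable R : realType.
Local Notation mu := (@mu4 R).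
Implicit Types (x y : pt4 R) (u H : pt4 R -> R) (h : 'I_4 -> pt4 R -> R).

Lemma L2_sum h : (forall i, L2 (h i)) -> L2 (fun y => \sum_(i < 4) h i y).
Proof.
move=> Lh.
have mh i : measurable_fun setT (h i) := (Lh i).1.
have mS : measurable_fun setT (fun y => \sum_(i < 4) h i y) by exact: measurable_sum.
split => //; apply/leb4_integrable.
have iS : mu.-integrable setT (fun y => \sum_(i < 4) (4%:E * (h i y ^+ 2)%:E))%E.
  apply: integrable_sum => // i _; apply: integrableZl => //.
  exact: (L2_integrable (Lh i)).2.
apply: (le_integrable _ _ _ iS) => //.
  by apply/measurable_EFinP; exact: measurable_funX.
move=> y _; rewrite (_ : (\sum_(i < 4) _)%E = (\sum_(i < 4) 4 * h i y ^+ 2)%:E); last first.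
  by rewrite sumEFin.
rewrite !abse_EFin lee_fin; apply: le_trans (ler_norm _).
rewrite ger0_norm ?sqr_ge0// !big_ord_recr !big_ord0 /=.
have sum_sq (p q r t : R) : (0 + p + q + r + t) ^+ 2 <= 0 + 4 * p ^+ 2 + 4 * q ^+ 2 + 4 * r ^+ 2 + 4 * t ^+ 2.
  have := sqr_ge0 (p - q); have := sqr_ge0 (p - r); have := sqr_ge0 (p - t).
  have := sqr_ge0 (q - r); have := sqr_ge0 (q - t); have := sqr_ge0 (r - t); nra.
exact: sum_sq.
Qed.

Lemma W22_newton : exists C : R, 0 <= C /\ forall u h (a : R), L2 u ->
  (forall i, L2 (h i)) -> (forall i, weak_deriv [:: i; i] u (h i)) ->
  (\int[mu]_y (u y ^+ 2)%:E <= a%:E)%E ->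
  {ae mu, forall x, (`|u x|%:E <= (C * (a + 12 * pi ^+ 2))%:E + pot (@newton R) (fun y => (\sum_(i < 4) h i y)%R) x)%E}.
Proof.
have [C [C0 hC]] := newton_bound R; exists C; split => // u h a Lu Lh wh ha.
apply: hC => //; first exact: L2_sum.
by move=> x c c0; exact: laplacian_identity.
Qed.

Lemma int4_newton : exists N : R, 0 <= N /\ (\int[mu]_y (newton (q4 y))%:E <= N%:E)%E.
Proof.
have [K [K0 hK]] := int4_knewton R.
have pi0 : 0 < 4 * pi ^+ 2 :> R by rewrite mulr_gt0// exprn_gt0// pi_gt0.
exists ((4 * pi ^+ 2)^-1 * K); split; first by rewrite mulr_ge0// invr_ge0 ltW.
under eq_integral do rewrite /newton invfM mulrCA EFinM.
rewrite ge0_integralZl_EFin//; last 2 first.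
- apply/measurable_EFinP; exact: (measurableT_comp (@measurable_knewton R) (@measurable_q4_0 R)).
- by rewrite invr_ge0 ltW.
by rewrite EFinM lee_wpmul2l ?lee_fin ?invr_ge0 ?(ltW pi0).
Qed.

(** Dominated convergence with majorant H^2: the truncation at level n is 0 at y as soon as n >= |H
    y|. *)
Lemma L2_tail H (e : R) : 0 < e -> L2 H -> exists M : R, 0 <= M /\
  (\int[mu]_y ((H y * (M < `|H y|)%R%:R) ^+ 2)%:E <= e%:E)%E.
Proof.
move=> e0 LH; have [mH iH] := L2_integrable LH.
pose f (n : nat) y := ((H y * (n%:R < `|H y|)%R%:R) ^+ 2)%:E.
have mf n : measurable_fun setT (f n).
  apply/measurable_EFinP; apply: measurable_funX; apply: measurable_funM => //.
  by apply: measurable_gtR; exact: measurableT_comp.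
have cf y : f n y @[n --> \oo] --> 0%E.
  apply: cvg_near_cst; exists (Num.truncn `|H y|).+1 => // n /= hn.
  rewrite /f (_ : (_ < _) = false) ?mulr0 ?expr0n//.
  apply/negbTE; rewrite -leNgt; apply: le_trans (ltW (truncnS_gt _)) _.
  by rewrite ler_nat.
have df n y : (`|f n y| <= (H y ^+ 2)%:E)%E.
  rewrite abse_EFin lee_fin ger0_norm ?sqr_ge0// exprMn ler_piMr ?sqr_ge0//.
  by case: (_ < _); rewrite ?expr1n ?expr0n.
have [_ _ cv] := @dominated_convergence _ _ _ mu setT measurableT f (cst 0%E) _ mf (measurable_cst _)
  (aeW _ (fun y _ => cf y)) iH (aeW _ (fun y n _ => df n y)).
have {}cv : (\int[mu]_y f n y)%E @[n --> \oo] --> (0 : R)%:E by rewrite integral0 in cv.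
have /fine_cvgP[fin cvf] := cv.
have [N _ hN] := fin; have [N' _ hN'] := (@cvgr_lt _ _ _ _ _ _ cvf e e0).
pose n := (N + N')%N.
have n1 : (\int[mu]_y f n y)%E \is a fin_num by apply: hN; rewrite /= leq_addr.
have n2 : fine (\int[mu]_y f n y)%E < e by apply: hN'; rewrite /= leq_addl.
by exists n%:R; split => //; rewrite -(fineK n1) lee_fin ltW.
Qed.

(** Where |H| <= M, the Laplacian adds at most M N to the potential, N bounding the mass of the
    kernel; this joins the constant term [A] of [AT_bound], whose size does not affect the
    admissible exponents. *)
Lemma AT_finite (al be : R) u : 0 < al -> 0 <= be -> be < 4 -> W22 u ->
  (AT_functional al be u < +oo)%E.
Proof.
move=> al0 be0 be4 [Lu [_ W2]].
have [h hh] := choice (fun i => W2 i i).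
have Lh i : L2 (h i) := (hh i).1.
have wh i : weak_deriv [:: i; i] u (h i) := (hh i).2.
pose H y := \sum_(i < 4) h i y.
have LH : L2 H by exact: L2_sum.
have [mu0 iu2] := L2_integrable Lu; have [mH iH2] := L2_integrable LH.
have fu := integrable_fin_num measurableT iu2.
have [C [C0 hC]] := W22_newton.
have [N [N0 hN]] := int4_newton.
pose a := fine (\int[mu]_y (u y ^+ 2)%:E).
have ha : (\int[mu]_y (u y ^+ 2)%:E <= a%:E)%E by rewrite fineK.
have a0 : 0 <= a by apply: fine_ge0; apply: integral_ge0 => y _; rewrite lee_fin sqr_ge0.
have b0 : 0 < 1 - be / 4 by lra.
have pi0 : 0 < pi ^+ 2 :> R by rewrite exprn_gt0// pi_gt0.
(* Makes al * e half of the critical value 32 pi^2 (1 - be/4). *)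
pose e := 16 * pi ^+ 2 * (1 - be / 4) / al.
have e0 : 0 < e by rewrite divr_gt0// mulr_gt0// mulr_gt0.
have [M [M0 hM]] := L2_tail e0 LH.
pose H2 y := H y * (M < `|H y|)%R%:R.
have mH2 : measurable_fun setT H2.
  apply: measurable_funM => //.
  by apply: measurable_gtR; exact: measurableT_comp.
have se : Num.sqrt e ^+ 2 = e by rewrite sqr_sqrtr// ltW.
have A0 : 0 <= C * (a + 12 * pi ^+ 2) + M * N.
  by rewrite addr_ge0 ?mulr_ge0// addr_ge0// mulr_ge0// ltW.
have hal : al * Num.sqrt e ^+ 2 < 32 * pi ^+ 2 * (1 - be / 4).
  by rewrite se /e mulrC divfK ?gt_eqF//; have := mulr_gt0 pi0 b0; lra.
have es0 : 0 < Num.sqrt e by rewrite sqrtr_gt0.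
have [K [K0 hK]] := AT_bound al0 be0 be4 es0 A0 a0 hal.
rewrite /AT_functional leb4_integral.
apply: (@le_lt_trans _ _ K%:E); last exact: ltry.
apply: (hK u H2) => //; first by rewrite se.
apply: filterS (hC u h a Lu Lh wh ha) => x hx.
apply: le_trans hx _; rewrite EFinD -addeA leeD2l//.
have mnw := @measurable_newton R.
have mn x' : measurable_fun setT (fun y => (newton (q4 (sub4 y x')))%:E).
  by apply/measurable_EFinP; exact: (measurableT_comp mnw (measurable_q4 x')).
have m2 : measurable_fun setT (fun y => (newton (q4 (sub4 y x)) * `|H2 y|)%:E).
  by apply: (@measurable_kernel1 R (@newton R) (fun y => `|H2 y|)) => //; exact: measurableT_comp.
apply: (@le_trans _ _ (\int[mu]_y (M%:E * (newton (q4 (sub4 y x)))%:E + (newton (q4 (sub4 y x)) * `|H2 y|)%:E))%E).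
  apply: ge0_le_integral => //.
  - by move=> y _; rewrite lee_fin mulr_ge0// newton_ge0.
  - by apply: (@measurable_kernel1 R (@newton R) (fun y => `|H y|)) => //; exact: measurableT_comp.
  - by apply: emeasurable_funD => //; exact: measurable_funeM.
  move=> y _; rewrite -EFinM -EFinD lee_fin -/(H y) [M * _]mulrC -mulrDr ler_wpM2l ?newton_ge0//.
  rewrite /H2; case: ltP => hy; first by rewrite mulr1 lerDr.
  by rewrite mulr0 normr0 addr0.
rewrite ge0_integralD//; last 3 first.
- by move=> y _; rewrite mule_ge0 ?lee_fin ?newton_ge0.
- exact: measurable_funeM.
- by move=> y _; rewrite lee_fin mulr_ge0// newton_ge0.
rewrite leeD2r// ge0_integralZl_EFin//; last by move=> y _; rewrite lee_fin newton_ge0.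
by rewrite EFinM lee_wpmul2l ?lee_fin// (int4_dq x mnw (@newton_ge0 R)).
Qed.

Lemma integral_npos (f : pt4 R -> R) : (forall x, f x <= 0) -> (\int[mu]_x (f x)%:E <= 0)%E.
Proof.
move=> hf; rewrite integralE integral0_eq; last first.
  by move=> x _; rewrite funeposE; apply/max_idPr; rewrite lee_fin.
by rewrite sub0e oppe_le0; apply: integral_ge0.
Qed.

(** The energy constraint gives squared L2 norms at most 1 for the Laplacian and 1/sigma for u, so
    one constant of [AT_bound] with a = 1 serves the whole class. For al <= 0 the integrand is
    nonpositive. *)
Lemma AT_sup_finite (al be tau sigma : R) : 0 <= be -> be < 4 -> 0 < tau -> 0 < sigma ->
  al < 32 * pi ^+ 2 * (1 - be / 4) -> (AT_sup al be tau sigma < +oo)%E.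
Proof.
move=> be0 be4 tau0 sigma0 hal.
suff [K hK] : exists K : R, forall u, W22 u -> energy_le1 tau sigma u -> (AT_functional al be u <= K%:E)%E.
  apply: (@le_lt_trans _ _ K%:E); last exact: ltry.
  by apply: ub_ereal_sup => _ [u [hW hE] <-]; exact: hK.
have [al0|al0] := leP al 0.
  exists 0 => u _ _; rewrite /AT_functional leb4_integral; apply: integral_npos => x.
  rewrite mulr_le0_ge0 ?invr_ge0 ?powR_ge0// subr_le0 -[leRHS]expR0 ler_expR.
  by rewrite mulr_le0_ge0// sqr_ge0.
have [C [C0 hC]] := W22_newton.
have si0 : 0 <= sigma^-1 by rewrite invr_ge0 ltW.
have A0 : 0 <= C * (sigma^-1 + 12 * pi ^+ 2).
  by rewrite mulr_ge0// addr_ge0// mulr_ge0// sqr_ge0.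
have hal1 : al * 1 ^+ 2 < 32 * pi ^+ 2 * (1 - be / 4) by rewrite expr1n mulr1.
have [K [K0 hK]] := AT_bound al0 be0 be4 ltr01 A0 si0 hal1.
exists K => u [Lu _] [g [h [hg [hh hE]]]].
have Lh i : L2 (h i) := (hh i).1.
have wh i : weak_deriv [:: i; i] u (h i) := (hh i).2.
pose H y := \sum_(i < 4) h i y.
have LH : L2 H by exact: L2_sum.
have [mu0 iu2] := L2_integrable Lu; have [mH iH2] := L2_integrable LH.
rewrite leb4_integral in hE.
have mg i : measurable_fun setT (g i) := (hg i).1.1.
have mS : measurable_fun setT (fun x => \sum_(i < 4) g i x ^+ 2).
  by apply: measurable_sum => i; exact: measurable_funX.
have mE : measurable_fun setT (fun x => (H x ^+ 2 + tau * (\sum_(i < 4) g i x ^+ 2) + sigma * u x ^+ 2)%:E).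
  apply/measurable_EFinP; apply: measurable_funD; last by apply: measurable_funM => //; exact: measurable_funX.
  by apply: measurable_funD; [exact: measurable_funX|exact: measurable_funM].
have g0 x : 0 <= tau * (\sum_(i < 4) g i x ^+ 2).
  by rewrite mulr_ge0 ?(ltW tau0)// sumr_ge0// => i _; rewrite sqr_ge0.
have hH : (\int[mu]_y (H y ^+ 2)%:E <= (1 ^+ 2)%:E)%E.
  rewrite expr1n; apply: le_trans hE; apply: ge0_le_integral => //.
  - by move=> y _; rewrite lee_fin sqr_ge0.
  - by apply/measurable_EFinP; exact: measurable_funX.
  - move=> y _; rewrite lee_fin -addrA lerDl; apply: le_trans (g0 y) _.
    by rewrite lerDl mulr_ge0 ?(ltW sigma0)// sqr_ge0.
have hu : (\int[mu]_y (u y ^+ 2)%:E <= (sigma^-1)%:E)%E.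
  apply: (@le_trans _ _ ((sigma^-1)%:E * \int[mu]_x (H x ^+ 2 + tau * (\sum_(i < 4) g i x ^+ 2) + sigma * u x ^+ 2)%:E)%E); last first.
    by rewrite -[leRHS]mule1 lee_wpmul2l ?lee_fin.
  have e0 x : 0 <= H x ^+ 2 + tau * (\sum_(i < 4) g i x ^+ 2) by rewrite addr_ge0 ?sqr_ge0.
  have s0 x : 0 <= sigma * u x ^+ 2 by rewrite mulr_ge0 ?sqr_ge0 ?ltW.
  rewrite -ge0_integralZl_EFin//; last by move=> x _; rewrite lee_fin; exact: addr_ge0.
  apply: ge0_le_integral => //.
  - by move=> y _; rewrite lee_fin sqr_ge0.
  - by apply/measurable_EFinP; exact: measurable_funX.
  - exact: measurable_funeM.
  move=> y _; rewrite -EFinM lee_fin mulrC ler_pdivlMr// mulrC lerDr; exact: e0.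
rewrite /AT_functional leb4_integral; apply: (hK u H) => //.
exact: hC.
Qed.
End Finiteness.

(** * Classical derivatives as weak derivatives *)

Section IntegrationByParts.
Variable R : realType.
Local Notation mu := (@mu4 R).
Implicit Types (x y : pt4 R) (F G dF : pt4 R -> R).

Lemma int4_shift_integrable F x : mu.-integrable setT (EFin \o F) ->
  mu.-integrable setT (fun y => (F (sub4 y x))%:E) /\
  (\int[mu]_y (F (sub4 y x))%:E = \int[mu]_y (F y)%:E)%E.
Proof.
move=> iF; have mF := measurable_int _ iF.
have mFs : measurable_fun setT (fun y => (F (sub4 y x))%:E).
  exact: (measurableT_comp mF (measurable_sub4 x)).
split.
  apply/integrableP; split => //.
  rewrite (@int4_shift R (fun y => `|(F y)%:E|%E) x)//; last by apply: measurableT_comp.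
  by have /integrableP[] := iF.
rewrite integralE [RHS]integralE; congr (_ - _)%E.
  rewrite (_ : (fun y : pt4 R => (F (sub4 y x))%:E) = (EFin \o F) \o (fun y => sub4 y x))// funepos_comp.
  by apply: (@int4_shift R (EFin \o F)^\+%E x) => //; exact: (measurable_funepos mF).
rewrite (_ : (fun y : pt4 R => (F (sub4 y x))%:E) = (EFin \o F) \o (fun y => sub4 y x))// funeneg_comp.
by apply: (@int4_shift R (EFin \o F)^\-%E x) => //; exact: (measurable_funeneg mF).
Qed.

(** Difference quotients of F integrate to 0 by translation invariance. They converge to dF,
    dominated through the mean value theorem by sup |dF| on a fixed ball. *)
Lemma int4_partial0 F dF i (r : R) : 0 <= r ->
  (forall y, is_derive (coord i y) 1 (fun t => F (upd i t y)) (dF y)) ->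
  continuous F -> continuous dF -> (forall y, r <= q4 y -> F y = 0) ->
  (forall y, r <= q4 y -> dF y = 0) -> (\int[mu]_y (dF y)%:E = 0)%E.
Proof.
move=> r0 hd cF cdF F0 dF0.
have supp (g : pt4 R -> R) : (forall y, r <= q4 y -> g y = 0) -> exists M : R, forall y, M < norm4 y -> g y = 0.
  by move=> h; exists (Num.sqrt r) => y /sqrt_lt_norm4/ltW; exact: h.
have [B [B0 hB]] := continuous_support_bounded cdF (supp _ dF0).
have iF : mu.-integrable setT (EFin \o F).
  have [r' [B' [r'0 h]]] := test_fun_ball cF (supp _ F0).
  by apply: integrable_ball_bounded h => //; exact: continuous_measurable4.
pose tn (n : nat) : R := n.+1%:R^-1.
have t0 n : 0 < tn n by rewrite invr_gt0.
have t1 n : tn n <= 1 by rewrite invf_le1// ler1n.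
(* The shift is - t e_i because [sub4] subtracts; t <= 1 keeps all translated supports in one
   ball. *)
pose xn n : pt4 R := upd i (- tn n) (cst4 0).
have subxn n y : sub4 y (xn n) = upd i (coord i y + tn n) y.
  apply: coord_ext => j; rewrite coord_upd (_ : coord j (sub4 y (xn n)) = coord j y - coord j (xn n)); last first.
    by rewrite /coord /sub4; case: j => [[|[|[|[|//]]]] hj].
  by rewrite coord_upd coord_cst4; case: eqP => [->|_]; rewrite ?opprK ?subr0.
pose f n y := (tn n)^-1 * (F (sub4 y (xn n)) - F y).
have qxn n : q4 (xn n) <= 1.
  rewrite (_ : q4 (xn n) = tn n ^+ 2); last first.
    by rewrite /q4 /xn /upd /cst4; case: (i) => [[|[|[|[|//]]]] hi] /=; ring.
  by rewrite expr_le1// ltW.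
have mf n : measurable_fun setT (fun y => (f n y)%:E).
  apply/measurable_EFinP; apply: measurable_funM => //; apply: measurable_funB; last exact: continuous_measurable4.
  exact: (measurableT_comp (continuous_measurable4 cF) (measurable_sub4 (xn n))).
have mdF : measurable_fun setT (EFin \o dF) by apply/measurable_EFinP; exact: continuous_measurable4.
have cvf y : (f n y)%:E @[n --> \oo] --> (dF y)%:E.
  apply: cvg_EFin; first exact: nearW.
  have [hdv hval] := hd y.
  have tn0 : (forall n, tn n != 0) /\ tn n @[n --> \oo] --> (0 : R).
    by split; [move=> n; rewrite gt_eqF|exact: cvg_harmonic].
  have hc := (cvgr_dnbhsP _ _ _).1 hdv tn tn0.
  rewrite -hval (_ : fine \o _ = (fun n => (tn n)^-1 *: (((fun t : R => F (upd i t y)) \o shift (coord i y)) (tn n *: (1 : R)) -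
     F (upd i (coord i y) y)))); first exact: hc.
  apply/funext => n; rewrite /= /f subxn upd_coord /shift /=.
  by rewrite /GRing.scale/= mulr1 [tn n + _]addrC.
have fB n y : `|f n y| <= B * (q4 y < 2 + 2 * r)%R%:R.
  have [hq|hq] := ltP (q4 y) (2 + 2 * r); last first.
    rewrite mulr0 /f F0; last by have := q4_tri (xn n) y; have := qxn n; lra.
    by rewrite F0 ?subrr ?mulr0 ?normr0//; lra.
  rewrite mulr1 /f subxn.
  have lt : coord i y < coord i y + tn n by rewrite ltrDl.
  have cu (t : R) : is_derive t 1 (fun t : R => F (upd i t y)) (dF (upd i t y)).
    have := hd (upd i t y); rewrite coord_upd eqxx.
    rewrite (_ : (fun s => F (upd i s (upd i t y))) = (fun s => F (upd i s y)))//.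
    by apply/funext => s; congr F; apply: coord_ext => j; rewrite !coord_upd; case: eqP.
  have [c _ hc] := MVT lt (fun t _ => cu t) (continuous_subspaceT (is_derive_continuous cu)).
  move: hc; rewrite upd_coord => ->.
  by rewrite [coord i y + _]addrC addrK mulrC mulfK ?gt_eqF.
have iD : mu.-integrable setT (fun y : pt4 R => (B * (q4 y < 2 + 2 * r)%R%:R)%:E).
  apply: (@integrable_ball_bounded _ _ (2 + 2 * r) B).
  - by rewrite addr_ge0// mulr_ge0.
  - by apply: measurable_funM => //; apply: measurable_ltR; exact: measurable_q4_0.
  - by move=> y; rewrite ger0_norm// mulr_ge0.
have [_ _ cv] := @dominated_convergence _ _ _ mu setT measurableT (fun n y => (f n y)%:E) (EFin \o dF) _ mf mdF
  (aeW _ (fun y _ => cvf y)) iD (aeW _ (fun y n _ => fB n y)).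
apply: (cvg_unique _ cv) => //.
rewrite (_ : (fun n => _) = cst 0%E); first exact: cvg_cst.
apply/funext => n; have [iFn eFn] := int4_shift_integrable (xn n) iF.
rewrite /f; under eq_integral do rewrite EFinM EFinB.
rewrite integralZl//; last exact: integrableB.
by rewrite integralB// eFn subee ?mule0//; exact: integrable_fin_num.
Qed.

(** A syntactic certificate of vanishing for s >= 1, stable under [dx], so that boundary terms
    disappear at every order. *)
Fixpoint vanishing (e : sexpr R) : bool :=
  match e with
  | Flt _ => true
  | Mul e f => vanishing e || vanishing f
  | Add e f => vanishing e && vanishing f
  | _ => false
  end.

Lemma vanishing_dx i e : vanishing e -> vanishing (dx i e).
Proof.
elim: e => //= [e he f hf /andP[/he -> /hf ->]//|e he f hf /orP[h|h]].
  by rewrite h (he h).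
by rewrite h (hf h) !orbT.
Qed.

Lemma ev_vanishing x c e y : vanishing e -> 1 <= q4 (sub4 y x) -> ev x c e y = 0.
Proof.
move=> + hq; elim: e => //= [p _|e he f hf /andP[/he -> /hf ->]|e he f hf /orP[/he ->|/hf ->]].
- exact: flat_ge1.
- by rewrite addr0.
- by rewrite mul0r.
- by rewrite mulr0.
Qed.

Lemma ev_far x c e y : vanishing e -> 2 + 2 * q4 x <= q4 y -> ev x c e y = 0.
Proof. by move=> ve hy; apply: ev_vanishing => //; have := q4_tri x y; lra. Qed.

Lemma ev_support x c e : vanishing e -> exists M : R, forall y, M < norm4 y -> ev x c e y = 0.
Proof.
by move=> ve; exists (Num.sqrt (2 + 2 * q4 x)) => y /sqrt_lt_norm4/ltW; exact: ev_far.
Qed.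

Lemma integrable_support F : continuous F -> (exists M : R, forall y, M < norm4 y -> F y = 0) ->
  mu.-integrable setT (EFin \o F).
Proof.
move=> cF hF; have [r [B [r0 h]]] := test_fun_ball cF hF.
by apply: integrable_ball_bounded h => //; exact: continuous_measurable4.
Qed.

Lemma L2_ev x c e : 0 < c -> vanishing e -> L2 (ev x c e).
Proof.
move=> c0 ve; have ce := @continuous_ev R x c e c0.
split; first exact: continuous_measurable4.
apply/leb4_integrable; apply: (@integrable_support (fun y => ev x c e y ^+ 2)).
  by move=> y; exact: (cvgM (ce y) (ce y)).
by have [M hM] := ev_support x c ve; exists M => y /hM ->; rewrite expr0n.
Qed.

Lemma ibp_ev x c e i G : 0 < c -> vanishing e ->
  (forall y, derivable (fun t => G (upd i t y)) (coord i y) 1) ->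
  continuous G -> continuous (partial i G) ->
  (\int[mu]_y (ev x c e y * partial i G y)%:E = - \int[mu]_y (ev x c (dx i e) y * G y)%:E)%E.
Proof.
move=> c0 ve dG cG cdG.
have vd := vanishing_dx i ve.
have ce := @continuous_ev R x c e c0; have cde := @continuous_ev R x c (dx i e) c0.
have c1 : continuous (fun y => ev x c e y * partial i G y) by move=> y; apply: cvgM; [exact: ce|exact: cdG].
have c2 : continuous (fun y => ev x c (dx i e) y * G y) by move=> y; apply: cvgM; [exact: cde|exact: cG].
have i1 : mu.-integrable setT (EFin \o (fun y => ev x c e y * partial i G y)).
  by apply: integrable_support => //; have [M hM] := ev_support x c ve; exists M => y /hM ->; rewrite mul0r.
have i2 : mu.-integrable setT (EFin \o (fun y => ev x c (dx i e) y * G y)).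
  by apply: integrable_support => //; have [M hM] := ev_support x c vd; exists M => y /hM ->; rewrite mul0r.
have r0 : 0 <= 2 + 2 * q4 x by rewrite addr_ge0// mulr_ge0// q4_ge0.
have := @int4_partial0 (fun y => ev x c e y * G y) (fun y => ev x c e y * partial i G y + ev x c (dx i e) y * G y) i _ r0.
move=> h; have {}h : (\int[mu]_y (ev x c e y * partial i G y + ev x c (dx i e) y * G y)%:E = 0)%E.
  apply: h.
  - move=> y; have h1 := @ev_is_derive R x c i e y c0.
    have h2 : is_derive (coord i y) 1 (fun t => G (upd i t y)) (partial i G y).
      by rewrite /partial derive1E; exact/derivableP.
    apply: (is_derive_eq (is_deriveM h1 h2)); rewrite /GRing.scale/= !upd_coord; ring.
  - by move=> y; apply: cvgM; [exact: ce|exact: cG].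
  - by move=> y; apply: cvgD; [exact: c1|exact: c2].
  - by move=> y hy; rewrite ev_far// mul0r.
  - by move=> y hy; rewrite !ev_far// !mul0r addr0.
have f1 : (\int[mu]_y (ev x c e y * partial i G y)%:E)%E \is a fin_num by exact: integrable_fin_num.
have f2 : (\int[mu]_y (ev x c (dx i e) y * G y)%:E)%E \is a fin_num by exact: integrable_fin_num.
move: h; under eq_integral do rewrite EFinD.
rewrite integralD//; move: f1 f2; case: (\int[mu]_y _)%E => [a||]//; case: (\int[mu]_y _)%E => [b||]// _ _ h.
by congr EFin; have := EFin_inj h; lra.
Qed.

Lemma weak_deriv_ev1 x c e i : 0 < c -> vanishing e -> weak_deriv [:: i] (ev x c e) (ev x c (dx i e)).
Proof.
move=> c0 ve phi [[dphi cphi] _]; rewrite !leb4_integral /= expr1 mulN1e.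
apply: ibp_ev => //; [by move=> y; exact: (dphi [::])|exact: (cphi [::])|exact: (cphi [:: i])].
Qed.

(** In [dpart [:: i; j]] the derivative in i is outermost, so it is moved onto the expression first;
    hence the reversed order [dx j (dx i e)]. *)
Lemma weak_deriv_ev2 x c e i j : 0 < c -> vanishing e ->
  weak_deriv [:: i; j] (ev x c e) (ev x c (dx j (dx i e))).
Proof.
move=> c0 ve phi [[dphi cphi] _]; rewrite !leb4_integral /= sqrrN expr1n mul1e.
rewrite ibp_ev//; last 3 first.
- by move=> y; exact: (dphi [:: j]).
- exact: (cphi [:: j]).
- exact: (cphi [:: i; j]).
rewrite ibp_ev ?oppeK//; first exact: vanishing_dx.
- by move=> y; exact: (dphi [::]).
- exact: (cphi [::]).
- exact: (cphi [:: j]).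
Qed.

Lemma W22_ev x c e : 0 < c -> vanishing e -> W22 (ev x c e).
Proof.
move=> c0 ve; split; first exact: L2_ev.
split=> [i|i j].
  by exists (ev x c (dx i e)); split; [apply: L2_ev => //; exact: vanishing_dx|exact: weak_deriv_ev1].
exists (ev x c (dx j (dx i e))); split; last exact: weak_deriv_ev2.
by apply: L2_ev => //; do 2 apply: vanishing_dx.
Qed.
End IntegrationByParts.

(** * Truncated logarithms and their energy density *)

Section LogBump.
Variable R : realType.
Local Notation mu := (@mu4 R).
Implicit Types (x y : pt4 R) (c s t k : R).

Lemma int4_ball_inv : exists K : R, 0 <= K /\ forall c, 0 < c ->
  (\int[mu]_y ((q4 y < 1)%R%:R * (q4 y + c)^-1)%:E <= K%:E)%E.
Proof.
have [K [K0 hK]] := int4_knewton R; exists K; split => // c c0; apply: le_trans hK.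
have mi : measurable_fun setT (fun y : pt4 R => (q4 y < 1)%R%:R * (q4 y + c)^-1).
  apply: measurable_funM; first by apply: measurable_ltR; exact: measurable_q4_0.
  by apply: measurable_addV; exact: measurable_q4_0.
have mk : measurable_fun setT (fun y : pt4 R => knewton (q4 y)).
  exact: (measurableT_comp (@measurable_knewton R) (@measurable_q4_0 R)).
apply: ae_ge0_le_integral => //.
- by move=> y _; rewrite lee_fin mulr_ge0// invr_ge0 addr_ge0 ?q4_ge0// ltW.
- exact/measurable_EFinP.
- by move=> y _; rewrite lee_fin knewton_ge0.
- exact/measurable_EFinP.
(* At y = 0 [knewton] has the default value 0, so the comparison holds only off this null set. *)
exists [set y | q4 (sub4 y (cst4 0)) = 0]; split.
- rewrite (_ : [set y | _] = (fun y => q4 (sub4 y (cst4 0))) @^-1` [set 0])// -[X in measurable X]setTI.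
  by apply: measurable_q4.
- exact: mu4_point.
- move=> y /=; apply: contra_notP => /eqP qn _.
  have {}qn : 0 < q4 y.
    rewrite lt_neqAle q4_ge0 andbT eq_sym; move: qn; rewrite (_ : sub4 y (cst4 0) = y)//.
    by apply: coord_ext => j; rewrite /sub4 /cst4 /coord /= !subr0.
  rewrite lee_fin /knewton gtr0_norm// ler_wpM2l// lef_pV2 ?posrE ?lerDl ?ltW//.
  by rewrite addr_gt0.
Qed.

(** For t <= 1 and r = sqrt(t) the left side is 4 (r ln r)^2. The range up to 2 covers s + c; the
    result bounds ln(s + c)^2 by 4 / (s + c), a lower-order term. *)
Lemma ln_sq_le t : 0 < t -> t <= 2 -> t * ln t ^+ 2 <= 4.
Proof.
move=> t0 t2; have [t1|t1] := leP t 1.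
- set r := Num.sqrt t; have r0 : 0 < r by rewrite sqrtr_gt0.
  have e : t = r ^+ 2 by rewrite sqr_sqrtr// ltW.
  have h2 := mul_oppln_le1 r0.
  have h3 : 0 <= r * - ln r.
    by rewrite mulr_ge0 ?(ltW r0)// oppr_ge0 ln_le0// -sqrtr1 ler_wsqrtr.
  rewrite e lnXn// -mulr_natl (_ : _ * _ = 4 * (r * - ln r) ^+ 2); last by ring.
  by have := expr_le1 (n := 2) isT h3; rewrite h2; lra.
- have h0 : 0 <= ln t by rewrite ln_ge0// ltW.
  have := @le_ln1Dx R (t - 1); rewrite (_ : 1 + (t - 1) = t); last by ring.
  move=> h; have h1 : ln t <= t - 1 by apply: h; lra.
  have h2 : ln t ^+ 2 <= 1 by rewrite expr_le1//; lra.
  by have := ler_pM (ltW t0) (sqr_ge0 (ln t)) t2 h2; lra.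
Qed.

Definition log_bump k : sexpr R := Mul (Flt (@bump_poly R)) (Mul (Cst k) (Lg R)).

Lemma ev_log_bump x c k y : ev x c (log_bump k) y = chi (q4 (sub4 y x)) * (k * ln (q4 (sub4 y x) + c)).
Proof. by []. Qed.

Local Opaque Qe.
Lemma log_bump_dx x c k i y (s := q4 (sub4 y x)) (F := (s + c)^-1) (L := ln (s + c))
   (f0 := chi s) (f1 := flat (dflat (@bump_poly R)) (1 - s ^+ 2)) :
  ev x c (dx i (log_bump k)) y = 2 * k * (coord i y - coord i x) * (- 2 * s * f1 * L + f0 * F).
Proof. by rewrite /= evQe -/s -/F -/L -/f1 -/(chi s) -/f0; ring. Qed.

Lemma log_bump_dxdx x c k i y (s := q4 (sub4 y x)) (F := (s + c)^-1) (L := ln (s + c))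
   (f0 := chi s) (f1 := flat (dflat (@bump_poly R)) (1 - s ^+ 2))
   (f2 := flat (dflat (dflat (@bump_poly R))) (1 - s ^+ 2)) :
  ev x c (dx i (dx i (log_bump k))) y =
  2 * k * (- 2 * s * f1 * L + f0 * F) +
  4 * (coord i y - coord i x) ^+ 2 * (k * ((- 2 * f1 + 4 * s ^+ 2 * f2) * L - 4 * s * f1 * F - f0 * F ^+ 2)).
Proof.
rewrite /= ?eqxx evQe ev_dxQe -/s -/F -/L -/f1 -/f2 -/(chi s) -/f0.
rewrite (_ : (true%:R : R) = 1)//; ring.
Qed.
Local Transparent Qe.

Lemma sum_coord_sq x y : \sum_(i < 4) (coord i y - coord i x) ^+ 2 = q4 (sub4 y x).
Proof. by rewrite !big_ord_recr big_ord0/= add0r /q4 /sub4 /coord. Qed.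

Definition log_energy (tau sigma : R) c k y : R :=
  (\sum_(i < 4) ev (cst4 0) c (dx i (dx i (log_bump k))) y) ^+ 2 +
  tau * (\sum_(i < 4) ev (cst4 0) c (dx i (log_bump k)) y ^+ 2) +
  sigma * ev (cst4 0) c (log_bump k) y ^+ 2.

Lemma sub4_0 y : sub4 y (cst4 0) = y.
Proof. by apply: coord_ext => j; rewrite /sub4 /cst4 /coord /= !subr0. Qed.

(** With F = 1/(s + c), the Laplacian is k times the cutoff times 4 F + 4 c F^2, plus a remainder
    bounded by [E0]. Only 16 F^2 has an integral that diverges logarithmically; c F^3, F and
    constants on the ball, which absorb the gradient and zero-order terms, have bounded
    integrals. *)
Lemma log_energy_le (tau sigma : R) : 0 < tau -> 0 < sigma -> exists A D : R, 0 <= A /\ 0 <= D /\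
  forall c k y, 0 < c -> c <= 1 -> log_energy tau sigma c k y <=
   k ^+ 2 * ((q4 y < 1)%R%:R * (16 * (q4 y + c)^-1 ^+ 2 + A * (q4 y + c)^-1 + D) + 48 * c * (q4 y + c)^-1 ^+ 3).
Proof.
move=> tau0 sigma0.
have [C1 [C10 h1]] := flat_bnd (dflat (@bump_poly R)).
have [C2 [C20 h2]] := flat_bnd (dflat (dflat (@bump_poly R))).
pose E0 := 2 * (24 * C1 + 16 * C2) + 16 * C1.
have E00 : 0 <= E0 by rewrite /E0; lra.
exists (16 * E0 + 8 * tau + 4 * sigma), (E0 ^+ 2 + 128 * C1 ^+ 2 * tau).
split; first by lra.
split; first by rewrite addr_ge0 ?sqr_ge0// !mulr_ge0 ?sqr_ge0// ltW.
move=> c k y c0 c1.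
rewrite /log_energy.
under eq_bigr do rewrite log_bump_dxdx.
rewrite [X in X ^+ 2 + _]sum_affine.
under [X in _ + tau * X + _]eq_bigr do rewrite log_bump_dx mulrAC exprMn.
rewrite ev_log_bump -big_distrr [X in _ + tau * X + _]/= sum_coord_sq sub4_0.
have := q4_ge0 y; move: (q4 y) => s s0.
have t0 : 0 < s + c by rewrite ltr_wpDl.
have F0 : 0 < (s + c)^-1 by rewrite invr_gt0.
have cF3 : 0 <= 48 * c * (s + c)^-1 ^+ 3.
  by rewrite mulr_ge0 ?exprn_ge0 ?(ltW F0)// mulr_ge0// ltW.
have [s1|s1] := ltP s 1; last first.
  rewrite /chi !flat_ge1// !(mulr0, mul0r, add0r, addr0, subr0, oppr0) !expr0n/= !(mulr0, mul0r, add0r, addr0).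
  by rewrite mulr_ge0 ?sqr_ge0.
rewrite mul1r.
have ub : 1 - s ^+ 2 <= 1 by rewrite gerBl sqr_ge0.
have {}h1 := h1 _ ub; have {}h2 := h2 _ ub.
have ch0 := chi_ge0 s; have ch1 := chi_le1 s.
have hL : (s + c) * ln (s + c) ^+ 2 <= 4 by apply: ln_sq_le => //; lra.
have tF : (s + c) * (s + c)^-1 = 1 by rewrite mulfV// gt_eqF.
move: (flat _ _) (flat (dflat (dflat _)) _) (chi s) h1 h2 ch0 ch1 => f1 f2 f0.
move: (s + c)^-1 (ln (s + c)) F0 cF3 hL tF => F L F0 cF3 hL tF h1 h2 f00 f01.
have cF : c * F <= 1 by rewrite -tF ler_wpM2r ?(ltW F0)// lerDr.
have sF : s * F <= 1 by rewrite -tF ler_wpM2r ?(ltW F0)// lerDl ltW.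
have sF0 : 0 <= s * F by rewrite mulr_ge0// ltW.
have cF0 : 0 <= c * F by rewrite mulr_ge0 ?(ltW F0)// ltW.
have sL : s * L ^+ 2 <= 4 by apply: le_trans hL; rewrite ler_wpM2r ?sqr_ge0// lerDl ltW.
have L2 : L ^+ 2 <= 4 * F.
  by have := ler_wpM2r (ltW F0) hL; rewrite mulrAC tF mul1r.
have ss1 : s ^+ 2 <= 1 by rewrite expr_le1// ltW.
have ff1 : f0 ^+ 2 <= 1 by rewrite expr_le1.
have ssL : 0 <= s * L ^+ 2 by rewrite mulr_ge0// sqr_ge0.
have sL2 : `|s * L| <= 2.
  rewrite -ler_sqr ?nnegrE// real_normK ?num_real// exprMn.
  rewrite (_ : 2 ^+ 2 = 4 :> R); last by ring.
  apply: le_trans sL; rewrite (_ : s ^+ 2 * L ^+ 2 = s * (s * L ^+ 2)); last by ring.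
  by apply: ler_piMl; [rewrite mulr_ge0// sqr_ge0|exact: ltW].
pose E := s * L * (- 24 * f1 + 16 * s ^+ 2 * f2) - 16 * s * (s * F) * f1.
have hE : `|E| <= E0.
  rewrite (le_trans (ler_normB _ _))// lerD//.
    rewrite normrM; apply: ler_pM => //.
    rewrite (le_trans (ler_normD _ _))// lerD//.
      by rewrite normrM normrN normr_nat ler_wpM2l.
    rewrite -mulrA normrM normr_nat ler_wpM2l// normrM ger0_norm ?sqr_ge0//.
    by apply: le_trans h2; rewrite ler_piMl//; nra.
  rewrite -!mulrA normrM normr_nat ler_wpM2l// !normrM (ger0_norm s0) (ger0_norm (ltW F0)).
  by apply: le_trans h1; rewrite mulrA mulrA ler_piMl//; nra.
have -> : 4 * (2 * k * (-2 * s * f1 * L + f0 * F)) + 4 * s * (k * ((-2 * f1 + 4 * s ^+ 2 * f2) * L - 4 * s * f1 * F - f0 * F ^+ 2))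
  = k * (f0 * (8 * F - 4 * (s * F) * F) + E) by rewrite /E; ring.
(* Uses (s + c) F = 1 to expose the leading term 4 F. *)
have e8 : 8 * F - 4 * (s * F) * F = 4 * F + 4 * (c * F) * F.
  rewrite (_ : 8 * F = 4 * F + 4 * ((s + c) * F) * F); first by ring.
  by rewrite tF; ring.
rewrite e8.
have b1 : (f0 * (4 * F + 4 * (c * F) * F) + E) ^+ 2 <= 16 * F ^+ 2 + 48 * c * F ^+ 3 + 16 * E0 * F + E0 ^+ 2.
  set G := 4 * F + 4 * (c * F) * F.
  have G0 : 0 <= G by rewrite addr_ge0// !mulr_ge0// ltW.
  have G8 : G <= 8 * F by rewrite /G; nra.
  have : (f0 * G + E) ^+ 2 <= (G + E0) ^+ 2.
    have GE : 0 <= G + E0 by exact: (addr_ge0 G0 E00).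
    rewrite -real_normK ?num_real// ler_sqr ?nnegrE//.
    rewrite (le_trans (ler_normD _ _))// lerD// ger0_norm ?mulr_ge0//; exact: ler_piMl.
  move=> h; apply: le_trans h _.
  have -> : (G + E0) ^+ 2 = G ^+ 2 + 2 * E0 * G + E0 ^+ 2 by ring.
  rewrite lerD2r; apply: lerD; last by have := ler_wpM2l E00 G8; lra.
  rewrite (_ : G ^+ 2 = 16 * F ^+ 2 + 32 * c * F ^+ 3 + 16 * (c * F ^+ 3) * (c * F)); last by rewrite /G; ring.
  have p : 0 <= c * F ^+ 3 by rewrite mulr_ge0 ?exprn_ge0 ?(ltW F0) ?ltW.
  have := ler_piMr p cF; lra.
have b2 : s * (-2 * s * f1 * L + f0 * F) ^+ 2 <= 32 * C1 ^+ 2 + 2 * F.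
  have p1 : (-2 * s * f1 * L + f0 * F) ^+ 2 <= 2 * (2 * (s * L) * f1) ^+ 2 + 2 * (f0 * F) ^+ 2.
    rewrite -subr_ge0 (_ : _ - _ = (2 * (s * L) * f1 + f0 * F) ^+ 2) ?sqr_ge0//; ring.
  apply: le_trans (ler_wpM2l s0 p1) _.
  rewrite mulrDr; apply: lerD.
    have p2 : f1 ^+ 2 <= C1 ^+ 2 by rewrite -[f1 ^+ 2]real_normK ?num_real// ler_sqr ?nnegrE.
    have p3 : s ^+ 2 * (s * L ^+ 2) <= 4.
      apply: le_trans sL; exact: ler_piMl.
    rewrite [leLHS](_ : _ = 8 * (s ^+ 2 * (s * L ^+ 2) * f1 ^+ 2)); last by ring.
    rewrite (_ : 32 * C1 ^+ 2 = 8 * (4 * C1 ^+ 2)); last by ring.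
    rewrite ler_wpM2l//; apply: ler_pM => //; rewrite ?sqr_ge0// mulr_ge0 ?sqr_ge0// mulr_ge0 ?sqr_ge0//.
  rewrite [leLHS](_ : _ = 2 * (f0 ^+ 2 * (s * F * F))); last by ring.
  rewrite ler_wpM2l//; apply: (@le_trans _ _ (1 * (s * F * F))).
    by rewrite ler_wpM2r// mulr_ge0// ltW.
  by rewrite mul1r ler_piMl// ltW.
have b3 : (f0 * (k * L)) ^+ 2 <= k ^+ 2 * (4 * F).
  rewrite (_ : (f0 * (k * L)) ^+ 2 = k ^+ 2 * (f0 ^+ 2 * L ^+ 2)); last by ring.
  rewrite ler_wpM2l ?sqr_ge0//; apply: le_trans L2; apply: ler_piMl ff1; exact: sqr_ge0.
have k0 := sqr_ge0 k.
have q1 := ler_wpM2l k0 b1.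
have q2 := ler_wpM2l (mulr_ge0 (ltW tau0) k0) b2.
have q3 := ler_wpM2l (ltW sigma0) b3.
rewrite [X in X + _ + _](_ : _ = k ^+ 2 * (f0 * (4 * F + 4 * (c * F) * F) + E) ^+ 2); last by ring.
rewrite [X in _ + X + _](_ : _ = 4 * (tau * k ^+ 2 * (s * (-2 * s * f1 * L + f0 * F) ^+ 2))); last by ring.
apply: le_trans (lerD (lerD q1 (ler_wpM2l (ler0n R 4) q2)) q3) _.
by rewrite le_eqVlt; apply/orP; left; apply/eqP; ring.
Qed.
End LogBump.

(** * Part (iii) *)

Section Sharpness.
Variable R : realType.
Local Notation mu := (@mu4 R).
Implicit Types (x y : pt4 R) (c s t k : R).

Lemma int4_log_energy (tau sigma : R) : 0 < tau -> 0 < sigma -> exists C : R, 0 <= C /\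
  forall c k, 0 < c -> c <= 1 ->
  (\int[mu]_y (log_energy tau sigma c k y)%:E <= (k ^+ 2 * (16 * pi ^+ 2 * - ln c + C))%:E)%E.
Proof.
move=> tau0 sigma0; have [A [D [A0 [D0 hAD]]]] := log_energy_le tau0 sigma0.
have [K [K0 hK]] := int4_ball_inv R.
have pi0 : 0 <= pi ^+ 2 :> R by exact: sqr_ge0.
(* In order: 16 * 3 pi^2 from [int4_q4_inv2], the integrals of F and of the constant over the ball,
   and 48 c * pi^2 / (2 c). *)
exists (48 * pi ^+ 2 + A * K + D * (12 * pi ^+ 2) + 24 * pi ^+ 2); split.
  by have := mulr_ge0 A0 K0; have := mulr_ge0 D0 pi0; lra.
move=> c k c0 c1.
have k0 := sqr_ge0 k.
have q0 y : 0 < q4 y + c by rewrite ltr_wpDl ?q4_ge0.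
have qi y : 0 <= (q4 y + c)^-1 by rewrite invr_ge0 ltW.
have mlt : measurable_fun setT (fun y : pt4 R => (q4 y < 1)%R%:R : R).
  by apply: measurable_ltR; exact: measurable_q4_0.
have mi : measurable_fun setT (fun y : pt4 R => (q4 y + c)^-1).
  by apply: measurable_addV; exact: measurable_q4_0.
pose f1 y := ((q4 y < 1)%R%:R * (q4 y + c)^-1 ^+ 2)%:E.
pose f2 y := ((q4 y < 1)%R%:R * (q4 y + c)^-1)%:E.
pose f3 y := ((q4 y < 1)%R%:R : R)%:E.
pose f4 y := ((q4 y + c)^-1 ^+ 3)%:E.
have m1 : measurable_fun setT f1 by apply/measurable_EFinP; apply: measurable_funM => //; exact: measurable_funX.
have m2 : measurable_fun setT f2 by apply/measurable_EFinP; exact: measurable_funM.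
have m3 : measurable_fun setT f3 by exact/measurable_EFinP.
have m4 : measurable_fun setT f4 by apply/measurable_EFinP; exact: measurable_funX.
have p1 y : (0 <= f1 y)%E by rewrite lee_fin mulr_ge0// exprn_ge0.
have p2 y : (0 <= f2 y)%E by rewrite lee_fin mulr_ge0.
have p3 y : (0 <= f3 y)%E by rewrite lee_fin.
have p4 y : (0 <= f4 y)%E by rewrite lee_fin exprn_ge0.
have c48 : 0 <= 48 * c by rewrite mulr_ge0// ltW.
have c16 : 0 <= 16 :> R by [].
have n1 : measurable_fun setT (fun y => 16%:E * f1 y + A%:E * f2 y)%E.
  by apply: emeasurable_funD; exact: measurable_funeM.
have n2 : measurable_fun setT (fun y => D%:E * f3 y + (48 * c)%:E * f4 y)%E.
  by apply: emeasurable_funD; exact: measurable_funeM.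
have g1 y : (0 <= 16%:E * f1 y + A%:E * f2 y)%E by apply: adde_ge0; apply: mule_ge0.
have g2 y : (0 <= D%:E * f3 y + (48 * c)%:E * f4 y)%E by apply: adde_ge0; apply: mule_ge0.
have E0 : (\int[mu]_y ((k ^+ 2)%:E * (16%:E * f1 y + A%:E * f2 y + (D%:E * f3 y + (48 * c)%:E * f4 y))) <=
    (k ^+ 2 * (16 * pi ^+ 2 * - ln c + (48 * pi ^+ 2 + A * K + D * (12 * pi ^+ 2) + 24 * pi ^+ 2)))%:E)%E.
  rewrite ge0_integralZl_EFin//; last 2 first.
  - by move=> y _; apply: adde_ge0.
  - exact: emeasurable_funD.
  rewrite [X in (_ <= X)%E]EFinM lee_wpmul2l ?lee_fin//.
  rewrite ge0_integralD// !ge0_integral_lin2//.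
  have hK1 := lee_wpmul2l (A0 : (0 <= A%:E)%E) (hK c c0).
  have h1 := lee_wpmul2l (c16 : (0 <= 16%:E)%E) (int4_q4_inv2 c0 c1).
  have h3 := lee_wpmul2l (D0 : (0 <= D%:E)%E) (@int4_unit_ball R).
  apply: (le_trans (leeD (leeD h1 hK1) (leeD h3 (lexx _)))).
  rewrite int4_q4_inv3// -!EFinM -!EFinD lee_fin.
  rewrite (_ : 48 * c * (pi ^+ 2 / (2 * c)) = 24 * pi ^+ 2); last by field; rewrite gt_eqF.
  by rewrite le_eqVlt; apply/orP; left; apply/eqP; ring.
apply: le_trans E0; apply: ge0_le_integral => //.
- move=> y _; rewrite lee_fin /log_energy.
  apply: addr_ge0; last by apply: mulr_ge0; [exact: ltW|exact: sqr_ge0].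
  apply: addr_ge0; first exact: sqr_ge0.
  by apply: mulr_ge0; [exact: ltW|apply: sumr_ge0 => i _; exact: sqr_ge0].
- apply/measurable_EFinP.
  have mev e : measurable_fun setT (ev (cst4 0) c e) by apply: continuous_measurable4; exact: continuous_ev.
  apply: measurable_funD; last by apply: measurable_funM => //; apply: measurable_funX; exact: mev.
  apply: measurable_funD; first by apply: measurable_funX; apply: measurable_sum => i; exact: mev.
  by apply: measurable_funM => //; apply: measurable_sum => i; apply: measurable_funX; exact: mev.
- by apply: measurable_funeM; exact: emeasurable_funD.
move=> y _.
rewrite (_ : (_ * _)%E = (k ^+ 2 * (16 * ((q4 y < 1)%R%:R * (q4 y + c)^-1 ^+ 2) +
  A * ((q4 y < 1)%R%:R * (q4 y + c)^-1) + (D * (q4 y < 1)%R%:R + 48 * c * (q4 y + c)^-1 ^+ 3)))%:E)// lee_fin.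
apply: le_trans (hAD c k y c0 c1) _.
by rewrite le_eqVlt; apply/orP; left; apply/eqP; ring.
Qed.

Lemma mu4_cube (a : R) : 0 <= a -> mu (box (cst4 0) (cst4 a)) = (a ^+ 4)%:E.
Proof.
move=> a0; pose I := `]0, a[%classic : set R.
have mI : measurable I by exact: measurable_itv.
have lI : @leb1 R I = a%:E.
  transitivity (@lebesgue_measure R I) => //; rewrite lebesgue_measure_itv /= lte_fin.
  by case: ltP => h; [rewrite -EFinB subr0|congr EFin; apply/eqP; rewrite eq_le a0].
rewrite (_ : box _ _ = I `*` I `*` I `*` I); last first.
  apply/seteqP; split => [[[[p q] r] s] h|[[[p q] r] s] /= [[[]]]].
    have := h 0; have := h 1; have := h (inord 2); have := h (inord 3).
    by rewrite !coord_cst4 /coord /= !inordK// /I /= !in_itv.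
  rewrite /I /= !in_itv /= => h0 h1 h2 h3 i; rewrite !coord_cst4 /coord /=.
  by case: i => [[|[|[|[|//]]]] hi].
rewrite [LHS](@product_measure1E _ _ _ _ _ (prodms (prodms (@leb1 R) (@leb1 R)) (@leb1 R)) (@leb1 R))//; last first.
  by do !apply: measurableX.
rewrite [X in (X * _)%E](@product_measure1E _ _ _ _ _ (prodms (@leb1 R) (@leb1 R)) (@leb1 R))//; last exact: measurableX.
rewrite [X in (X * _ * _)%E](@product_measure1E _ _ _ _ _ (@leb1 R) (@leb1 R))//.
by rewrite [X in (X * _ * _ * _)%E]lI [X in (_ * X * _ * _)%E]lI [X in (_ * _ * X * _)%E]lI [X in (_ * _ * _ * X)%E]lI -!EFinM; congr EFin; ring.
Qed.

(* The cube lies in the open positive orthant, away from the origin, where dividing by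
   [norm4 x `^ be = 0] gives the junk value 0. *)
Lemma AT_cube_lower (al be a v : R) (u : pt4 R -> R) : 0 < al -> 0 <= be -> 0 < a -> 0 <= v ->
  measurable_fun setT u ->
  (forall x, 0 < q4 x -> q4 x < (2 * a) ^+ 2 -> v <= u x ^+ 2) ->
  ((a ^+ 4 * ((expR (al * v) - 1) / (2 * a) `^ be))%:E <= AT_functional al be u)%E.
Proof.
move=> al0 be0 a0 v0 mu0 hu; rewrite /AT_functional leb4_integral.
have a2 : 0 < 2 * a by rewrite mulr_gt0.
set X := (expR (al * v) - 1) / (2 * a) `^ be.
have X0 : 0 <= X.
  by rewrite mulr_ge0 ?invr_ge0 ?powR_ge0// subr_ge0 -[leLHS]expR0 ler_expR mulr_ge0// ltW.
have mb := measurable_box (cst4 0) (cst4 a).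
apply: (@le_trans _ _ (\int[mu]_x (X%:E * (\1_(box (cst4 0) (cst4 a)) x)%:E))%E).
  rewrite ge0_integralZl_EFin//; last first.
    by apply/measurable_EFinP; exact: measurable_indic.
  rewrite integral_indic// setIT [X in (_ <= _ * X)%E](mu4_cube (ltW a0)).
  by rewrite -EFinM mulrC.
apply: ge0_le_integral => //.
- by move=> x _; rewrite mule_ge0// lee_fin.
- by apply: measurable_funeM; apply/measurable_EFinP; exact: measurable_indic.
- by apply/measurable_EFinP; exact: measurable_AT.
move=> x _; rewrite -EFinM lee_fin indicE.
have u0 : 0 <= expR (al * u x ^+ 2) - 1.
  by rewrite subr_ge0 -[leLHS]expR0 ler_expR mulr_ge0 ?sqr_ge0// ltW.
case: (boolP (x \in _)) => hx; last by rewrite mulr0 mulr_ge0// invr_ge0 powR_ge0.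
rewrite mulr1; move: hx; rewrite inE => hx.
have hc i : 0 < coord i x < a by have := hx i; rewrite !coord_cst4.
have q0 : 0 < q4 x.
  have /andP[h _] := hc 0; apply: lt_le_trans (_ : coord 0 x ^+ 2 <= _); first by rewrite exprn_gt0.
  by have := coord_sq_le 0 (cst4 0) x; rewrite coord_cst4 subr0 sub4_0.
have qa : q4 x < (2 * a) ^+ 2.
  have h i : coord i x ^+ 2 < a ^+ 2.
    by have /andP[h0 h1] := hc i; rewrite ltr_pXn2r// ?nnegrE ltW.
  have := h 0; have := h 1; have := h (inord 2); have := h (inord 3).
  by rewrite /coord /= !inordK// /q4; lra.
have n0 : 0 < norm4 x by rewrite norm4E sqrtr_gt0.
have na : norm4 x <= 2 * a.
  by rewrite norm4E -[leRHS]ger0_norm ?(ltW a2)// -sqrtr_sqr ler_wsqrtr// ltW.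
apply: ler_pM => //.
- by rewrite subr_ge0 -[leLHS]expR0 ler_expR mulr_ge0// ltW.
- by rewrite invr_ge0 powR_ge0.
- by rewrite lerD2r ler_expR ler_wpM2l ?(ltW al0)// hu.
- by rewrite lef_pV2 ?posrE ?powR_gt0// ge0_ler_powR// ?nnegrE ltW.
Qed.

(** For s < c the cutoff is at least 1 - 2c and - ln(s + c) >= - ln(2c) >= T - 1. The product loses
    at most 2 more because c T <= 1. *)
Lemma log_bump_lower (T c : R) x : 3 <= T -> c = expR (- T) -> q4 x < c ->
  T - 3 <= chi (q4 x) * - ln (q4 x + c).
Proof.
move=> T3 cE hx; have s0 := q4_ge0 x; move: (q4 x) s0 hx => s s0 hx.
have c0 : 0 < c by rewrite cE expR_gt0.
have cT : c * T <= 1.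
  rewrite cE expRN mulrC ler_pdivrMr ?expR_gt0// mul1r.
  by have := @expR_ge1Dx R T; lra.
have c3 : c <= 3^-1.
  by rewrite -[leRHS]mul1r ler_pdivlMr//; apply: le_trans cT; rewrite ler_wpM2l// ltW.
have h1 : 1 - 2 * c <= chi s by have := chi_lip s0 (_ : s < 1); lra.
have h2 : T - 1 <= - ln (s + c).
  have l1 : ln (s + c) <= ln (2 * c) by rewrite ler_ln ?posrE; lra.
  have l2 : ln (2 * c) <= 1 - T.
    rewrite lnM ?posrE// cE expRK; have := @le_ln1Dx R 1; rewrite -[1 + 1]/(2) => h.
    lra.
  lra.
apply: (@le_trans _ _ ((1 - 2 * c) * (T - 1))); first by nra.
by apply: ler_pM => //; lra.
Qed.
Lemma log_bump_energy (tau sigma C T : R) : 0 < tau -> 0 < sigma -> 0 <= C -> 0 < T ->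
  (forall c k, 0 < c -> c <= 1 ->
    (\int[mu]_y (log_energy tau sigma c k y)%:E <= (k ^+ 2 * (16 * pi ^+ 2 * - ln c + C))%:E)%E) ->
  energy_le1 tau sigma (ev (cst4 0) (expR (- T)) (log_bump (- (Num.sqrt (16 * pi ^+ 2 * T + C))^-1))).
Proof.
move=> tau0 sigma0 C0 T0 hC.
have N0 : 0 < 16 * pi ^+ 2 * T + C.
  by rewrite ltr_wpDr// !mulr_gt0// pi_gt0.
have c0 : 0 < expR (- T) by exact: expR_gt0.
have c1 : expR (- T) <= 1 by rewrite -[leRHS]expR0 ler_expR oppr_le0 ltW.
set k := - _^-1.
exists (fun i => ev (cst4 0) (expR (- T)) (dx i (log_bump k))),
  (fun i => ev (cst4 0) (expR (- T)) (dx i (dx i (log_bump k)))); split; last split.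
- by move=> i; split; [exact: L2_ev|exact: weak_deriv_ev1].
- by move=> i; split; [exact: L2_ev|exact: weak_deriv_ev2].
rewrite leb4_integral; apply: (le_trans (hC _ k c0 c1)).
rewrite expRK opprK lee_fin /k sqrrN exprVn sqr_sqrtr ?(ltW N0)// mulVf// gt_eqF//.
Qed.

(** On |x|^2 < c = exp(-T) the normalised bump has square about T / (16 pi^2), while volume and
    weight contribute c^(2 - be/2) = exp(- 2 b T). The functional is then at least about exp(eta T),
    and eta > 0 exactly above the critical exponent. *)
Lemma AT_sup_infinite (al be tau sigma : R) : 0 <= be -> be < 4 -> 0 < tau -> 0 < sigma ->
  32 * pi ^+ 2 * (1 - be / 4) < al -> AT_sup al be tau sigma = +oo%E.
Proof.
move=> be0 be4 tau0 sigma0 hal.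
have pi0 : 0 < 16 * pi ^+ 2 :> R by rewrite mulr_gt0// exprn_gt0// pi_gt0.
have [C [C0 hC]] := int4_log_energy tau0 sigma0.
apply/eqyP => M M0.
pose p : R := 16 * pi ^+ 2; pose D := C / p; pose b := 1 - be / 4.
have p0 : 0 < p by [].
have D0 : 0 <= D by rewrite divr_ge0// ltW.
have b0 : 0 < b by rewrite /b; lra.
have p32 : 32 * pi ^+ 2 = 2 * p by rewrite /p; ring.
have al0 : 0 < al by apply: lt_trans hal; rewrite p32 mulr_gt0// mulr_gt0.
pose eta := al / p - 2 * b.
have eta0 : 0 < eta.
  by rewrite subr_gt0 ltr_pdivlMr// (_ : 2 * b * p = 32 * pi ^+ 2 * (1 - be / 4))// /b /p; ring.
pose K := al / p * (6 + D).
(* Since exp(x) >= 1 + x, it suffices that eta T - K reaches 16 M; the 16 comes from a^4 =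
   exp(-2T)/16, and T >= 3 is required by [log_bump_lower]. *)
pose T := Num.max 3 ((16 * M + K) / eta).
have T3 : 3 <= T by rewrite le_max lexx.
have TM : 16 * M + K <= eta * T by rewrite [leRHS]mulrC -ler_pdivrMr// le_max lexx orbT.
have T0 : 0 < T by apply: lt_le_trans T3.
pose N := 16 * pi ^+ 2 * T + C.
have N0 : 0 < N by rewrite ltr_wpDr// mulr_gt0.
pose k := - (Num.sqrt N)^-1.
pose c := expR (- T).
have c0 : 0 < c by exact: expR_gt0.
pose u := ev (cst4 0) c (log_bump k).
have hW : W22 u by exact: W22_ev.
have hE : energy_le1 tau sigma u by exact: log_bump_energy.
(* Half of sqrt(c), so that (2 a)^2 = c and the cube of side a lies where the lower bound holds. *)
pose a := expR (- T / 2) / 2.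
have a0 : 0 < a by rewrite divr_gt0// expR_gt0.
have a2 : 2 * a = expR (- T / 2) by rewrite /a mulrC divfK.
pose v := (T - 3) ^+ 2 / N.
have v0 : 0 <= v by rewrite mulr_ge0 ?sqr_ge0// invr_ge0 ltW.
have hv x : 0 < q4 x -> q4 x < (2 * a) ^+ 2 -> v <= u x ^+ 2.
  move=> _; rewrite a2 -expRM_natl mulrC divfK// => hx.
  have h := log_bump_lower T3 erefl hx.
  rewrite /u ev_log_bump sub4_0 (_ : (chi _ * _) ^+ 2 = (chi (q4 x) * - ln (q4 x + c)) ^+ 2 * k ^+ 2); last by ring.
  rewrite /k sqrrN exprVn sqr_sqrtr ?(ltW N0)// ler_wpM2r ?invr_ge0 ?(ltW N0)//.
  by rewrite ler_pXn2r ?nnegrE//; lra.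
have mu_ : measurable_fun setT u by apply: continuous_measurable4; exact: continuous_ev.
have low := AT_cube_lower al0 be0 a0 v0 mu_ hv.
apply: (@le_trans _ _ (AT_functional al be u)); last first.
  by apply: ereal_sup_ubound; exists u.
apply: le_trans low; rewrite lee_fin.
(* Linearises (T - 3)^2 / (T + D) from below; the lost constant 6 + D is what [K] compensates. *)
have vl : (T - 6 - D) / p <= v.
  rewrite /v ler_pdivrMr// mulrAC ler_pdivlMr//.
  have -> : N = p * (T + D) by rewrite /N /D -/p mulrDr [p * (C / p)]mulrC divfK// gt_eqF.
  have h : (T - 6 - D) * (T + D) <= (T - 3) ^+ 2 by have := sqr_ge0 D; nra.
  by rewrite mulrCA [leRHS]mulrC ler_wpM2l ?(ltW p0).
have -> : a ^+ 4 * ((expR (al * v) - 1) / (2 * a) `^ be) = (expR (al * v - 2 * b * T) - expR (- (2 * b * T))) / 16.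
  rewrite a2 -expRM -expRN /a expr_div_n -expRM_natl.
  rewrite (_ : expR (al * v - 2 * b * T) = expR (4 * (- T / 2)) * expR (al * v) * expR (- (- T / 2 * be))); last first.
    by rewrite -!expRD; congr expR; rewrite /b; field.
  rewrite (_ : expR (- (2 * b * T)) = expR (4 * (- T / 2)) * expR (- (- T / 2 * be))); last first.
    by rewrite -!expRD; congr expR; rewrite /b; field.
  by field.
rewrite ler_pdivlMr//.
have e1 := @expR_ge1Dx R (al * v - 2 * b * T).
have e2 : expR (- (2 * b * T)) <= 1.
  by rewrite -[leRHS]expR0 ler_expR oppr_le0 !mulr_ge0// ltW.
have av : al / p * (T - 6 - D) <= al * v.
  by rewrite -mulrA ler_wpM2l ?(ltW al0)// mulrC.
have e3 : al / p * (T - 6 - D) = eta * T + 2 * b * T - K by rewrite /eta /K; ring.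
lra.
Qed.
End Sharpness.

Theorem theorem1p1 (R : realType) (beta : R) (hb0 : 0 <= beta) (hb4 : beta < 4) :
  (forall (alpha : R) (u : pt4 R -> R), 0 < alpha -> W22 u ->
     (AT_functional alpha beta u < +oo)%E) /\
  (forall tau sigma alpha : R, 0 < tau -> 0 < sigma ->
     alpha < 32 * pi ^+ 2 * (1 - beta / 4) ->
     (AT_sup alpha beta tau sigma < +oo)%E) /\
  (forall tau sigma alpha : R, 0 < tau -> 0 < sigma ->
     32 * pi ^+ 2 * (1 - beta / 4) < alpha ->
     AT_sup alpha beta tau sigma = +oo%E).
Proof.
split; first by move=> alpha u al0 hu; exact: AT_finite.
split=> tau sigma alpha tau0 sigma0 hal; first exact: AT_sup_finite.
exact: AT_sup_infinite.
Qed.
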